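(* Let $\mathcal{B}\subset\mathcal{L}_{\mathrm{SD}}$ be a Borel set. Then there is a Borel map $(X,Y,\hat A)\in\mathcal{B}\mapsto(Y^\bullet,X^\bullet,\hat A^\bullet)\in\mathcal{L}$ such that, for every $(X,Y,\hat A)\in\mathcal{B}$, the operator $A^\bullet:Y^\bullet\to X^\bullet$ coded by $(Y^\bullet,X^\bullet,\hat A^\bullet)$ is isometric to the adjoint $A^*:Y^*\to X^*$ of the operator $A:X\to Y$ coded by $(X,Y,\hat A)$. Moreover, the set $$\mathcal{C}=\{(X,Y,\hat A,g,x)\in\mathcal{B}\times C(\Delta)\times C(\Delta): g\in Y^\bullet,\ x\in X\}$$ is Borel, and there is a Borel map $\mathcal{C}\to\mathbb{R}$, $(X,Y,\hat A,g,x)\mapsto[g,x]_{(X,Y,\hat A)}$, such that for every $(X,Y,\hat A)\in\mathcal{B}$: (1) $[\cdot,\cdot]_{(X,Y,\hat A)}$ is bilinear and norm continuous on $Y^\bullet\times X$; and (2) the operator $Y^\bullet\to X^*$, $g\mapsto[g,\cdot]_{(X,Y,\hat A)}$, is isometric to $A^*:Y^*\to X^*$.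
   Context: All Banach spaces are real. $\Delta$ is the Cantor set, $C(\Delta)$ the space of continuous real functions on $\Delta$ with the sup norm. $\mathrm{SB}$ is the set of closed linear subspaces of $C(\Delta)$ with the Effros–Borel $\sigma$-algebra (generated by $\{F:F\cap U\ne\emptyset\}$, $U$ open), a standard Borel space. Fix Borel maps $d_n:\mathrm{SB}\to C(\Delta)$ with $\{d_n(X)\}_n$ dense in $X$ and closed under rational linear combinations (for all $k,m\in\mathbb{N}$, $r,q\in\mathbb{Q}$ there is $n$ with $d_n(X)=rd_k(X)+qd_m(X)$ for all $X$). $\mathcal{L}\subset\mathrm{SB}\times\mathrm{SB}\times C(\Delta)^{\mathbb{N}}$ is the Borel set of triples $(X,Y,\hat A)$ with $\hat A(n)\in Y$ for all $n$, $\hat A(n)=r\hat A(k)+q\hat A(m)$ whenever $d_n(X)=rd_k(X)+qd_m(X)$ with $r,q\in\mathbb{Q}$, and $\|\sum_ia_i\hat A(i)\|\le L\|\sum_ia_id_i(X)\|$ for some rational $L>0$ and all finite rational $(a_i)$; such a triple codes the unique bounded operator $A:X\to Y$ with $A(d_n(X))=\hat A(n)$. $\mathrm{SD}$ is the set of $X\in\mathrm{SB}$ with separable dual, and $\mathcal{L}_{\mathrm{SD}}=\{(X,Y,\hat A)\in\mathcal{L}:X,Y\in\mathrm{SD}\}$. Two bounded operators $A:X\to Y$ and $B:Z\to W$ between Banach spaces are isometric (resp. isomorphic) if there are surjective linear isometries (resp. isomorphisms) $j_1:X\to Z$, $j_2:Y\to W$ with $B\circ j_1=j_2\circ A$. 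*)

(* Defs.v *)
From HB Require Import structures.
From mathcomp Require Import all_boot all_order all_algebra.
From mathcomp Require Import all_classical all_reals all_analysis.
Set Implicit Arguments. Unset Strict Implicit. Unset Printing Implicit Defensive.
Import Order.TTheory GRing.Theory Num.Theory.
Import numFieldNormedType.Exports.
Local Open Scope classical_set_scope.
Local Open Scope ring_scope.

Section Defs.
Context (R : realType).

Record CD := MkCD { cfun : cantor_space -> R ; cfun_cont : forall x : cantor_space, @continuous_at cantor_space R x cfun }.

Definition normf (phi : cantor_space -> R) : R :=
  sup [set `|phi x| | x in [set: cantor_space]].
Definition normC (f : CD) : R := normf (cfun f).
Definition distC (f g : CD) : R := normf (fun t => cfun f t - cfun g t).

Definition lincomb (h : CD) (a : R) (f : CD) (b : R) (g : CD) : Prop :=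
  forall t, cfun h t = a * cfun f t + b * cfun g t.

Definition openC (U : set CD) : Prop :=
  forall f, U f -> exists2 e : R, 0 < e & forall g, distC f g < e -> U g.

Record SB := MkSB {
  sbset : set CD ;
  sb_zero : forall z, (forall t, cfun z t = 0) -> sbset z ;
  sb_lin : forall f g h a b, sbset f -> sbset g -> lincomb h a f b g -> sbset h ;
  sb_closed : forall f, (forall e : R, 0 < e -> exists2 g, sbset g & distC f g < e) ->
                        sbset f }.

Definition borelC : set (set CD) := <<s [set U | openC U] >>.
Definition borelR : set (set R) := <<s [set U : set R | open U] >>.
Definition effros : set (set SB) :=
  <<s [set [set F : SB | sbset F `&` U !=set0] | U in [set U | openC U]] >>.

Definition T3 := (SB * SB * (nat -> CD))%type.
Definition T3_meas : set (set T3) :=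
  <<s [set S | (exists2 E, effros E & S = [set t : T3 | E t.1.1])
            \/ (exists2 E, effros E & S = [set t : T3 | E t.1.2])
            \/ (exists n, exists2 E, borelC E & S = [set t : T3 | E (t.2 n)])] >>.

Definition T5 := (T3 * CD * CD)%type.
Definition T5_meas : set (set T5) :=
  <<s [set S | (exists2 E, T3_meas E & S = [set u : T5 | E u.1.1])
            \/ (exists2 E, borelC E & S = [set u : T5 | E u.1.2])
            \/ (exists2 E, borelC E & S = [set u : T5 | E u.2])] >>.

Definition dseq_ok (d : nat -> SB -> CD) : Prop :=
  (forall n, forall E, borelC E -> effros [set X : SB | E (d n X)]) /\
  (forall n X, sbset X (d n X)) /\
  (forall X f, sbset X f -> forall e : R, 0 < e -> exists n, distC (d n X) f < e) /\
  (forall (k m : nat) (r q : rat), exists n, forall X,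
      lincomb (d n X) (ratr r) (d k X) (ratr q) (d m X)).

Definition Lset (d : nat -> SB -> CD) : set T3 := [set t : T3 |
  let X := t.1.1 in let Y := t.1.2 in let Ah := t.2 in
  (forall n, sbset Y (Ah n)) /\
  (forall (n k m : nat) (r q : rat),
      lincomb (d n X) (ratr r) (d k X) (ratr q) (d m X) ->
      lincomb (Ah n) (ratr r) (Ah k) (ratr q) (Ah m)) /\
  (exists2 L : rat, 0 < L & forall (N : nat) (a : nat -> rat),
      normf (fun x => \sum_(i < N) ratr (a i) * cfun (Ah i) x)
      <= ratr L * normf (fun x => \sum_(i < N) ratr (a i) * cfun (d i X) x))].

(* A : X -> Y (represented by a function on C(Delta), relevant on X) is the
   bounded linear operator coded by (X, Y, Ah) *)
Definition codes (d : nat -> SB -> CD) (X Y : SB) (Ah : nat -> CD)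
    (A : CD -> CD) : Prop :=
  (forall f, sbset X f -> sbset Y (A f)) /\
  (forall f g h a b, sbset X f -> sbset X g -> sbset X h -> lincomb h a f b g ->
      lincomb (A h) a (A f) b (A g)) /\
  (exists M : R, forall f, sbset X f -> normC (A f) <= M * normC f) /\
  (forall n, A (d n X) = Ah n).

(* dual space X^*: bounded linear functionals on X, represented by functions
   CD -> R, identified when they agree on X *)
Definition linear_on (X : set CD) (phi : CD -> R) : Prop :=
  forall f g h a b, X f -> X g -> X h -> lincomb h a f b g ->
    phi h = a * phi f + b * phi g.
Definition in_dual (X : set CD) (phi : CD -> R) : Prop :=
  linear_on X phi /\ exists M : R, forall f, X f -> `|phi f| <= M * normC f.
Definition deq (X : set CD) (phi psi : CD -> R) : Prop :=
  forall f, X f -> phi f = psi f.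
Definition dnorm (X : set CD) (phi : CD -> R) : R :=
  sup [set `|phi f| | f in [set f | X f /\ normC f <= 1]].

Definition SD (X : SB) : Prop :=
  exists s : nat -> CD -> R, (forall n, in_dual (sbset X) (s n)) /\
    forall phi, in_dual (sbset X) phi -> forall e : R, 0 < e ->
      exists n, dnorm (sbset X) (fun f => phi f - s n f) < e.

Definition LSD d : set T3 := [set t | Lset d t /\ SD t.1.1 /\ SD t.1.2].

Definition iso_sub_dual (Z X : set CD) (j : CD -> CD -> R) : Prop :=
  (forall g, Z g -> in_dual X (j g)) /\
  (forall g h k a b, Z g -> Z h -> Z k -> lincomb k a g b h ->
      deq X (j k) (fun x => a * j g x + b * j h x)) /\
  (forall g, Z g -> dnorm X (j g) = normC g) /\
  (forall psi, in_dual X psi -> exists2 g, Z g & deq X (j g) psi).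

Definition iso_dual_dual (X : set CD) (j : (CD -> R) -> CD -> R) : Prop :=
  (forall phi psi, in_dual X phi -> deq X phi psi -> deq X (j phi) (j psi)) /\
  (forall phi, in_dual X phi -> in_dual X (j phi)) /\
  (forall phi psi a b, in_dual X phi -> in_dual X psi ->
      deq X (j (fun x => a * phi x + b * psi x)) (fun x => a * j phi x + b * j psi x)) /\
  (forall phi, in_dual X phi -> dnorm X (j phi) = dnorm X phi) /\
  (forall psi, in_dual X psi -> exists2 phi, in_dual X phi & deq X (j phi) psi).

(* the operator Ab : Yb -> Xb is isometric to the adjoint A^* : Y^* -> X^*
   of A : X -> Y, where A^* psi = psi o A:
   j1 : Yb -> Y^*, j2 : Xb -> X^* with A^* o j1 = j2 o Ab *)
Definition isometric_to_adjoint (X Y Xb Yb : SB) (A Ab : CD -> CD) : Prop :=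
  exists (j1 j2 : CD -> CD -> R),
    iso_sub_dual (sbset Yb) (sbset Y) j1 /\ iso_sub_dual (sbset Xb) (sbset X) j2 /\
    forall g, sbset Yb g -> deq (sbset X) (fun x => j1 g (A x)) (j2 (Ab g)).

(* the operator T : Yb -> X^* is isometric to A^* : Y^* -> X^*:
   j1 : Yb -> Y^*, j2 : X^* -> X^* with A^* o j1 = j2 o T *)
Definition isometric_to_adjoint' (X Y Yb : SB) (A : CD -> CD)
    (T : CD -> CD -> R) : Prop :=
  exists (j1 : CD -> CD -> R) (j2 : (CD -> R) -> CD -> R),
    iso_sub_dual (sbset Yb) (sbset Y) j1 /\ iso_dual_dual (sbset X) j2 /\
    forall g, sbset Yb g -> deq (sbset X) (fun x => j1 g (A x)) (j2 (T g)).

Definition bilin_cont (Z X : set CD) (p : CD -> CD -> R) : Prop :=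
  (forall g, Z g -> linear_on X (p g)) /\
  (forall x, X x -> linear_on Z (fun g => p g x)) /\
  (forall g x, Z g -> X x -> forall e : R, 0 < e -> exists2 del : R, 0 < del &
     forall g' x', Z g' -> X x' -> distC g g' < del -> distC x x' < del ->
       `|p g x - p g' x'| < e).

Definition Cset (B : set T3) (F : T3 -> T3) : set T5 :=
  [set u : T5 | B u.1.1 /\ sbset (F u.1.1).1.1 u.1.2 /\ sbset u.1.1.1.1 u.2].

End Defs.

(* Main.v *)
(* The main point is to choose, measurably in X, a norm dense sequence of X^* when X
   ranges over a Borel family of spaces with separable dual. A functional is recorded
   by its normalized values on the dense sequence of X, so that the dual ball becomes a
   compact set K_w of [-1,1]^nat depending on a point w of Baire space, with closed
   graph, and the dual norm becomes the sup norm. The Borel set of parameters is the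
   projection of a closed set F. Following the proof of Lusin's separation theorem, and
   in place of a bound on the Szlenk index, call a neighbourhood in F together with a
   finite family of sets cut out of the K_w by rational half-spaces good if the
   neighbourhood is covered by measurable sets, one for each member of the family, over
   which that member has measurable e-dense selectors. If all refinements are good then
   so is the given datum: what remains of K_w after removing the covered halves has
   diameter at most e. If the initial datum were bad, one would build a parameter w and
   a Cantor scheme of e-separated points of K_w, contradicting separability.

   A dense sequence of X^* evaluated on X gives a compact set of sequences, onto which
   Cantor space is mapped continuously, and measurably in X, by deciding the rational
   half-space constraints one after the other; this embeds X^* isometrically into
   C(Delta). All remaining objects are limits of measurable ones. *)

Require Import Defs.
From HB Require Import structures.
From mathcomp Require Import all_boot all_order all_algebra.
From mathcomp Require Import all_classical all_reals all_analysis.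
From mathcomp Require Import measurable_realfun ring lra.
Set Implicit Arguments. Unset Strict Implicit. Unset Printing Implicit Defensive.
Import Order.TTheory GRing.Theory Num.Theory.
Import numFieldNormedType.Exports.
Local Open Scope classical_set_scope.
Local Open Scope ring_scope.

(** * Measurability of predicates and real functions *)

(** Compactness of the dual ball readily gives measurable selectors that are weak-star dense. Norm
    density is the obstacle: separability of each dual is a pointwise hypothesis, with no uniformity
    in the parameter. The uniformity comes from the parameters: since a Borel set of codes is the
    projection of a closed set, an infinite descent through bad neighbourhoods ends at an actual
    parameter, where separability applies. This needs convergent parameters, whereas [SB] carries
    only a sigma-algebra; hence the detour through Baire space. Coding is measurable and can be
    undone, so selectors found on codes pull back to triples. *)

Section MeasurablePredicates.
Context d (T : measurableType d).
Implicit Types P Q : T -> Prop.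

Lemma measP_ext P Q : (forall w, P w <-> Q w) ->
  measurable [set w | P w] -> measurable [set w | Q w].
Proof. by move=> PQ mP; rewrite (_ : mkset Q = mkset P)//; apply/funext => w; apply/propext; split=> /PQ. Qed.

Lemma measP_and P Q : measurable [set w | P w] -> measurable [set w | Q w] ->
  measurable [set w | P w /\ Q w].
Proof. exact: measurableI. Qed.

Lemma measP_or P Q : measurable [set w | P w] -> measurable [set w | Q w] ->
  measurable [set w | P w \/ Q w].
Proof. exact: measurableU. Qed.

Lemma measP_not P : measurable [set w | P w] -> measurable [set w | ~ P w].
Proof. exact: measurableC. Qed.

Lemma measP_imp P Q : measurable [set w | P w] -> measurable [set w | Q w] ->
  measurable [set w | P w -> Q w].
Proof.
move=> mP mQ; apply: (measP_ext (P := fun w => ~ P w \/ Q w)) => [w|].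
  split=> [[//|//]|PQ]; have [/PQ|] := pselect (P w); first by right.
  by left.
by apply: measP_or => //; exact: measP_not.
Qed.

Lemma measP_const (A : Prop) : measurable [set w : T | A].
Proof.
have [a|na] := pselect A.
- by apply: (measP_ext (P := fun=> True)) => [w|]; [split | exact: measurableT].
- by apply: (measP_ext (P := fun=> False)) => [w|]; [split | exact: measurable0].
Qed.

Lemma measP_ex (I : countType) (P : I -> T -> Prop) :
  (forall i, measurable [set w | P i w]) -> measurable [set w | exists i, P i w].
Proof.
move=> mP; rewrite (_ : mkset _ = \bigcup_i mkset (P i)).
  by apply: countable_bigcupT_measurable => //; exact: countableP.
by apply/funext => w; apply/propext; split=> [[i Pi]|[i _ Pi]]; exists i.
Qed.

Lemma measP_all (I : countType) (P : I -> T -> Prop) :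
  (forall i, measurable [set w | P i w]) -> measurable [set w | forall i, P i w].
Proof.
move=> mP; apply: (measP_ext (P := fun w => ~ exists i, ~ P i w)) => [w|].
  split=> [nP i|Pi [i]]; last exact.
  by apply: contrapT => nPi; apply: nP; exists i.
by apply: measP_not; apply: measP_ex => i; apply: measP_not.
Qed.
End MeasurablePredicates.

Section GeneratedPreimages.
Context d (T : measurableType d) (D : set T) (S : Type) (G : set (set S)) (Phi : T -> S).

(** Borel maps are only given on a domain [D]. The sets whose preimage has a measurable trace on [D]
    form a sigma-algebra, complements being taken relative to [D], so generators suffice. *)
Lemma measurable_generated : measurable D ->
  (forall A, G A -> measurable [set w | D w /\ A (Phi w)]) ->
  forall A, <<s G >> A -> measurable [set w | D w /\ A (Phi w)].
Proof.
move=> mD mG; suff : <<s G >> `<=` [set A | measurable [set w | D w /\ A (Phi w)]] by [].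
apply: smallest_sub => //; split=> [|A mA|F mF].
- by apply: measP_and => //; exact: measurable0.
- apply: (measP_ext (P := fun w => D w /\ ~ (D w /\ A (Phi w)))) => [w|].
    by rewrite setTD /setC /=; tauto.
  by apply: measP_and => //; exact: measP_not.
- apply: (measP_ext (P := fun w => exists n, D w /\ F n (Phi w))) => [w|].
    by split=> [[n [Dw Fn]]|[Dw [n _ Fn]]]; [split => //; exists n|exists n].
  by apply: measP_ex => n; exact: mF.
Qed.

End GeneratedPreimages.

Section MeasurableReal.
Context d (T : measurableType d) (R : realType).

Definition meas_on (D : set T) (f : T -> R) : Prop :=
  forall c : R, measurable [set w | D w /\ f w < c].

Lemma meas_onP (D : set T) (f : T -> R) :
  measurable D -> meas_on D f <-> measurable_fun D f.
Proof.
move=> mD; split=> [mf|mf c].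
  apply: (measurability _ (RGenInftyO.measurableE R)) => // _ [_ [c ->] <-].
  by apply: measP_ext (mf c) => w; rewrite /= in_itv.
have /= := mf mD `]-oo, c[%classic (measurable_itv _).
by apply: measP_ext => w; rewrite /= in_itv.
Qed.

Lemma rat_lt_between (x y : R) : x < y -> exists q : rat, x < ratr q < y.
Proof. by move=> /rat_in_itvoo[q]; rewrite in_itv /= => ?; exists q. Qed.

Lemma meas_on_dom (D : set T) (f : T -> R) : meas_on D f -> measurable D.
Proof.
move=> mf; apply: (measP_ext (P := fun w => exists n : nat, D w /\ f w < n%:R)) => [w|].
  split=> [[n []]//|Dw].
  exists (Num.truncn (`|f w|)).+1; split => //.
  by rewrite (le_lt_trans (ler_norm _))// truncnS_gt.
by apply: measP_ex => n; apply: mf.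
Qed.

Lemma meas_on_lt (D : set T) (f g : T -> R) : meas_on D f -> meas_on D g ->
  measurable [set w | D w /\ f w < g w].
Proof.
move=> mf mg; apply: (measP_ext
  (P := fun w => exists q : rat, (D w /\ f w < ratr q) /\ ~ (D w /\ g w < ratr q) /\
  ~ (D w /\ g w < ratr q))) => [w|]; last first.
  apply: measP_ex => q; apply: measP_and; first exact: mf.
  by apply: measP_and; apply: measP_not; apply: mg.
split=> [[q [[Dw fq] [gq _]]]|[Dw fg]].
  by split => //; rewrite (lt_le_trans fq)// leNgt; apply/negP => ?; apply: gq.
have [q /andP[fq qg]] := rat_lt_between fg.
by exists q; do 2!split=> //; try split => //; rewrite ltNge (ltW qg) => -[].
Qed.

Lemma meas_on_le (D : set T) (f g : T -> R) : meas_on D f -> meas_on D g ->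
  measurable [set w | D w /\ f w <= g w].
Proof.
move=> mf mg; apply: (measP_ext (P := fun w => D w /\ ~ (D w /\ g w < f w))) => [w|].
  split=> [[Dw /not_andP[//|/negP]]|[Dw fg]]; first by rewrite -leNgt.
  by split => // -[_]; rewrite ltNge fg.
apply: measP_and; first exact: meas_on_dom mf.
by apply: measP_not; apply: meas_on_lt.
Qed.

Lemma meas_on_cst (D : set T) (c : R) : measurable D -> meas_on D (fun=> c).
Proof. by move=> mD c'; apply: measP_and => //; exact: measP_const. Qed.

Lemma meas_on_sub (D D' : set T) (f : T -> R) : D' `<=` D -> measurable D' ->
  meas_on D f -> meas_on D' f.
Proof.
move=> DD mD mf c; apply: (measP_ext (P := fun w => D' w /\ (D w /\ f w < c))) => [w|].
  by split=> [[? []]//|[/[dup]/DD]].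
exact: measP_and.
Qed.

Lemma meas_on_ext (D : set T) (f g : T -> R) : (forall w, D w -> f w = g w) ->
  meas_on D f -> meas_on D g.
Proof. by move=> fg mf c; apply: measP_ext (mf c) => w; split=> -[Dw]; rewrite fg. Qed.

(** Used in place of a measurable choice of approximants. [S n i w] says that [i] is admissible at
    stage [n]; as every admissible index serves, [h w < c] is expressed by quantifying over all of
    them. *)
Lemma meas_on_approx (I : countType) (D : set T) (S : nat -> I -> T -> Prop)
    (r : I -> T -> R) (h : T -> R) :
  measurable D ->
  (forall n i, measurable [set w | D w /\ S n i w]) ->
  (forall i, meas_on D (r i)) ->
  (forall w n, D w -> exists i, S n i w) ->
  (forall w, D w -> forall e, 0 < e -> exists n, forall m i, (n <= m)%N -> S m i w ->
     `|r i w - h w| < e) ->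
  meas_on D h.
Proof.
move=> mD mS mr exS apx c.
apply: (measP_ext (P := fun w => D w /\ exists q : rat, ratr q < c /\ exists n, forall m i,
   ((n <= m)%N /\ (D w /\ S m i w)) -> (D w /\ r i w < ratr q))) => [w|]; last first.
  apply: measP_and => //; apply: measP_ex => q; apply: measP_and; first exact: measP_const.
  apply: measP_ex => n; apply: measP_all => m; apply: measP_all => i.
  apply: measP_imp; last exact: mr.
  by apply: measP_and => //; exact: measP_const.
split=> [[Dw [q [qc [n Hn]]]]|[Dw hc]]; split => //.
  rewrite (le_lt_trans _ qc)// leNgt; apply/negP => qh.
  have [|n' Hn'] := apx w Dw (h w - ratr q); first by rewrite subr_gt0.
  have [i Si] := exS w (maxn n n') Dw.
  have [//|_ rq] := Hn (maxn n n') i; first by rewrite leq_maxl.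
  have := Hn' _ _ (leq_maxr n n') Si; rewrite ltr_norml => /andP[]; lra.
have [q /andP[hq qc]] := rat_lt_between hc.
exists q; split => //.
have [|n Hn] := apx w Dw (ratr q - h w); first by rewrite subr_gt0.
exists n => m i [nm [_ Si]]; split => //.
have := Hn _ _ nm Si; rewrite ltr_norml => /andP[]; lra.
Qed.

Lemma meas_on_sup (I : countType) (D : set T) (f : I -> T -> R) (h : T -> R) :
  measurable D -> (forall i, meas_on D (f i)) ->
  (forall w c, D w -> h w <= c <-> forall i, f i w <= c) -> meas_on D h.
Proof.
move=> mD mf fh c.
apply: (measP_ext (P := fun w => D w /\ exists q : rat, ratr q < c /\
   forall i, D w /\ f i w <= ratr q)) => [w|]; last first.
  apply: measP_and => //; apply: measP_ex => q; apply: measP_and; first exact: measP_const.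
  by apply: measP_all => i; apply: meas_on_le => //; exact: meas_on_cst.
split=> [[Dw [q [qc Hq]]]|[Dw hc]]; split => //.
  by apply: (le_lt_trans _ qc); apply/(fh _ _ Dw) => i; have [] := Hq i.
have [q /andP[hq qc]] := rat_lt_between hc.
by exists q; split => // i; split => //; move: i; apply/(fh _ _ Dw); rewrite ltW.
Qed.

Lemma meas_onD (D : set T) (f g : T -> R) : meas_on D f -> meas_on D g ->
  meas_on D (fun w => f w + g w).
Proof.
move=> mf mg; have mD := meas_on_dom mf.
by apply/(meas_onP _ mD); apply: measurable_funD; apply/(meas_onP _ mD).
Qed.

Lemma meas_onM (D : set T) (f g : T -> R) : meas_on D f -> meas_on D g ->
  meas_on D (fun w => f w * g w).
Proof.
move=> mf mg; have mD := meas_on_dom mf.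
by apply/(meas_onP _ mD); apply: measurable_funM; apply/(meas_onP _ mD).
Qed.

Lemma meas_onZ (D : set T) (a : R) (f : T -> R) : meas_on D f ->
  meas_on D (fun w => a * f w).
Proof.
by move=> mf; apply: meas_onM => //; apply: meas_on_cst; apply: meas_on_dom mf.
Qed.

Lemma meas_onB (D : set T) (f g : T -> R) : meas_on D f -> meas_on D g ->
  meas_on D (fun w => f w - g w).
Proof.
move=> mf mg; have mD := meas_on_dom mf.
by apply/(meas_onP _ mD); apply: measurable_funB; apply/(meas_onP _ mD).
Qed.

Lemma meas_on_norm (D : set T) (f : T -> R) : meas_on D f ->
  meas_on D (fun w => `|f w|).
Proof.
move=> mf; have mD := meas_on_dom mf; apply/(meas_onP _ mD).
by apply: measurableT_comp => //; apply/(meas_onP _ mD).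
Qed.

Lemma meas_on_max (D : set T) (f g : T -> R) : meas_on D f -> meas_on D g ->
  meas_on D (fun w => Num.max (f w) (g w)).
Proof.
move=> mf mg; have mD := meas_on_dom mf; apply/(meas_onP _ mD).
by apply: measurable_maxr; apply/(meas_onP _ mD).
Qed.

End MeasurableReal.

(** * Compact sets of real sequences and rational constraints *)

Section Compactness.
Context {R : realType}.
Implicit Types (phi psi : nat -> R) (L : set (nat -> R)).

(* [(k, q, b)] stands for [q <= phi k] if [b] and for [phi k <= q] otherwise. *)
Definition cns := (nat * rat * bool)%type.

Definition sat phi (c : cns) : Prop :=
  if c.2 then ratr c.1.2 <= phi c.1.1 else phi c.1.1 <= ratr c.1.2.
Definition sats phi (U : seq cns) : Prop := forall c, c \in U -> sat phi c.
Definition hits L (U : seq cns) : Prop := exists2 phi, L phi & sats phi U.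

(** Basic neighbourhoods of [phi] in the product topology, one integer governing both the
    coordinates seen and the error. *)
Definition pnear phi psi (n : nat) : Prop :=
  forall k, (k < n)%N -> `|psi k - phi k| < n.+1%:R^-1.
Definition pclosed L : Prop :=
  forall phi, (forall n, exists2 psi, L psi & pnear phi psi n) -> L phi.
Definition pbounded L : Prop := forall k, exists C : R, forall phi, L phi -> `|phi k| <= C.

Lemma invS_lt (e : R) : 0 < e -> exists n : nat, n.+1%:R^-1 < e.
Proof.
move=> e0; exists (Num.truncn e^-1).
by rewrite invf_plt ?posrE// truncnS_gt.
Qed.

Lemma invS_le (m n : nat) : (m <= n)%N -> n.+1%:R^-1 <= m.+1%:R^-1 :> R.
Proof. by move=> mn; rewrite lef_pV2 ?posrE// ler_nat. Qed.

Lemma sats_cons phi c U : sats phi (c :: U) <-> sat phi c /\ sats phi U.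
Proof.
split=> [H|[Hc HU] c']; last by rewrite inE => /orP[/eqP->|/HU].
by split=> [|c' cU]; apply: H; rewrite inE ?eqxx// cU orbT.
Qed.

Lemma sats_nil phi : sats phi [::]. Proof. by []. Qed.

Lemma sats_cat phi U V : sats phi (U ++ V) <-> sats phi U /\ sats phi V.
Proof.
elim: U => [|c U IH] /=; first by split=> [|[]].
by rewrite sats_cons IH sats_cons; tauto.
Qed.

(* Tychonoff, in sequential form. *)
Lemma cluster_point (u : nat -> nat -> R) (C : nat -> R) :
  (forall n k, `|u n k| <= C k) ->
  exists phi, forall n, exists2 m, (n <= m)%N & pnear phi (u m) n.
Proof.
move=> uC; pose X := fun _ : nat => (R : topologicalType).
pose K := fun k : nat => (`[- C k, C k]%classic : set R).
have cK : compact [set f : prod_topology X | forall i, K i (f i)].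
  by apply: tychonoff => i; exact: segment_compact.
have [|phi [_ cphi]] := cK ((u : nat -> prod_topology X) @ \oo) _ _.
  exists 0%N => // n _ k /=; rewrite /K /= in_itv /=.
  by rewrite -ler_norml; exact: uC.
exists phi => n.
have nb k : nbhs (phi : prod_topology X)
    [set f : prod_topology X | `|(f : nat -> R) k - (phi : nat -> R) k| < n.+1%:R^-1].
  apply: (@proj_continuous nat X k phi [set y : R | `|y - (phi : nat -> R) k| < n.+1%:R^-1]).
  apply/nbhs_ballP; exists n.+1%:R^-1; first by rewrite /= invr_gt0.
  by move=> y; rewrite /ball /= distrC.
have key m : nbhs (phi : prod_topology X)
    [set f : prod_topology X | forall k, (k < m)%N ->
       `|(f : nat -> R) k - (phi : nat -> R) k| < n.+1%:R^-1].
  elim: m => [|m IH]; first exact: filterS filterT.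
  apply: filterS (filterI (nb m) IH) => f [fm fk] k.
  by rewrite ltnS leq_eqVlt => /orP[/eqP->//|]; exact: fk.
have := cphi [set f | exists2 m, (n <= m)%N & f = u m] _ _ (key n).
case; first by exists n => // m /= nm; exists m.
by move=> f [[m nm ->] H]; exists m.
Qed.

Lemma pnear_le phi psi m n : (m <= n)%N -> pnear phi psi n -> pnear phi psi m.
Proof.
move=> mn H k km; apply: lt_le_trans (H k _) (invS_le mn).
exact: leq_trans km mn.
Qed.

Lemma sat_limit phi (c : cns) :
  (forall n, exists2 psi, sat psi c & pnear phi psi n) -> sat phi c.
Proof.
case: c => [[k q] b] H; rewrite /sat /=.
suff E e : 0 < e -> if b then ratr q <= phi k + e else phi k <= ratr q + e.
  by clear H; destruct b; apply/ler_addgt0Pr => e /E.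
move=> /invS_lt[n ne]; have [psi Hs /(_ k)] := H (maxn n k.+1).
rewrite leq_max ltnSn orbT => /(_ isT) /lt_le_trans /(_ (invS_le (leq_maxl _ _))).
move=> /lt_trans/(_ ne); rewrite ltr_norml => /andP[].
by move: Hs; rewrite /sat /=; clear H; destruct b => /=; lra.
Qed.

(** Compactness for an increasing sequence of finite systems: a cluster point of solutions of the
    [U n] satisfies every constraint, because constraints are non-strict and belong to all later
    systems. *)
Lemma hits_limit L (U : nat -> seq cns) : pclosed L -> pbounded L ->
  (forall m n c, (m <= n)%N -> c \in U m -> c \in U n) ->
  (forall n, hits L (U n)) ->
  exists2 phi, L phi & forall n, sats phi (U n).
Proof.
move=> cL bL monoU hU.
have [C HC] := choice bL.
have /choice[u Hu] : forall n, exists phi, L phi /\ sats phi (U n).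
  by move=> n; have [phi] := hU n; exists phi.
have [|phi Hphi] := @cluster_point u C.
  by move=> n k; apply: HC; have [] := Hu n.
exists phi.
  by apply: cL => n; have [m _ um] := Hphi n; exists (u m) => //; have [] := Hu m.
move=> n c cU; apply: sat_limit => p.
have [m mp um] := Hphi (maxn n p).
exists (u m); last exact: pnear_le (leq_maxr _ _) um.
have [_] := Hu m; apply; apply: monoU cU.
exact: leq_trans (leq_maxl _ _) mp.
Qed.

End Compactness.

(** * Measurable parametrization of compact sets by Cantor space *)

Section CantorParametrization.
Context d (T : measurableType d) (R : realType) (L : T -> set (nat -> R)).
Hypotheses (Lclosed : forall w, pclosed (L w)) (Lbounded : forall w, pbounded (L w)).
Hypothesis Lmeas : forall U, measurable [set w | hits (L w) U].

Let threshold (i : nat) : nat * rat := odflt (0%N, 0) (unpickle i).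

Lemma threshold_onto kq : exists i, threshold i = kq.
Proof. by exists (pickle kq); rewrite /threshold pickleK. Qed.

(* The [i]-th constraint is imposed in the direction asked for by [b i] when
   this is compatible with the earlier choices, and reversed otherwise. *)
Fixpoint greedy (w : T) (b : nat -> bool) (n : nat) : seq cns :=
  if n is i.+1 then
    let V := greedy w b i in
    if `[< hits (L w) ((threshold i, b i) :: V) >] then (threshold i, b i) :: V
    else (threshold i, ~~ b i) :: V
  else [::].

Lemma sat_total (phi : nat -> R) kq b : sat phi (kq, b) \/ sat phi (kq, ~~ b).
Proof.
by rewrite /sat; have [?|/ltW ?] := leP (phi kq.1) (ratr kq.2);
  case: b => /=; [right|left|left|right].
Qed.

Lemma greedy_hits w b n : L w !=set0 -> hits (L w) (greedy w b n).
Proof.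
move=> [phi0 L0]; elim: n => [|n [phi Lphi sphi]] /=; first by exists phi0.
case: asboolP => // nh; exists phi => //; apply/sats_cons; split => //.
have [s|//] := sat_total phi (threshold n) (b n).
by exfalso; apply: nh; exists phi => //; apply/sats_cons.
Qed.

Lemma greedy_mono w b m n c : (m <= n)%N -> c \in greedy w b m -> c \in greedy w b n.
Proof.
elim: n => [|n IH]; first by rewrite leqn0 => /eqP->.
rewrite leq_eqVlt ltnS => /orP[/eqP->//|H] cn /=.
by case: ifP => _; rewrite inE (IH H cn) orbT.
Qed.

Lemma greedy_threshold w b i : exists b', (threshold i, b') \in greedy w b i.+1.
Proof. by rewrite /=; case: ifP => _; [exists (b i)|exists (~~ b i)]; rewrite mem_head. Qed.

Lemma greedy_ext w b b' n : (forall i, (i < n)%N -> b i = b' i) ->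
  greedy w b n = greedy w b' n.
Proof.
elim: n => // n IH H /=; rewrite IH ?H// => i ni; apply: H.
exact: ltn_trans ni _.
Qed.

Lemma greedy_exists w b : L w !=set0 ->
  exists phi, L w phi /\ forall n, sats phi (greedy w b n).
Proof.
move=> L0; have [//|//|||phi] := hits_limit (L := L w) (U := greedy w b).
- by move=> m n c; exact: greedy_mono.
- by move=> n; exact: greedy_hits.
- by exists phi.
Qed.

(** Every pair of a coordinate and a rational gets decided, which fixes a Dedekind cut for each
    coordinate. *)
Lemma greedy_unique w b (phi psi : nat -> R) : (forall n, sats phi (greedy w b n)) ->
  (forall n, sats psi (greedy w b n)) -> phi = psi.
Proof.
move=> Hphi Hpsi; apply/funext => k; apply/eqP; rewrite eq_le.
suff H (f g : nat -> R) : (forall n, sats f (greedy w b n)) -> (forall n, sats g (greedy w b n)) ->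
    f k <= g k by rewrite !H.
move=> Hf Hg; rewrite leNgt; apply/negP => /rat_lt_between[q /andP[gq qf]].
have [i ci] := threshold_onto (k, q); have [b' cb] := greedy_threshold w b i.
move: (Hf _ _ cb) (Hg _ _ cb); rewrite ci /sat /=.
by case: b' {cb} => /=; rewrite leNgt ?gq ?qf//= => _; rewrite leNgt gq.
Qed.

Definition cparam (w : T) (b : nat -> bool) : nat -> R :=
  xget (fun=> 0) [set phi | L w phi /\ forall n, sats phi (greedy w b n)].

Lemma cparam_prop w b : L w !=set0 ->
  L w (cparam w b) /\ forall n, sats (cparam w b) (greedy w b n).
Proof.
move=> /(greedy_exists b)[phi Hphi]; rewrite /cparam.
by case: xgetP => [psi _ //|/(_ phi)].
Qed.

Lemma cparam_in w b : L w !=set0 -> L w (cparam w b).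
Proof. by move=> /(cparam_prop b)[]. Qed.

(** Let [b] record the actual cuts of [phi]: each request is met by [phi] itself, so none is ever
    reversed. *)
Lemma cparam_onto w phi : L w phi -> exists b, cparam w b = phi.
Proof.
move=> Lphi; pose b i := `[< ratr (threshold i).2 <= phi (threshold i).1 >].
exists b; have [|_ H] := @cparam_prop w b; first by exists phi.
apply: greedy_unique H _ => n; elim: n => // n IH /=.
have sn : sat phi (threshold n, b n).
  rewrite /sat /= /b; case: asboolP => // /negP; rewrite -ltNge; exact: ltW.
by rewrite asboolT; [|exists phi => //]; apply/sats_cons.
Qed.

Lemma cparam_cont w k b (e : R) : L w !=set0 -> 0 < e ->
  exists n, forall b', (forall i, (i < n)%N -> b i = b' i) ->
    `|cparam w b' k - cparam w b k| < e.
Proof.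
move=> L0 e0; set x := cparam w b k.
(* The thresholds [q1] and [q2] on either side of [x] are decided after finitely many bits; a
   sequence sharing these bits takes the same decisions there. *)
have [q1 /andP[q1l q1r]] : exists q : rat, x - e < ratr q < x by apply: rat_lt_between; lra.
have [q2 /andP[q2l q2r]] : exists q : rat, x < ratr q < x + e by apply: rat_lt_between; lra.
have [i1 c1] := threshold_onto (k, q1); have [i2 c2] := threshold_onto (k, q2).
exists (maxn i1.+1 i2.+1) => b' bb'.
have [_ Hb] := cparam_prop b L0; have [_ Hb'] := cparam_prop b' L0.
have A i q : threshold i = (k, q) -> (i < maxn i1.+1 i2.+1)%N -> exists b1,
    sat (cparam w b) (k, q, b1) /\ sat (cparam w b') (k, q, b1).
  move=> ci im; have [b1 cb1] := greedy_threshold w b i; exists b1; split.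
    by apply: Hb; rewrite -ci; exact: cb1.
  apply: (Hb' i.+1); rewrite -(@greedy_ext w b) -?ci// => j ji.
  by apply: bb'; exact: leq_trans ji im.
have [|b1 []] := A _ _ c1; first by rewrite leq_max leqnn.
have [|b2 []] := A _ _ c2; first by rewrite leq_max leqnn orbT.
rewrite /sat /= -/x; rewrite ltr_norml; clear A.
by case: b1; case: b2 => ? ? ? ?; apply/andP; split; lra.
Qed.

Lemma greedy_meas b n V : measurable [set w | greedy w b n = V].
Proof.
elim: n V => [|n IH] V; first exact: (measP_const _ ([::] = V)).
apply: (measP_ext (P := fun w => exists V' : seq cns, greedy w b n = V' /\
  ((hits (L w) ((threshold n, b n) :: V') /\ (threshold n, b n) :: V' = V) \/
   (~ hits (L w) ((threshold n, b n) :: V') /\ (threshold n, ~~ b n) :: V' = V)))) => [w|].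
  split=> [[V' [<-]]/=|/= <-].
    by move=> [[h <-]|[h <-]]; [rewrite asboolT|rewrite asboolF].
  by exists (greedy w b n); split => //; case: asboolP => h; [left|right].
apply: measP_ex => V'; apply: measP_and; first exact: IH.
apply: measP_or; apply: measP_and; try exact: measP_const; first exact: Lmeas.
by apply: measP_not; exact: Lmeas.
Qed.

(** A coordinate is below [c] exactly when some stage has recorded an upper bound [q < c] for it,
    and each stage takes countably many values. *)
Lemma cparam_meas b k : meas_on [set w | L w !=set0] (fun w => cparam w b k).
Proof.
have m0 : measurable [set w | L w !=set0].
  apply: measP_ext (Lmeas [::]) => w.
  by split=> [[phi ? _]|[phi ?]]; exists phi.
move=> c; apply: (measP_ext (P := fun w => L w !=set0 /\ exists n, exists q : rat,
   ratr q < c /\ exists V : seq cns, (k, q, false) \in V /\ greedy w b n = V)) => [w|].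
  split=> [[L0 [n [q [qc [V [cV VE]]]]]]|[L0]].
    split => //; have [_ H] := cparam_prop b L0.
    by move: cV; rewrite -VE => /H; rewrite /sat /= => /le_lt_trans; apply.
  move=> /rat_lt_between[q /andP[cq qc]]; split => //.
  have [i ci] := threshold_onto (k, q); have [b' cb] := greedy_threshold w b i.
  exists i.+1, q; split => //; exists (greedy w b i.+1); split => //.
  have [_ H] := cparam_prop b L0; have := H _ _ cb; move: cb; rewrite ci /sat /=.
  by case: b' => //= _; rewrite leNgt cq.
apply: measP_and => //; apply: measP_ex => n; apply: measP_ex => q.
apply: measP_and; first exact: measP_const.
apply: measP_ex => V; apply: measP_and; first exact: measP_const.
exact: greedy_meas.
Qed.

End CantorParametrization.

(** * Borel sets of Baire space are analytic *)

Section BaireSpace.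

Definition agree (n : nat) (x y : nat -> nat) : Prop := forall i, (i < n)%N -> x i = y i.

Lemma agree_sym n x y : agree n x y -> agree n y x.
Proof. by move=> H i ni; rewrite H. Qed.

Lemma agree_trans n x y z : agree n x y -> agree n y z -> agree n x z.
Proof. by move=> H H' i ni; rewrite H// H'. Qed.

Lemma agree_le m n x y : (m <= n)%N -> agree n x y -> agree m x y.
Proof. by move=> mn H i im; apply: H; exact: leq_trans mn. Qed.

Definition closed2 (F : (nat -> nat) -> (nat -> nat) -> Prop) : Prop :=
  forall x y, (forall n, exists x', exists y', F x' y' /\ agree n x x' /\ agree n y y') ->
    F x y.

Definition analytic (B : set (nat -> nat)) : Prop :=
  exists2 F, closed2 F & forall x, B x <-> exists y, F x y.

Lemma bounded_range (f : nat -> nat) n : exists N, forall k, (k < n)%N -> (f k < N)%N.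
Proof.
elim: n => [|n [N HN]]; first by exists 0%N.
exists (maxn N (f n).+1) => k; rewrite ltnS leq_eqVlt => /orP[/eqP->|/HN kN].
  by rewrite leq_max leqnn orbT.
by rewrite leq_max kN.
Qed.

Lemma analytic_ex (B : nat -> set (nat -> nat)) : (forall n, analytic (B n)) ->
  analytic (\bigcup_n B n).
Proof.
move=> aB; have /choice[F HF] : forall n, exists F, closed2 F /\
    forall x, B n x <-> exists y, F x y.
  by move=> n; have [F] := aB n; exists F.
exists (fun x y => F (y 0%N) x (y \o S)).
  move=> x y Hxy; have [cF _] := HF (y 0%N); apply: cF => n.
  have [x' [y' [Fxy [xx' yy']]]] := Hxy n.+1.
  exists x', (y' \o S); rewrite (yy' 0%N)//; split => //; split.
    exact: agree_le xx'.
  by move=> i ni /=; apply: yy'.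
move=> x; split=> [[n _ Bnx]|[y Fy]].
  have [_ /(_ x)[/(_ Bnx)[y Fy] _]] := HF n.
  by exists (fun i => if i is j.+1 then y j else n).
by exists (y 0%N) => //; have [_ /(_ x)[_]] := HF (y 0%N); apply; exists (y \o S).
Qed.

Lemma analytic_all (B : nat -> set (nat -> nat)) : (forall n, analytic (B n)) ->
  analytic (\bigcap_n B n).
Proof.
move=> aB; have /choice[F HF] : forall n, exists F, closed2 F /\
    forall x, B n x <-> exists y, F x y.
  by move=> n; have [F] := aB n; exists F.
exists (fun x y => forall m, F m x (fun k => y (pickle (m, k)))).
  move=> x y Hxy m; have [cF _] := HF m; apply: cF => n.
  have [N HN] := bounded_range (fun k => pickle (m, k)) n.
  have [x' [y' [Fxy [xx' yy']]]] := Hxy (maxn n N).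
  exists x', (fun k => y' (pickle (m, k))); split => //; split.
    exact: agree_le (leq_maxl _ _) xx'.
  by move=> i /HN iN; apply: yy'; rewrite leq_max iN orbT.
move=> x; split=> [Bx|[y Fy] m _].
  have /choice[y Hy] : forall m, exists y, F m x y.
    by move=> m; have [_ /(_ x)[H _]] := HF m; apply: H; exact: Bx.
  exists (fun i => let mk := odflt (0%N, 0%N) (unpickle i) in y mk.1 mk.2) => m.
  by under [X in F _ _ X]funext do rewrite pickleK /=.
by have [_ /(_ x)[_]] := HF m; apply; exists (fun k => y (pickle (m, k))).
Qed.

Definition cylinders : set (set (nat -> nat)) :=
  [set A | exists i, exists j, A = [set x | x i = j]].

Definition baire := g_sigma_algebraType cylinders.

Lemma analytic_local (B : set (nat -> nat)) n :
  (forall x y, agree n x y -> B x -> B y) -> analytic B.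
Proof.
move=> HB; exists (fun x _ => B x) => [x y Hxy|x]; last first.
  by split=> [Bx|[]//]; exists x.
have [x' [_ [Bx' [xx' _]]]] := Hxy n.
exact: HB (agree_sym xx') Bx'.
Qed.

(** Analytic sets are not closed under complement, so the induction carries each set together with
    its complement. Cylinders are clopen. *)
Lemma borel_analytic (B : set baire) : measurable B -> analytic B.
Proof.
suff H : <<s cylinders >> `<=` [set B | analytic B /\ analytic (~` B)].
  by move=> /H[].
apply: smallest_sub; last first.
  move=> _ [i [j ->]]; split; apply: (@analytic_local _ i.+1) => x y xy /=;
  by rewrite xy.
split.
- by split; apply: (@analytic_local _ 0%N).
- by move=> A [aA aAC]; rewrite setTD; split => //; rewrite setCK.
move=> F aF; split.
  by apply: analytic_ex => n; have [] := aF n.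
by rewrite setC_bigcup; apply: analytic_all => n; have [] := aF n.
Qed.

Lemma cylinder_measurable i j : measurable [set x : baire | x i = j].
Proof. by apply: sub_sigma_algebra; exists i, j. Qed.

(** A point outside a closed set has a finite prefix with no extension in the set, and there are
    countably many prefixes. *)
Lemma baire_closed_measurable (P : baire -> Prop) :
  (forall x, (forall n, exists2 x', agree n x x' & P x') -> P x) ->
  measurable [set x | P x].
Proof.
move=> cP; apply: (measP_ext (T := baire) (P := fun x => ~ exists s : seq nat,
  (forall x', (forall i, (i < size s)%N -> x' i = nth 0%N s i) -> ~ P x') /\
  forall i, (i < size s)%N -> x i = nth 0%N s i)) => [x|]; last first.
  apply: measP_not; apply: measP_ex => s; apply: measP_and; first exact: measP_const.
  apply: measP_all => i; apply: measP_imp; first exact: measP_const.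
  exact: cylinder_measurable.
split=> [H|Px [s [H xs]]]; last exact: H xs Px.
apply: cP => n; apply: contrapT => nH; apply: H; exists (mkseq x n).
rewrite size_mkseq; split=> [x' Hx' Px'|i ni]; last by rewrite nth_mkseq.
by apply: nH; exists x' => // i ni; rewrite Hx'// nth_mkseq.
Qed.

End BaireSpace.

(** * Measurable dense selectors for norm separable compact sets *)

Section DenseSelectors.
Context (R : realType) (K : baire -> set (nat -> R)).
Hypothesis Kclosed : forall x phi,
  (forall n, exists x', exists psi, [/\ agree n x x', K x' psi & pnear phi psi n]) -> K x phi.
Hypothesis Kbounded : forall x phi k, K x phi -> `|phi k| <= 1.
Hypothesis K0 : forall x, K x (fun=> 0).

Lemma K_pclosed x : pclosed (K x).
Proof.
by move=> phi H; apply: Kclosed => n; have [psi ? ?] := H n; exists x, psi; split.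
Qed.

Lemma K_pbounded x : pbounded (K x).
Proof. by move=> k; exists 1 => phi; exact: Kbounded. Qed.

(** Compactness with a moving parameter: as [x' n] tends to [x], a cluster point of points of
    [K (x' n)] lies in [K x] by the closed graph. *)
Lemma K_limit x (x' : nat -> baire) (u : nat -> nat -> R) (U : nat -> seq cns) :
  (forall n, agree n x (x' n)) -> (forall n, K (x' n) (u n)) ->
  (forall m n c, (m <= n)%N -> c \in U m -> sat (u n) c) ->
  exists2 phi, K x phi & forall n, sats phi (U n).
Proof.
move=> xx' Ku sU; have [|phi Hphi] := @cluster_point _ u (fun=> 1).
  by move=> n k; apply: Kbounded (Ku n).
exists phi.
  apply: Kclosed => n; have [m nm um] := Hphi n; exists (x' m), (u m); split => //.
  exact: agree_le (xx' m).
move=> n c cU; apply: sat_limit => p; have [m mp um] := Hphi (maxn n p).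
exists (u m); last exact: pnear_le (leq_maxr _ _) um.
by apply: sU cU; exact: leq_trans (leq_maxl _ _) mp.
Qed.

Lemma K_hits_measurable U : measurable [set x | hits (K x) U].
Proof.
apply: baire_closed_measurable => x H.
have /choice[x' Hx'] : forall n, exists x', agree n x x' /\ hits (K x') U.
  by move=> n; have [x'] := H n; exists x'.
have /choice[u Hu] : forall n, exists phi, K (x' n) phi /\ sats phi U.
  by move=> n; have [_ [phi]] := Hx' n; exists phi.
have [|||phi Kphi sphi] := @K_limit x x' u (fun=> U).
- by move=> n; have [] := Hx' n.
- by move=> n; have [] := Hu n.
- by move=> m n c _; have [_] := Hu n; apply.
- by exists phi => //; exact: (sphi 0%N).
Qed.

(** [G] may switch on infinitely many constraints. By compactness they can be met together as soon
    as every finite initial part can, and which of finitely many are active is a measurable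
    condition. *)
Lemma restrict_hits_measurable (I : countType) (U0 : seq cns) (G : I -> set baire)
    (c : I -> cns) : (forall i, measurable (G i)) -> forall U,
  measurable [set x | hits [set phi | [/\ K x phi, sats phi U0 &
     forall i, G i x -> sat phi (c i)]] U].
Proof.
move=> mG U; pose V x (l : seq I) := [seq c i | i <- l & `[< G i x >]].
have mV l U1 : measurable [set x | hits (K x) (U1 ++ V x l)].
  elim: l U1 => [|i l IH] U1; first by rewrite /V /= cats0; exact: K_hits_measurable.
  apply: (measP_ext (T := baire) (P := fun x => (G i x /\ hits (K x) (rcons U1 (c i) ++ V x l)) \/
     (~ G i x /\ hits (K x) (U1 ++ V x l)))) => [x|].
    rewrite /V /=; case: asboolP => Gi; rewrite ?cat_rcons; tauto.
  by apply: measP_or; apply: measP_and => //; [exact: mG|exact: measP_not (mG i)].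
pose l n : seq I := pmap unpickle (iota 0 n).
apply: (measP_ext (T := baire) (P := fun x => forall n : nat, hits (K x) ((U ++ U0) ++ V x (l n)))) => [x|];
  last by apply: measP_all => n; exact: mV.
split=> [H|[phi [Kphi sphi cphi] sU] n]; last first.
  exists phi => //; apply/sats_cat; split; first exact/sats_cat.
  move=> c0 /mapP[i]; rewrite mem_filter => /andP[/asboolP Gi _] ->; exact: cphi.
have [|||phi Kphi sphi] := hits_limit _ _ _ H.
- exact: K_pclosed.
- exact: K_pbounded.
- move=> m n c0 mn; rewrite !mem_cat => /orP[->//|/mapP[i]].
  rewrite mem_filter => /andP[Gi il ->]; apply/orP; right.
  apply/map_f; rewrite mem_filter Gi/=; move: il; rewrite !mem_pmap => /mapP[j jm ->].
  apply/map_f; move: jm; rewrite !mem_iota !add0n/= => jm; exact: leq_trans jm mn.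
exists phi; last by move=> c0 cU; apply: (sphi 0%N); rewrite !mem_cat cU.
split => //; first by move=> c0 cU; apply: (sphi 0%N); rewrite !mem_cat cU orbT.
move=> i Gi; apply: (sphi (pickle i).+1); rewrite mem_cat; apply/orP; right.
apply/map_f; rewrite mem_filter asboolT//= mem_pmap; apply/mapP.
by exists (pickle i); rewrite ?pickleK// mem_iota add0n ltnS leqnn.
Qed.

Section Epsilon.
Variables (e : rat).
Hypothesis e_gt0 : 0 < e.

(** Selectors are measurable on all of Baire space and take values in [K] everywhere, even outside
    the set they serve, so countable families are pooled without gluing. *)
Definition selectors (I : Type) (s : I -> baire -> nat -> R) : Prop :=
  (forall m k, meas_on setT (fun x => s m x k)) /\ (forall m x, K x (s m x)).

Definition covers (E : set baire) (U : seq cns) : Prop :=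
  exists2 s : nat -> baire -> nat -> R, selectors s &
    forall x phi, E x -> K x phi -> sats phi U ->
      exists m, forall k, `|phi k - s m x k| <= ratr e.

Lemma countable_selectors (I : countType) (s : I -> baire -> nat -> R) : selectors s ->
  exists2 s' : nat -> baire -> nat -> R, selectors s' & forall i, exists n, s' n = s i.
Proof.
move=> [ms Ks]; exists (fun n => if unpickle n is Some i then s i else fun=> fun=> 0).
  split=> [n k|n x]; last by case: unpickle.
  case: unpickle => [i|]; first exact: ms.
  by apply: meas_on_cst.
by move=> i; exists (pickle i); rewrite pickleK.
Qed.

Lemma covers_selectors (I : countType) (s : I -> baire -> nat -> R) E U : selectors s ->
  (forall x phi, E x -> K x phi -> sats phi U ->
      exists m, forall k, `|phi k - s m x k| <= ratr e) -> covers E U.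
Proof.
move=> /countable_selectors[s' ss' Hs'] H; exists s' => // x phi Ex Kp sp.
by have [i Hi] := H x phi Ex Kp sp; have [n ns] := Hs' i; exists n; rewrite ns.
Qed.

Lemma covers_bigcup (I : countType) (E : I -> set baire) U :
  (forall i, covers (E i) U) -> covers [set x | exists i, E i x] U.
Proof.
move=> HE; have /choice[s Hs] : forall i, exists s : nat -> baire -> nat -> R,
    selectors s /\ forall x phi, E i x -> K x phi -> sats phi U ->
      exists m, forall k, `|phi k - s m x k| <= ratr e.
  by move=> i; have [s] := HE i; exists s.
apply: (@covers_selectors (I * nat)%type (fun im => s im.1 im.2)).
  by split=> [[i m] k|[i m] x] /=; have [[]] := Hs i.
move=> x phi [i Ei] Kp sp; have [_ /(_ x phi Ei Kp sp)[m Hm]] := Hs i.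
by exists (i, m).
Qed.

(** The halves at a cut [(k, q)] are [phi k >= q + e] and [phi k <= q]; the gap makes points of
    opposite halves [e]-separated. *)
Definition child (c : nat * rat) (b : bool) : cns := (c.1, if b then c.2 + e else c.2, b).

(* Points of [K x] outside all the covered halves form a compact set of diameter
   at most [e], for which one measurable selector suffices. *)
Lemma covers_split U (G : nat * rat -> bool -> set baire) :
  (forall c b, measurable (G c b)) -> (forall c b, covers (G c b) (child c b :: U)) ->
  covers [set x | forall c, exists b, G c b x] U.
Proof.
move=> mG cG.
(* The reversed constraint is again non-strict: it contains the complement of the half and keeps
   [L x] compact. *)
pose opp (cb : (nat * rat) * bool) : cns :=
  (cb.1.1, if cb.2 then cb.1.2 + e else cb.1.2, ~~ cb.2).
pose L x := [set phi | [/\ K x phi, sats phi U &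
  forall cb : (nat * rat) * bool, G cb.1 cb.2 x -> sat phi (opp cb)]].
have mL : forall V, measurable [set x | hits (L x) V].
  by apply: restrict_hits_measurable => cb; exact: mG.
have Lc x : pclosed (L x).
  move=> phi H; split.
  - by apply: K_pclosed => n; have [psi [? _ _] ?] := H n; exists psi.
  - move=> c cU; apply: sat_limit => n; have [psi [_ sp _] ?] := H n.
    by exists psi => //; exact: sp.
  - move=> cb Gcb; apply: sat_limit => n; have [psi [_ _ sp] ?] := H n.
    by exists psi => //; exact: sp.
have Lb x : pbounded (L x).
  by move=> k; exists 1 => phi [/Kbounded].
pose s0 x : nat -> R := if `[< L x !=set0 >] then cparam L x (fun=> false) else fun=> 0.
have /choice[s Hs] : forall cb : (nat * rat) * bool, exists s : nat -> baire -> nat -> R,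
    selectors s /\ forall x phi, G cb.1 cb.2 x -> K x phi -> sats phi (child cb.1 cb.2 :: U) ->
      exists m, forall k, `|phi k - s m x k| <= ratr e.
  by move=> [c b]; have [s] := cG c b; exists s.
apply: (@covers_selectors (option ((nat * rat) * bool * nat))
  (fun o => if o is Some cbm then s cbm.1 cbm.2 else s0)).
  split=> [[[cb m]|] k|[[cb m]|] x] /=; [by have [[]] := Hs cb| |by have [[]] := Hs cb|].
    have m0 := cparam_meas Lc Lb mL (fun=> false) k.
    have md := meas_on_dom m0.
    move=> a; apply: (measP_ext (T := baire) (P := fun x => (L x !=set0 /\ cparam L x (fun=> false) k < a) \/
       (~ (L x !=set0) /\ 0 < a))) => [x|].
      by have : [set: baire] x by []; rewrite /s0; case: asboolP => h /=; tauto.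
    by apply: measP_or => //; apply: measP_and; [exact: measP_not|exact: measP_const].
  rewrite /s0; case: asboolP => h //.
  by have [] := cparam_in Lc Lb (fun=> false) h.
move=> x phi Ex Kp sp; have [Lp|nL] := pselect (L x phi).
  have h : L x !=set0 by exists phi.
  exists None => k; rewrite /s0 asboolT//.
  have := cparam_in Lc Lb (fun=> false) h; move: (cparam _ _ _) => psi Lpsi.
  suff H f g : L x f -> L x g -> f k - g k <= ratr e.
    rewrite ler_norml H// andbT; have := H _ _ Lpsi Lp; lra.
  move=> [_ _ Hf] [_ _ Hg]; rewrite leNgt; apply/negP => fg.
  (* The cut [(k, q)] puts [f] and [g] strictly inside opposite halves. One of these is covered at
     [x], and its removal excludes [f] or [g] from [L x]. *)
  have [q /andP[gq qf]] : exists q : rat, g k < ratr q < f k - ratr e.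
    by apply: rat_lt_between; lra.
  have [[] Gb] := Ex (k, q).
    by have := Hf (k, q, true) Gb; rewrite /sat /= rmorphD /=; lra.
  by have := Hg (k, q, false) Gb; rewrite /sat /=; lra.
have [cb [Gcb sc]] : exists cb : (nat * rat) * bool, G cb.1 cb.2 x /\ sat phi (child cb.1 cb.2).
  apply: contrapT => nex; apply: nL; split => // cb Gcb.
  have [//|sc] := sat_total phi (cb.1.1, if cb.2 then cb.1.2 + e else cb.1.2) (~~ cb.2).
  by exfalso; apply: nex; exists cb; split => //; rewrite negbK in sc.
have [_ /(_ x phi Gcb Kp)[|m Hm]] := Hs cb; first by apply/sats_cons.
by exists (Some (cb, m)).
Qed.

End Epsilon.
End DenseSelectors.

(** * Good neighbourhoods and the Cantor scheme *)

Section Boundedness.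
Context (R : realType) (K : baire -> set (nat -> R)).
Hypothesis Kclosed : forall x phi,
  (forall n, exists x', exists psi, [/\ agree n x x', K x' psi & pnear phi psi n]) -> K x phi.
Hypothesis Kbounded : forall x phi k, K x phi -> `|phi k| <= 1.
Hypothesis K0 : forall x, K x (fun=> 0).
Variables (F : (nat -> nat) -> (nat -> nat) -> Prop) (e : rat).
Hypotheses (Fclosed : closed2 F) (e_gt0 : 0 < e).

(* [good n x y u]: the points of the projection of [F] having a witness in the
   [n]-th neighbourhood of [(x, y)] are covered by measurable sets [E s], one for
   each binary word [s] of length [n], over which [K] restricted by the
   constraints [u s] admits countably many measurable [e]-dense selectors. *)
Definition good n (x y : nat -> nat) (u : seq bool -> seq cns) : Prop :=
  exists E : seq bool -> set baire,
    (forall s, size s = n -> measurable (E s) /\ covers K e (E s) (u s)) /\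
    forall x' y', F x' y' -> agree n x x' -> agree n y y' ->
      exists s, size s = n /\ E s x'.

Definition refine (u : seq bool -> seq cns) (c : seq bool -> nat * rat) (s : seq bool) :=
  if s is b :: s' then child e (c s') b :: u s' else [::].

(** As [i] and [j] vary, the neighbourhoods of level [n + 1] of [set_at x n i] and [set_at y n j]
    exhaust the [n]-th neighbourhood of [(x, y)]. *)
Definition set_at (x : nat -> nat) n i := fun k => if k == n then i else x k.

Lemma set_at_agree x n i : agree n x (set_at x n i).
Proof. by move=> k kn; rewrite /set_at; case: eqP kn => // ->; rewrite ltnn. Qed.

Lemma agree_set_at n x x' : agree n x x' -> agree n.+1 (set_at x n (x' n)) x'.
Proof.
move=> H k; rewrite ltnS leq_eqVlt /set_at; case: eqP => [-> //|_ /=]; exact: H.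
Qed.

(* If every refinement is good, the sets witnessing this for each assignment [c] of
   cuts to the words combine: were [x'] in none of the new sets, choosing for each
   word a cut that fails at [x'] would contradict the goodness of that assignment. *)
Lemma good_step n x y u :
  (forall i j c, good n.+1 (set_at x n i) (set_at y n j) (refine u c)) -> good n x y u.
Proof.
(* Only the cuts at words of length [n] matter. Storing them in a finite function makes the
   assignments countable, as unions of measurable sets require. *)
move=> H; pose C := {ffun n.-tuple bool -> nat * rat}.
pose ext (c : C) (s : seq bool) : nat * rat :=
  if insub s is Some t then c t else (0%N, 0).
have /choice[E HE] : forall ijc : nat * nat * C, exists E : seq bool -> set baire,
    (forall s, size s = n.+1 -> measurable (E s) /\ covers K e (E s) (refine u (ext ijc.2) s)) /\
    forall x' y', F x' y' -> agree n.+1 (set_at x n ijc.1.1) x' ->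
      agree n.+1 (set_at y n ijc.1.2) y' -> exists s, size s = n.+1 /\ E s x'.
  by move=> [[i j] c]; exact: (H i j (ext c)).
pose G s (c0 : nat * rat) b : set baire :=
  [set w | exists ijc : nat * nat * C, ext ijc.2 s = c0 /\ E ijc (b :: s) w].
have mG s c0 b : size s = n -> measurable (G s c0 b).
  move=> sn; apply: measP_ex => ijc; apply: measP_and; first exact: measP_const.
  by have [/(_ (b :: s))[]] := HE ijc; rewrite /= ?sn.
have cG s c0 b : size s = n -> covers K e (G s c0 b) (child e c0 b :: u s).
  move=> sn; apply: (covers_bigcup K0) => ijc.
  have [Ec|nE] := pselect (ext ijc.2 s = c0).
    have [/(_ (b :: s))[|_ /=]] := HE ijc; first by rewrite /= sn.
    by rewrite Ec => -[s1 ss1 H1] _; exists s1 => // w phi [_]; exact: H1.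
  exists (fun _ _ _ => 0); last by move=> w phi [].
  by split=> // m k; apply: meas_on_cst.
exists (fun s => [set w | forall c0, exists b, G s c0 b w]); split=> [s sn|x' y' Fxy xx' yy'].
  split; last by apply: covers_split => // c b; [exact: mG|exact: cG].
  by apply: measP_all => c0; apply: measP_ex => b; exact: mG.
apply: contrapT => nex.
have /choice[c Hc] : forall t : n.-tuple bool, exists c0, forall b, ~ G t c0 b x'.
  move=> t; apply: contrapT => nc; apply: nex; exists (val t); rewrite size_tuple; split => // c0.
  by apply: contrapT => nb; apply: nc; exists c0 => b Gb; apply: nb; exists b.
have [_ /(_ x' y' Fxy)[||s [ss Es]]] := HE ((x' n, y' n), [ffun t => c t]).
- exact: agree_set_at.
- exact: agree_set_at.
case: s ss Es => // b s [ss] Es; have st : size s == n by rewrite ss.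
apply: (Hc (Tuple st) b); exists ((x' n, y' n), [ffun t => c t]); split => //=.
rewrite /ext; case: insubP => [t _ ts|]; last by rewrite st.
by rewrite ffunE; congr c; apply: val_inj.
Qed.

(** Where [u s] has no solution in [K], covering is vacuous. If each point of the neighbourhood had
    such a word, these sets would witness goodness; so some point satisfies the constraints of all
    words. *)
Lemma not_good_hits n x y u : ~ good n x y u -> exists x' y',
  [/\ F x' y', agree n x x', agree n y y' & forall s, size s = n -> hits (K x') (u s)].
Proof.
move=> ng; apply: contrapT => nex; apply: ng.
exists (fun s => [set w | ~ hits (K w) (u s)]); split=> [s _|x' y' Fxy xx' yy'].
  split; first by apply: measP_not; exact: K_hits_measurable.
  exists (fun _ _ _ => 0); first by split=> // m k; apply: meas_on_cst.
  by move=> w phi nh Kp sp; exfalso; apply: nh; exists phi.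
apply: contrapT => ns; apply: nex; exists x', y'; split => // s sn.
by apply: contrapT => nh; apply: ns; exists s.
Qed.

Definition stage := ((nat -> nat) * (nat -> nat) * (seq bool -> seq cns))%type.

Lemma bad_step n (st : stage) : exists st' : stage,
  ~ good n st.1.1 st.1.2 st.2 ->
  [/\ ~ good n.+1 st'.1.1 st'.1.2 st'.2, agree n st.1.1 st'.1.1, agree n st.1.2 st'.1.2 &
      exists c, st'.2 = refine st.2 c].
Proof.
case: st => [[x y] u] /=; have [g|ng] := pselect (good n x y u); first by exists ((x, y), u).
have [i [j [c nb]]] : exists i j c,
    ~ good n.+1 (set_at x n i) (set_at y n j) (refine u c).
  apply: contrapT => nex; apply: ng; apply: good_step => i j c.
  by apply: contrapT => nb; apply: nex; exists i, j, c.
exists ((set_at x n i, set_at y n j), refine u c) => _; split => //=.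
- exact: set_at_agree.
- exact: set_at_agree.
- by exists c.
Qed.

(** The latest bit comes first, since [refine] branches on the head. *)
Fixpoint word (a : nat -> bool) n : seq bool := if n is m.+1 then a m :: word a m else [::].

Lemma size_word a n : size (word a n) = n.
Proof. by elim: n => //= n ->. Qed.

Lemma word_ext a b n : (forall i, (i < n)%N -> a i = b i) -> word a n = word b n.
Proof.
elim: n => //= n IH H; rewrite H// IH// => i ni; apply: H; exact: ltn_trans ni _.
Qed.

(* Otherwise bad refinements can be chosen forever; they converge to a point [x] of
   the projection and yield a Cantor scheme of [e]-separated points of [K x]. *)
Lemma separable_good : (forall x y, F x y -> exists s : nat -> nat -> R, forall phi, K x phi ->
    forall d : R, 0 < d -> exists n, forall k, `|phi k - s n k| <= d) ->
  exists2 E : set baire, measurable E /\ (forall x y, F x y -> E x) & covers K e E [::].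
Proof.
move=> sep; suff [E [HE EF]] : good 0 (fun=> 0%N) (fun=> 0%N) (fun=> [::]).
  exists (E [::]); last by have [] := HE [::] erefl.
  split; first by have [] := HE [::] erefl.
  by move=> x y Fxy; have [//|//|s [/size0nil -> ]] := EF x y Fxy.
apply: contrapT => bad0.
have /choice[nx Hnx] := fun nst : nat * stage => bad_step nst.1 nst.2.
pose fix st n : stage := if n is m.+1 then nx (m, st m)
  else (((fun=> 0%N), (fun=> 0%N)), fun=> [::]).
have bad n : ~ good n (st n).1.1 (st n).1.2 (st n).2.
  by elim: n => // n IH; have [] := Hnx (n, st n) IH.
have xS n : agree n (st n).1.1 (st n.+1).1.1 by have [] := Hnx (n, st n) (bad n).
have yS n : agree n (st n).1.2 (st n.+1).1.2 by have [] := Hnx (n, st n) (bad n).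
have /choice[c Hc] : forall n, exists c, (st n.+1).2 = refine (st n).2 c.
  by move=> n; have [] := Hnx (n, st n) (bad n).
have mono (z : nat -> nat -> nat) : (forall n, agree n (z n) (z n.+1)) ->
    forall n, agree n (fun i => z i.+1 i) (z n).
  move=> zS n i; elim: n => // n IH; rewrite ltnS leq_eqVlt => /orP[/eqP->//|ni].
  by rewrite IH// zS.
(* Entry [i] no longer changes from stage [i + 1] on, so the stages converge to [(x, y)]. *)
pose x i := (st i.+1).1.1 i; pose y i := (st i.+1).1.2 i.
have xn n : agree n x (st n).1.1 by exact: (mono (fun n => (st n).1.1)).
have yn n : agree n y (st n).1.2 by exact: (mono (fun n => (st n).1.2)).
have /choice[xy' Hxy'] : forall n, exists xy' : (nat -> nat) * (nat -> nat),
    [/\ F xy'.1 xy'.2, agree n x xy'.1, agree n y xy'.2 &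
        forall s, size s = n -> hits (K xy'.1) ((st n).2 s)].
  move=> n; have [x' [y' [Fxy xx' yy' Hh]]] := not_good_hits (bad n).
  by exists (x', y'); split => //; [exact: agree_trans (xn n) xx'|exact: agree_trans (yn n) yy'].
have Fxy : F x y.
  apply: Fclosed => n; exists (xy' n).1, (xy' n).2.
  by have [] := Hxy' n.
pose U a n := (st n).2 (word a n).
have US a n : U a n.+1 = child e (c n (word a n)) (a n) :: U a n.
  by rewrite /U Hc.
have Umono a m n c0 : (m <= n)%N -> c0 \in U a m -> c0 \in U a n.
  elim: n => [|n IH]; first by rewrite leqn0 => /eqP->.
  by rewrite leq_eqVlt ltnS => /orP[/eqP->//|mn cm]; rewrite US inE IH ?orbT.
have /choice[p Hp] : forall a : nat -> bool, exists phi, K x phi /\ forall n, sats phi (U a n).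
  move=> a; have /choice[v Hv] : forall n, exists phi, K (xy' n).1 phi /\ sats phi (U a n).
    move=> n; have [_ _ _ /(_ (word a n) (size_word a n))[phi]] := Hxy' n.
    by exists phi.
  have [|||phi Kphi sphi] := @K_limit _ K Kclosed Kbounded x (fun n => (xy' n).1) v (U a).
  - by move=> n; have [] := Hxy' n.
  - by move=> n; have [] := Hv n.
  - by move=> m n c0 mn cm; have [_] := Hv n; apply; exact: Umono cm.
  by exists phi.
(* Up to the first bit where they differ, [a] and [b] have the same word, hence the same cut; there
   they enter opposite halves. *)
have psep a b : (exists i, a i != b i) -> exists k, ratr e <= `|p a k - p b k|.
  move=> abi; have abm := ex_minnP abi; case: abm => m abm mmin.
  have wE : word a m = word b m.
    apply: word_ext => i im; apply: contrapT => /eqP ab.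
    by have := mmin i ab; rewrite leqNgt im.
  exists (c m (word a m)).1.
  have [_ /(_ m.+1) sa] := Hp a; have [_ /(_ m.+1) sb] := Hp b.
  move: sa sb; rewrite !US => /sats_cons[sa _] /sats_cons[sb _].
  move: sa sb; rewrite -wE /sat /=.
  case: (a m) (b m) abm => -[]//= _ sa sb.
    by rewrite ger0_norm; move: sa; rewrite rmorphD /=; first lra; move=> ?;
      have := e_gt0; rewrite -(@ltr0q R); lra.
  by rewrite ler0_norm; move: sb; rewrite rmorphD /=; first lra; move=> ?;
      have := e_gt0; rewrite -(@ltr0q R); lra.
have [s Hs] := sep x y Fxy.
have e3 : 0 < ratr e / 3 :> R by rewrite divr_gt0 ?ltr0q.
(* [b n] is a branch with [p (b n)] within [e/3] of [s n], if there is one. The diagonal branch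
   differs from every [b n], yet the [s n] approximating it would put it within [2e/3] of [b n]. *)
have /choice[b Hb] : forall n, exists b : nat -> bool, forall a,
    (forall k, `|p a k - s n k| <= ratr e / 3) -> forall k, `|p b k - s n k| <= ratr e / 3.
  move=> n; have [[b bn]|nb] := pselect (exists b, forall k, `|p b k - s n k| <= ratr e / 3).
    by exists b.
  by exists (fun=> true) => a Ha; exfalso; apply: nb; exists a.
pose a n := ~~ b n n.
have [Kpa _] := Hp a.
have [n Hn] := Hs (p a) Kpa _ e3.
have [|k] := psep a (b n); first by exists n; rewrite /a; case: (b n n).
have := Hb n a Hn k; have := Hn k; rewrite !ler_norml => /andP[? ?] /andP[? ?].
by rewrite leNgt => /negP; apply; rewrite ltr_norml; apply/andP; split; lra.
Qed.

End Boundedness.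

Theorem measurable_dense_selectors (R : realType) (K : baire -> set (nat -> R)) (B : set baire) :
  (forall x phi, (forall n, exists x', exists psi,
     [/\ agree n x x', K x' psi & pnear phi psi n]) -> K x phi) ->
  (forall x phi k, K x phi -> `|phi k| <= 1) -> (forall x, K x (fun=> 0)) ->
  measurable B ->
  (forall x, B x -> exists s : nat -> nat -> R, forall phi, K x phi ->
     forall d : R, 0 < d -> exists n, forall k, `|phi k - s n k| <= d) ->
  exists2 s : nat -> baire -> nat -> R, selectors K s &
    forall x, B x -> forall phi, K x phi -> forall d : R, 0 < d ->
      exists n, forall k, `|phi k - s n x k| <= d.
Proof.
move=> Kc Kb K0 /borel_analytic[F Fc BF] sep.
have /choice[s Hs] : forall j : nat, exists s : nat -> baire -> nat -> R, selectors K s /\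
    forall x phi, B x -> K x phi -> exists m, forall k, `|phi k - s m x k| <= j.+1%:R^-1.
  move=> j; have e0 : 0 < j.+1%:R^-1 :> rat by rewrite invr_gt0.
  have [|E [mE EF] [s ss Hs]] := separable_good Kc Kb K0 Fc e0.
    by move=> x y Fxy; apply: sep; apply/BF; exists y.
  exists s; split => // x phi /BF[y Fxy] Kp; have [m Hm] := Hs x phi (EF _ _ Fxy) Kp (sats_nil phi).
  by exists m => k; move: (Hm k); rewrite fmorphV /= ratr_nat.
have [|s' ss' Hs'] := countable_selectors K0 (I := (nat * nat)%type) (s := fun jm => s jm.1 jm.2).
  by split=> [[j m] k|[j m] x] /=; have [[]] := Hs j.
exists s' => // x Bx phi Kp d d0; have [j jd] := invS_lt d0.
have [_ /(_ x phi Bx Kp)[m Hm]] := Hs j.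
have [n nE] := Hs' (j, m); exists n => k; rewrite nE /=.
exact: le_trans (Hm k) (ltW jd).
Qed.

(** * Continuous functions on Cantor space *)

Section CantorContinuity.
Context (R : realType).
Implicit Types (phi : cantor_space -> R) (t : cantor_space).


Definition agreeb n (t t' : nat -> bool) : Prop := forall i, (i < n)%N -> t i = t' i.

Lemma cylinder_nbhs (t : cantor_space) n : nbhs t [set t' : cantor_space | agreeb n t t'].
Proof.
elim: n => [|n IH]; first exact: filterS filterT.
have nt : nbhs t [set t' : cantor_space | (t : nat -> bool) n = (t' : nat -> bool) n].
  exact: (@proj_continuous nat (fun=> bool) n t [set b | t n = b]).
apply: filterS (filterI nt IH) => t' [tn H] i.
by rewrite ltnS leq_eqVlt => /orP[/eqP->//|]; exact: H.
Qed.

Lemma nbhs_cylinder (t : cantor_space) (A : set cantor_space) : nbhs t A ->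
  exists n, forall t' : cantor_space, agreeb n t t' -> A t'.
Proof.
move=> tA; apply: contrapT => nex.
have /choice[u Hu] : forall n, exists t' : cantor_space, agreeb n t t' /\ ~ A t'.
  move=> n; apply: contrapT => nH; apply: nex; exists n => t' tt'.
  by apply: contrapT => nA; apply: nH; exists t'.
have : u @ \oo --> t.
  apply/(@pointwise_cvgP nat bool) => k B /= /nbhs_singleton Bt.
  exists k.+1 => // n /= kn; have [H _] := Hu n.
  by rewrite -(H k).
move=> /(_ A tA) [n _ /(_ n (leqnn n))] /=.
by have [] := Hu n.
Qed.

Definition cyl_cont (phi : cantor_space -> R) : Prop := forall t (e : R), 0 < e ->
  exists n, forall t' : cantor_space, agreeb n t t' -> `|phi t' - phi t| < e.

Lemma cfun_cyl_cont (f : CD R) : cyl_cont (cfun f).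
Proof.
move=> t e e0; apply: nbhs_cylinder.
have /cvgrPdist_lt/(_ e e0) := @cfun_cont _ f t.
by apply: filterS => t'; rewrite distrC.
Qed.

Lemma cyl_cont_cfun phi : cyl_cont phi ->
  forall t, @continuous_at cantor_space R t phi.
Proof.
move=> H t; apply/cvgrPdist_lt => e e0; have [n Hn] := H t e e0.
by apply: filterS (cylinder_nbhs t n) => t' /Hn; rewrite distrC.
Qed.

Definition mkCD phi (H : cyl_cont phi) : CD R := MkCD (cyl_cont_cfun H).

Lemma CD_ext (f g : CD R) : (forall t, cfun f t = cfun g t) -> f = g.
Proof.
case: f g => [f cf] [g cg] /= /funext fg; move: cf cg; rewrite fg => cf cg.
by congr MkCD; exact: Prop_irrelevance.
Qed.

(** The eventually false sequences are countable and dense, so sup norms become countable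
    suprema. *)
Definition cpoint (s : seq bool) : cantor_space := fun i => nth false s i.

Lemma cpoint_agree (t : cantor_space) n : agreeb n t (cpoint (mkseq t n)).
Proof. by move=> i ni; rewrite /cpoint nth_mkseq. Qed.

Lemma cpoint_dense phi (c : R) : cyl_cont phi ->
  (forall s, `|phi (cpoint s)| <= c) -> forall t, `|phi t| <= c.
Proof.
move=> cphi H t; apply/ler_addgt0Pr => e e0; have [n Hn] := cphi t e e0.
have := Hn _ (@cpoint_agree t n); have := H (mkseq t n).
move: (phi _) (phi _) => x y; rewrite !ler_norml ltr_norml.
by move=> /andP[? ?] /andP[? ?]; apply/andP; split; lra.
Qed.


Lemma CDlin_cont (a : R) (f : CD R) (b : R) (g : CD R) t :
  @continuous_at cantor_space R t (fun t => a * cfun f t + b * cfun g t).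
Proof.
by apply: cvgD; apply: cvgM; try exact: cvg_cst; exact: @cfun_cont.
Qed.

Definition CDlin (a : R) (f : CD R) (b : R) (g : CD R) : CD R := MkCD (@CDlin_cont a f b g).

Lemma CDlinE a f b g : lincomb (CDlin a f b g) a f b g. Proof. by []. Qed.

Lemma lincomb_eq h a (f : CD R) b g : lincomb h a f b g -> h = CDlin a f b g.
Proof. by move=> H; exact: CD_ext. Qed.

Lemma CDcst_cont (c : R) t : @continuous_at cantor_space R t (fun=> c).
Proof. exact: cvg_cst. Qed.

Definition CDcst (c : R) : CD R := MkCD (@CDcst_cont c).

Definition fbounded phi : Prop := exists M, forall t, `|phi t| <= M.

Lemma cfun_bounded (f : CD R) : fbounded (cfun f).
Proof.
have : compact (cfun f @` [set: cantor_space]).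
  apply: continuous_compact cantor_space_compact.
  by apply: continuous_subspaceT => t; exact: @cfun_cont.
move=> /compact_bounded[M [_ HM]]; exists (M + 1) => t.
by apply: HM; [rewrite ltrDl|exists t].
Qed.

Lemma normf_ub phi t : fbounded phi -> `|phi t| <= normf phi.
Proof.
by move=> [M HM]; apply: ub_le_sup; [exists M => _ [s _ <-]|exists t].
Qed.

Lemma normf_leP phi c : fbounded phi -> normf phi <= c <-> forall t, `|phi t| <= c.
Proof.
move=> bp; split=> [H t|H]; first exact: le_trans (normf_ub _ bp) H.
by apply: ge_sup; [exists `|phi point|, point|move=> _ [t _ <-]].
Qed.

Lemma normC_leP (f : CD R) c : normC f <= c <-> forall t, `|cfun f t| <= c.
Proof. exact/normf_leP/cfun_bounded. Qed.

Lemma normC_ub (f : CD R) t : `|cfun f t| <= normC f.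
Proof. by apply: normf_ub; exact: cfun_bounded. Qed.

Lemma normC_ge0 (f : CD R) : 0 <= normC f.
Proof. exact: le_trans (normr_ge0 _) (normC_ub f point). Qed.

Lemma distC_normC (f g : CD R) : distC f g = normC (CDlin 1 f (-1) g).
Proof.
rewrite /distC /normC; congr normf; apply/funext => t /=.
by rewrite mul1r mulN1r.
Qed.

Lemma distC_leP (f g : CD R) c : distC f g <= c <-> forall t, `|cfun f t - cfun g t| <= c.
Proof. by rewrite distC_normC normC_leP /=; split=> H t; have := H t; rewrite mul1r mulN1r. Qed.

Lemma distC_ub (f g : CD R) t : `|cfun f t - cfun g t| <= distC f g.
Proof. by move: t; apply/distC_leP. Qed.

Lemma distC_ge0 (f g : CD R) : 0 <= distC f g.
Proof. by rewrite distC_normC normC_ge0. Qed.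

Lemma distC_sym (f g : CD R) : distC f g = distC g f.
Proof.
by rewrite /distC /normf; congr sup; apply/seteqP; split=> _ [t _ <-]; exists t => //; rewrite distrC.
Qed.

Lemma distC_tri (g f h : CD R) : distC f h <= distC f g + distC g h.
Proof.
apply/distC_leP => t; rewrite -(subrK (cfun g t) (cfun f t)) -addrA.
by rewrite (le_trans (ler_normD _ _))// lerD// distC_ub.
Qed.

Lemma distCxx (f : CD R) : distC f f = 0.
Proof. by apply/eqP; rewrite eq_le distC_ge0 andbT; apply/distC_leP => t; rewrite subrr normr0. Qed.

Lemma distC_eq0 (f g : CD R) : (forall e, 0 < e -> distC f g <= e) -> f = g.
Proof.
move=> H; apply: CD_ext => t; apply/eqP; rewrite -subr_eq0 -normr_le0.
apply/ler_addgt0Pr => e e0; rewrite add0r.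
exact: le_trans (distC_ub f g t) (H e e0).
Qed.

Lemma normC_dist (f g : CD R) : `|normC f - normC g| <= distC f g.
Proof.
suff H (f1 g1 : CD R) : normC f1 - normC g1 <= distC f1 g1.
  by rewrite ler_norml H andbT lerNl opprB distC_sym H.
rewrite lerBlDr; apply/normC_leP => t; rewrite -(subrK (cfun g1 t) (cfun f1 t)).
by rewrite (le_trans (ler_normD _ _))// lerD ?distC_ub ?normC_ub.
Qed.

Lemma normC_lin a (f : CD R) b g : normC (CDlin a f b g) <= `|a| * normC f + `|b| * normC g.
Proof.
apply/normC_leP => t /=; rewrite (le_trans (ler_normD _ _))// !normrM.
by rewrite lerD// ler_wpM2l// normC_ub.
Qed.

Lemma normC_scale a (f : CD R) g : normC (CDlin a f 0 g) = `|a| * normC f.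
Proof.
apply/eqP; rewrite eq_le; apply/andP; split.
  by rewrite (le_trans (normC_lin _ _ _ _))// normr0 mul0r addr0.
have [->|a0] := eqVneq a 0; first by rewrite normr0 mul0r normC_ge0.
rewrite mulrC -ler_pdivlMr ?normr_gt0//; apply/normC_leP => t.
rewrite ler_pdivlMr ?normr_gt0// mulrC -normrM.
by have := normC_ub (CDlin a f 0 g) t; rewrite /= mul0r addr0.
Qed.

Lemma CD_complete (u : nat -> CD R) (r : nat -> R) :
  (forall e, 0 < e -> exists n, r n < e) ->
  (forall n m, (n <= m)%N -> distC (u n) (u m) <= r n) ->
  exists f, forall n, distC (u n) f <= r n.
Proof.
move=> r0 ur.
have cu (t : cantor_space) : cvg ((fun n => cfun (u n) t) @ \oo).
  apply/cauchy_cvgP/cauchy_exP => e e0; have [n ne] := r0 e e0.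
  exists (cfun (u n) t); exists n => // m /= nm.
  exact: le_lt_trans (distC_ub _ _ _) (le_lt_trans (ur _ _ nm) ne).
pose phi t := lim ((fun n => cfun (u n) t) @ \oo).
have uphi n t : `|cfun (u n) t - phi t| <= r n.
  have H : (fun m => `|cfun (u n) t - cfun (u m) t|) @ \oo --> `|cfun (u n) t - phi t|.
    by apply: cvg_norm; apply: cvgB; [exact: cvg_cst|exact: cu].
  rewrite -(cvg_lim _ H)//; apply: limr_le; first by apply/cvg_ex; eexists; exact: H.
  by exists n => // m /= nm; exact: le_trans (distC_ub _ _ _) (ur _ _ nm).
have cphi : cyl_cont phi.
  move=> t e e0; have e3 : 0 < e / 3 by rewrite divr_gt0.
  have [n ne] := r0 _ e3; have [m Hm] := cfun_cyl_cont (u n) t e3.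
  exists m => t' /Hm; have := uphi n t; have := uphi n t'.
  rewrite !ler_norml !ltr_norml => /andP[? ?] /andP[? ?] /andP[? ?].
  by apply/andP; split; lra.
by exists (mkCD cphi) => n; apply/distC_leP => t; exact: uphi.
Qed.

Lemma distC_dense (f g : CD R) c :
  distC f g <= c <-> forall s, `|cfun f (cpoint s) - cfun g (cpoint s)| <= c.
Proof.
split=> [/distC_leP H s|H]; first exact: H.
rewrite distC_normC; apply/normC_leP; apply: cpoint_dense (@cfun_cyl_cont _) _ => s /=.
by rewrite mul1r mulN1r.
Qed.

End CantorContinuity.

(** * Measurable maps into [C(Delta)] *)

Section MeasurableCD.
Context (R : realType) d (T : measurableType d) (D : set T) (mD : measurable D).
Context (dn : nat -> CD R).
Hypothesis dn_dense : forall f (e : R), 0 < e -> exists n, distC (dn n) f < e.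

(** Since [C(Delta)] is separable and its norm is a countable supremum, scalar measurability amounts
    to Borel measurability: see [measC_borel] and [borel_measC]. *)
Definition measC (Phi : T -> CD R) : Prop := forall t, meas_on D (fun w => cfun (Phi w) t).

Lemma measC_cst f : measC (fun=> f).
Proof. by move=> t; exact: meas_on_cst. Qed.

Lemma measC_lin a b Phi Psi : measC Phi -> measC Psi ->
  measC (fun w => CDlin a (Phi w) b (Psi w)).
Proof. by move=> H1 H2 t; apply: meas_onD; apply: meas_onZ. Qed.

Lemma measC_dist Phi Psi : measC Phi -> measC Psi ->
  meas_on D (fun w => distC (Phi w) (Psi w)).
Proof.
move=> H1 H2; apply: (meas_on_sup (I := seq bool)
   (f := fun s w => `|cfun (Phi w) (cpoint s) - cfun (Psi w) (cpoint s)|)) => //.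
  by move=> s; apply: meas_on_norm; apply: meas_onB.
by move=> w c _; exact: distC_dense.
Qed.

Lemma measC_norm Phi : measC Phi -> meas_on D (fun w => normC (Phi w)).
Proof.
move=> H1; apply: (meas_on_ext (f := fun w => distC (Phi w) (CDcst 0))) => [w _|].
  by rewrite /distC /normC; congr normf; apply/funext => t /=; rewrite subr0.
by apply: measC_dist => //; exact: measC_cst.
Qed.

Lemma measC_borel Phi E : measC Phi -> borelC E -> measurable [set w | D w /\ E (Phi w)].
Proof.
move=> mPhi; move: E; apply: measurable_generated => //.
move=> U oU /=; apply: (measP_ext (P := fun w => exists n : nat, exists q : rat,
   (forall g, distC (dn n) g < ratr q -> U g) /\ (D w /\ distC (dn n) (Phi w) < ratr q))) => [w|].
  split=> [[n [q [H [Dw Hd]]]]|[Dw /oU[e e0 He]]]; first by split => //; exact: H.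
  have e2 : 0 < e / 2 by rewrite divr_gt0.
  have [q /andP[q0 qe]] := rat_lt_between e2.
  have [n Hn] := dn_dense (Phi w) q0; exists n, q; split => // g ng; apply: He.
  apply: (le_lt_trans (distC_tri (dn n) _ _)).
  by rewrite distC_sym in Hn; lra.
apply: measP_ex => n; apply: measP_ex => q; apply: measP_and; first exact: measP_const.
by apply: (measC_dist (measC_cst _) mPhi).
Qed.

Lemma borel_measC Phi : (forall E, borelC E -> measurable [set w | D w /\ E (Phi w)]) ->
  measC Phi.
Proof.
move=> H t c; apply: (H [set f | cfun f t < c]).
apply: sub_sigma_algebra => f /= fc; exists (c - cfun f t); first by rewrite subr_gt0.
move=> g; have := distC_ub f g t; rewrite ler_norml => /andP[? ?] ?; lra.
Qed.

Lemma measC_approx (I : countType) (S : nat -> I -> T -> Prop) (Psi : I -> T -> CD R)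
    (Phi : T -> CD R) :
  (forall n i, measurable [set w | D w /\ S n i w]) ->
  (forall i, measC (Psi i)) ->
  (forall w n, D w -> exists i, S n i w) ->
  (forall w, D w -> forall e, 0 < e -> exists n, forall m i, (n <= m)%N -> S m i w ->
     distC (Psi i w) (Phi w) < e) ->
  measC Phi.
Proof.
move=> mS mPsi exS apx t.
apply: (meas_on_approx (S := S) (r := fun i w => cfun (Psi i w) t)) => // [i|w Dw e e0].
  exact: mPsi.
have [n Hn] := apx w Dw e e0; exists n => m i nm Si.
exact: le_lt_trans (distC_ub _ _ _) (Hn m i nm Si).
Qed.

End MeasurableCD.

(** * Extension of operators and duality *)

Section Extension.
Context (R : realType).

Lemma rat_approx (a e : R) : 0 < e -> exists r : rat, `|a - ratr r| < e.
Proof.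
move=> e0; have [r /andP[ar rae]] : exists r : rat, a < ratr r < a + e.
  by apply: rat_lt_between; rewrite ltrDl.
by exists r; rewrite ltr_norml; apply/andP; split; lra.
Qed.

Lemma distC_lin (a b r q : R) (f g f' g' : CD R) :
  distC (CDlin a f b g) (CDlin r f' q g') <=
  `|a - r| * normC f + `|r| * distC f f' + (`|b - q| * normC g + `|q| * distC g g').
Proof.
apply/distC_leP => t /=.
have -> : a * cfun f t + b * cfun g t - (r * cfun f' t + q * cfun g' t) =
  ((a - r) * cfun f t + r * (cfun f t - cfun f' t)) +
  ((b - q) * cfun g t + q * (cfun g t - cfun g' t)) by ring.
rewrite (le_trans (ler_normD _ _))// lerD//;
  by rewrite (le_trans (ler_normD _ _))// !normrM lerD// ler_wpM2l// ?normC_ub// distC_ub.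
Qed.

(** The common form of the epsilon arguments below. The restriction [d <= 1] permits constants such
    as [|a| + 1] as bounds for approximations of [a]. *)
Lemma le0_scaled (c x : R) : (forall d, 0 < d -> d <= 1 -> x <= d * c) -> x <= 0.
Proof.
move=> H; rewrite leNgt; apply/negP => x0.
have c0 : 0 < c.
  by have := H 1 ltr01 (lexx _); rewrite mul1r; apply: lt_le_trans.
pose d := Num.min 1 (x / (c * 2)).
have d0 : 0 < d by rewrite lt_min ltr01 divr_gt0// mulr_gt0.
have := H d d0 _; rewrite {1}/d ge_min lexx => /(_ isT).
have : d * c <= x / 2.
  rewrite (le_trans (y := x / (c * 2) * c))//.
    by rewrite (ler_wpM2r (ltW c0))// /d ge_min lexx orbT.
  by have -> : x / (c * 2) * c = x / 2 by field; rewrite gt_eqF.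
lra.
Qed.

Variables (X : SB R) (x : nat -> CD R).
Hypothesis Xx : forall n, sbset X (x n).
Hypothesis x_dense : forall f, sbset X f -> forall e : R, 0 < e -> exists n, distC (x n) f < e.
Hypothesis x_lin : forall (k m : nat) (r q : rat),
  exists n, lincomb (x n) (ratr r) (x k) (ratr q) (x m).

(** Differences of terms are again terms, so the norm bound makes [T] Lipschitz on the sequence, and
    [A] is its extension by completeness. Real linearity is reached by approximating the
    coefficients along with the vectors. *)
Lemma bounded_extension (T : nat -> CD R) (L : R) : 0 <= L ->
  (forall n k m r q, lincomb (x n) (ratr r) (x k) (ratr q) (x m) ->
     lincomb (T n) (ratr r) (T k) (ratr q) (T m)) ->
  (forall n, normC (T n) <= L * normC (x n)) ->
  exists A : CD R -> CD R,
  [/\ forall f g h a b, sbset X f -> sbset X g -> sbset X h -> lincomb h a f b g ->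
        lincomb (A h) a (A f) b (A g),
      forall f, sbset X f -> normC (A f) <= L * normC f,
      forall n, A (x n) = T n &
      forall f n, sbset X f -> distC (T n) (A f) <= L * distC (x n) f].
Proof.
move=> L0 Tlin Tbnd.
have Tlip n m : distC (T n) (T m) <= L * distC (x n) (x m).
  have [p Hp] := x_lin n m 1 (-1); have := Tlin _ _ _ _ _ Hp.
  move: Hp => /lincomb_eq Ep /lincomb_eq Et; have := Tbnd p.
  by rewrite Et Ep rmorph1 rmorphN1 -!distC_normC.
have /choice[A HA] : forall f, exists g, sbset X f -> forall n, distC (T n) g <= L * distC (x n) f.
  move=> f; have [Xf|nXf] := pselect (sbset X f); last by exists f.
  have /choice[k Hk] : forall i : nat, exists n, distC (x n) f < i.+1%:R^-1.
    by move=> i; apply: x_dense => //; rewrite invr_gt0.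
  (* Terms within [1/(i+1)] of [f] are at most twice that apart; the extra 1 keeps the constant
     positive when [L = 0]. *)
  have [||g Hg] := @CD_complete R (fun i => T (k i)) (fun i => (L * 2 + 1) * i.+1%:R^-1).
  - move=> e e0; have L1 : 0 < L * 2 + 1 by lra.
    have [|n Hn] := @invS_lt R (e / (L * 2 + 1)); first by rewrite divr_gt0.
    by exists n; rewrite mulrC -ltr_pdivlMr.
  - move=> n m nm; apply: (le_trans (Tlip _ _)).
    have := distC_tri f (x (k n)) (x (k m)); rewrite (distC_sym f).
    have := Hk n; have := Hk m; have := @invS_le R _ _ nm.
    have : 0 < n.+1%:R^-1 :> R by rewrite invr_gt0.
    set u := n.+1%:R^-1; set v := m.+1%:R^-1; set p1 := distC (x (k n)) f.
    set p2 := distC (x (k m)) f; set p3 := distC (x (k n)) (x (k m)) => ? ? ? ? ?.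
    have : L * p3 <= L * (2 * u) by apply: ler_wpM2l => //; lra.
    lra.
  exists g => _ n.
  rewrite -subr_le0; apply: (@le0_scaled (L + (L * 2 + 1))) => e e0 _.
  have [i Hi] := invS_lt e0.
  have := distC_tri (T (k i)) (T n) g; have := Hg i; have := Tlip n (k i).
  have := distC_tri f (x n) (x (k i)); rewrite (distC_sym f); have := Hk i.
  set u := i.+1%:R^-1; set a := distC (x n) (x (k i)); set b := distC (x n) f.
  move=> ? ? h1 h2 h3; have ui : u <= e by exact: ltW.
  have : L * a <= L * (b + e) by apply: ler_wpM2l => //; lra.
  have : (L * 2 + 1) * u <= (L * 2 + 1) * e by apply: ler_wpM2l => //; lra.
  lra.
have Abnd f : sbset X f -> normC (A f) <= L * normC f.
  move=> Xf; rewrite -subr_le0; apply: (@le0_scaled (L * 2)) => e e0 _.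
  have [n Hn] := x_dense Xf e0.
  have := HA f Xf n; have := Tbnd n.
  have := normC_dist (T n) (A f); have := normC_dist (x n) f.
  rewrite !ler_norml => /andP[? ?] /andP[? ?] ? ?.
  have : L * distC (x n) f <= L * e by apply: ler_wpM2l => //; lra.
  have : L * normC (x n) <= L * (normC f + e) by apply: ler_wpM2l => //; lra.
  lra.
exists A; split => // [f g h a b Xf Xg Xh hE|n|f n Xf]; last exact: HA.
- suff -> : A h = CDlin a (A f) b (A g) by [].
  apply: distC_eq0 => e0 e00; rewrite -[e0]addr0 -lerBlDl.
  apply: (le_trans (y := distC (A h) (CDlin a (A f) b (A g)))); first lra.
  pose C1 := normC f + (`|a| + 1) + (normC g + (`|b| + 1)).
  pose C2 := normC (A f) + (`|a| + 1) * L + (normC (A g) + (`|b| + 1) * L).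
  apply: (@le0_scaled (L * C1 + C2)) => e e0' e1.
  have [r Hr] := rat_approx a e0'; have [q Hq] := rat_approx b e0'.
  have [k Hk] := x_dense Xf e0'; have [m Hm] := x_dense Xg e0'.
  have [n Hn] := x_lin k m r q.
  have En := lincomb_eq Hn; have ET := lincomb_eq (Tlin _ _ _ _ _ Hn).
  have ra : `|ratr r| <= `|a| + 1 :> R.
    have := ler_normB a (a - ratr r); rewrite opprB addrC subrK; lra.
  have qb : `|ratr q| <= `|b| + 1 :> R.
    have := ler_normB b (b - ratr q); rewrite opprB addrC subrK; lra.
  have key (u v u' v' : CD R) (M : R) : 0 <= M -> distC u u' <= M * e -> distC v v' <= M * e ->
      distC (CDlin a u b v) (CDlin (ratr r) u' (ratr q) v') <=
      e * (normC u + (`|a| + 1) * M + (normC v + (`|b| + 1) * M)).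
    move=> M0 uu' vv'; apply: (le_trans (distC_lin _ _ _ _ _ _ _ _)).
    rewrite mulrDr; apply: lerD; rewrite mulrDr; apply: lerD.
    + by rewrite ler_wpM2r ?normC_ge0 ?ltW.
    + rewrite (le_trans (ler_pM _ _ ra uu'))// ?distC_ge0//.
      by rewrite [X in _ <= X]mulrC mulrA.
    + by rewrite ler_wpM2r ?normC_ge0 ?ltW.
    + rewrite (le_trans (ler_pM _ _ qb vv'))// ?distC_ge0//.
      by rewrite [X in _ <= X]mulrC mulrA.
  have d1 : distC h (x n) <= e * C1.
    rewrite (lincomb_eq hE) En; have := key f g (x k) (x m) 1 ler01.
    by rewrite !mulr1 !mul1r; apply; rewrite distC_sym ltW.
  have d2 : distC (CDlin a (A f) b (A g)) (T n) <= e * C2.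
    rewrite ET; apply: key => //; rewrite distC_sym.
      by apply: (le_trans (HA f Xf k)); rewrite ler_wpM2l// ltW.
    by apply: (le_trans (HA g Xg m)); rewrite ler_wpM2l// ltW.
  have := distC_tri (T n) (A h) (CDlin a (A f) b (A g)).
  rewrite [distC (A h) (T n)]distC_sym [distC (T n) (CDlin _ _ _ _)]distC_sym.
  have := HA h Xh n; rewrite [distC (x n) h]distC_sym.
  have : L * distC h (x n) <= L * (e * C1) by apply: ler_wpM2l.
  lra.
- apply/esym/distC_eq0 => e e0; apply: (le_trans (HA _ (Xx n) n)).
  by rewrite distCxx mulr0 ltW.
Qed.

Lemma CDcst_normC (c : R) : normC (CDcst c) = `|c|.
Proof.
apply/eqP; rewrite eq_le; apply/andP; split; first exact/normC_leP.
exact: (normC_ub (CDcst c) point).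
Qed.

(** A functional is treated as an operator into the constant functions and read off at one point. *)
Lemma functional_extension (u : nat -> R) (L : R) : 0 <= L ->
  (forall n k m r q, lincomb (x n) (ratr r) (x k) (ratr q) (x m) ->
     u n = ratr r * u k + ratr q * u m) ->
  (forall n, `|u n| <= L * normC (x n)) ->
  exists phi, [/\ in_dual (sbset X) phi, forall n, phi (x n) = u n &
     forall f, sbset X f -> `|phi f| <= L * normC f].
Proof.
move=> L0 ulin ubnd.
have [||A [Alin Abnd Ax _]] := @bounded_extension (fun n => CDcst (u n)) L L0.
- by move=> n k m r q H t /=; exact: ulin.
- by move=> n; rewrite CDcst_normC.
have HB f : sbset X f -> `|cfun (A f) point| <= L * normC f.
  by move=> Xf; exact: le_trans (normC_ub _ _) (Abnd f Xf).
exists (fun f => cfun (A f) point); split => //.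
- split; last by exists L.
  by move=> f g h a b Xf Xg Xh H; exact: Alin.
- by move=> n; rewrite Ax.
Qed.

End Extension.

(** * Functionals and dual norms *)

Section Duality.
Context (R : realType) (X : SB R).
Implicit Types (phi psi : CD R -> R).

Lemma in_dual_lin phi psi a b : in_dual (sbset X) phi -> in_dual (sbset X) psi ->
  in_dual (sbset X) (fun f => a * phi f + b * psi f).
Proof.
move=> [l1 [M1 b1]] [l2 [M2 b2]]; split.
  by move=> f g h c e Xf Xg Xh H; rewrite (l1 _ _ _ _ _ Xf Xg Xh H) (l2 _ _ _ _ _ Xf Xg Xh H); ring.
exists (`|a| * M1 + `|b| * M2) => f Xf.
rewrite (le_trans (ler_normD _ _))// !normrM mulrDl -!mulrA lerD// ler_wpM2l//; [exact: b1|exact: b2].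
Qed.

Lemma in_dualB phi psi : in_dual (sbset X) phi -> in_dual (sbset X) psi ->
  in_dual (sbset X) (fun f => phi f - psi f).
Proof.
move=> Hp Hs; have := in_dual_lin 1 (-1) Hp Hs.
by congr in_dual; apply/funext => f; rewrite mul1r mulN1r.
Qed.

Lemma sb_CDlin a f b g : sbset X f -> sbset X g -> sbset X (CDlin a f b g).
Proof. by move=> Xf Xg; apply: (sb_lin Xf Xg); exact: CDlinE. Qed.

Lemma in_dual0 phi f : in_dual (sbset X) phi -> sbset X f -> normC f = 0 -> phi f = 0.
Proof.
move=> [_ [M b]] Xf f0; have := b f Xf; rewrite f0 mulr0 normr_le0 => /eqP//.
Qed.

Lemma in_dualZ phi f a : in_dual (sbset X) phi -> sbset X f ->
  phi (CDlin a f 0 f) = a * phi f.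
Proof.
move=> [l _] Xf; rewrite (l f f (CDlin a f 0 f) a 0)//; last exact: sb_CDlin.
by rewrite mul0r addr0.
Qed.

Lemma in_dual_sub phi f g : in_dual (sbset X) phi -> sbset X f -> sbset X g ->
  phi (CDlin 1 f (-1) g) = phi f - phi g.
Proof.
move=> [l _] Xf Xg; rewrite (l f g (CDlin 1 f (-1) g) 1 (-1))//; last exact: sb_CDlin.
by rewrite mul1r mulN1r.
Qed.

Lemma dnorm_set_nonempty phi :
  [set `|phi f| | f in [set f | sbset X f /\ normC f <= 1]] !=set0.
Proof.
exists `|phi (CDcst 0)|, (CDcst 0) => //; split; first exact: sb_zero.
by apply/normC_leP => t; rewrite normr0.
Qed.

Lemma dnorm_leP phi c : in_dual (sbset X) phi -> 0 <= c ->
  dnorm (sbset X) phi <= c <-> forall f, sbset X f -> `|phi f| <= c * normC f.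
Proof.
move=> Hp c0; have [_ [M bM]] := Hp; split=> [H f Xf|H]; last first.
  apply: ge_sup; first exact: dnorm_set_nonempty.
  move=> _ [f [Xf f1] <-]; apply: (le_trans (H f Xf)).
  by rewrite -[leRHS]mulr1 ler_wpM2l.
have [f0|f0] := eqVneq (normC f) 0.
  by rewrite (in_dual0 Hp Xf f0) f0 normr0 mulr0.
have {}f0 : 0 < normC f by rewrite lt_def f0 normC_ge0.
have : `|phi (CDlin (normC f)^-1 f 0 f)| <= c.
  apply: le_trans H; apply: ub_le_sup.
    exists `|M| => _ [g [Xg g1] <-]; apply: (le_trans (bM g Xg)).
    rewrite (le_trans (ler_norm _))// normrM -[leRHS]mulr1 ler_wpM2l//.
    by rewrite ger0_norm// normC_ge0.
  exists (CDlin (normC f)^-1 f 0 f) => //; split; first exact: sb_CDlin.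
  by rewrite normC_scale gtr0_norm ?invr_gt0// mulVf// gt_eqF.
by rewrite in_dualZ// normrM gtr0_norm ?invr_gt0// mulrC ler_pdivrMr.
Qed.

Lemma dnorm_ub phi f : in_dual (sbset X) phi -> sbset X f ->
  `|phi f| <= dnorm (sbset X) phi * normC f.
Proof.
move=> Hp; move: f; apply/dnorm_leP => //.
have [z [y Hy _]] := dnorm_set_nonempty phi.
have [_ [M bM]] := Hp.
apply: (le_trans (y := `|phi y|)) => //; apply: ub_le_sup; last by exists y.
exists `|M| => _ [g [Xg g1] <-]; apply: (le_trans (bM g Xg)).
rewrite (le_trans (ler_norm _))// normrM -[leRHS]mulr1 ler_wpM2l//.
by rewrite ger0_norm// normC_ge0.
Qed.

Lemma dnorm_nneg phi : in_dual (sbset X) phi -> 0 <= dnorm (sbset X) phi.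
Proof.
move=> [_ [M bM]]; have [z [y Hy _]] := dnorm_set_nonempty phi.
apply: (le_trans (y := `|phi y|)) => //; apply: ub_le_sup; last by exists y.
exists `|M| => _ [g [Xg g1] <-]; apply: (le_trans (bM g Xg)).
rewrite (le_trans (ler_norm _))// normrM -[leRHS]mulr1 ler_wpM2l//.
by rewrite ger0_norm// normC_ge0.
Qed.

(** [f / mu f] always lies in the unit ball and equals [f] there. Unlike division by the norm, this
    is defined and continuous at 0. *)
Definition mu (f : CD R) : R := Num.max 1 (normC f).

Lemma mu_ge1 f : 1 <= mu f. Proof. by rewrite le_max lexx. Qed.
Lemma mu_gt0 f : 0 < mu f. Proof. exact: lt_le_trans ltr01 (mu_ge1 f). Qed.
Lemma mu_ge f : normC f <= mu f. Proof. by rewrite le_max lexx orbT. Qed.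

Lemma mu_lip f g : `|mu f - mu g| <= distC f g.
Proof.
have := normC_dist f g; have := distC_ge0 f g; rewrite /mu !ler_norml => ? /andP[? ?].
by have [?|?] := leP 1 (normC f); have [?|?] := leP 1 (normC g); apply/andP; split; lra.
Qed.

(** Turns a sup bound on normalized values into a bound on the dual norm: it passes to all of [X] by
    density, and [mu] is 1 on the unit ball. *)
Lemma dual_bound_mu (x : nat -> CD R) phi (e : R) : 0 <= e ->
  (forall n, sbset X (x n)) ->
  (forall f, sbset X f -> forall e : R, 0 < e -> exists n, distC (x n) f < e) ->
  in_dual (sbset X) phi ->
  (forall k, `|phi (x k)| <= e * mu (x k)) -> forall f, sbset X f -> `|phi f| <= e * normC f.
Proof.
move=> e0 Xx xd Hp H.
have H1 f : sbset X f -> `|phi f| <= e * mu f.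
  move=> Xf; rewrite -subr_le0; apply: (@le0_scaled _ (e + dnorm (sbset X) phi)) => d d0 _.
  have [n Hn] := xd f Xf d d0.
  have := dnorm_ub Hp (sb_CDlin 1 (-1) (Xx n) Xf); rewrite in_dual_sub// -distC_normC.
  have := H n; have := mu_lip (x n) f; have := dnorm_nneg Hp.
  have := ler_normB (phi (x n)) (phi (x n) - phi f); rewrite opprB addrC subrK.
  move=> h1 h2; rewrite ler_norml => /andP[h3 h4] h5 h6.
  have : dnorm (sbset X) phi * distC (x n) f <= dnorm (sbset X) phi * d.
    by apply: ler_wpM2l => //; lra.
  have : e * mu (x n) <= e * (mu f + d) by apply: ler_wpM2l => //; lra.
  lra.
apply/dnorm_leP => //; apply: ge_sup; first exact: dnorm_set_nonempty.
move=> _ [f [Xf f1] <-]; have := H1 f Xf.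
by rewrite /mu (max_idPl f1) mulr1.
Qed.

End Duality.

HB.instance Definition _ (R : realType) := gen_eqMixin (CD R).
HB.instance Definition _ (R : realType) := gen_choiceMixin (CD R).
HB.instance Definition _ (R : realType) := isPointed.Build (CD R) (CDcst 0).

(** * Closures of sequences as members of [SB] *)

Section Subspaces.
Context (R : realType).
Implicit Types (u : nat -> CD R).

Definition in_closure u (f : CD R) : Prop := forall e : R, 0 < e -> exists n, distC (u n) f < e.

(** Real combinations usually leave a sequence, so they are only required to be approximable by its
    terms. *)
Lemma closure_subspace u :
  (forall (a b : R) l m e, 0 < e -> exists n, distC (u n) (CDlin a (u l) b (u m)) < e) ->
  exists X : SB R, forall f, sbset X f <-> in_closure u f.
Proof.
move=> Hu.
have lin f g h a b : in_closure u f -> in_closure u g -> lincomb h a f b g -> in_closure u h.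
  move=> cf cg /lincomb_eq-> e e0.
  pose d := e / (2 * (`|a| + `|b| + 1)).
  have M0 : 0 < `|a| + `|b| + 1 :> R by rewrite ltr_wpDl// addr_ge0.
  have d0 : 0 < d by rewrite divr_gt0// mulr_gt0.
  have [l Hl] := cf d d0; have [m Hm] := cg d d0.
  have [n Hn] := Hu a b l m d d0; exists n.
  apply: (le_lt_trans (distC_tri (CDlin a (u l) b (u m)) _ _)).
  have := distC_lin a b a b (u l) (u m) f g; rewrite !subrr normr0 !mul0r !add0r => H.
  have h1 : `|a| * distC (u l) f <= `|a| * d by rewrite ler_wpM2l// ltW.
  have h2 : `|b| * distC (u m) g <= `|b| * d by rewrite ler_wpM2l// ltW.
  have : (`|a| + `|b| + 1) * d = e / 2 by rewrite /d; field; rewrite gt_eqF.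
  lra.
have zero z : (forall t, cfun z t = 0) -> in_closure u z.
  move=> z0 e e0; have [n Hn] := Hu 0 0 0%N 0%N e e0; exists n.
  by rewrite (_ : z = CDlin 0 (u 0%N) 0 (u 0%N))//; apply: CD_ext => t /=; rewrite z0 !mul0r addr0.
have closed f : (forall e : R, 0 < e -> exists2 g, in_closure u g & distC f g < e) -> in_closure u f.
  move=> H e e0; have e2 : 0 < e / 2 by rewrite divr_gt0.
  have [g cg fg] := H _ e2; have [n Hn] := cg _ e2; exists n.
  by apply: (le_lt_trans (distC_tri g _ _)); rewrite (distC_sym g); lra.
by exists (MkSB zero lin closed).
Qed.

Lemma SB_ext (X Y : SB R) : (forall f, sbset X f <-> sbset Y f) -> X = Y.
Proof.
case: X Y => [X x0 xl xc] [Y y0 yl yc] /= H.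
have E : X = Y by apply/funext => f; apply/propext.
move: x0 xl xc y0 yl yc; rewrite {}E {H} => x0 xl xc y0 yl yc.
by congr MkSB; exact: Prop_irrelevance.
Qed.

Lemma full_closed (f : CD R) :
  (forall e : R, 0 < e -> exists2 g, [set: CD R] g & distC f g < e) -> [set: CD R] f.
Proof. by []. Qed.

Definition full : SB R := @MkSB R setT (fun _ _ => I) (fun _ _ _ _ _ _ _ _ => I) full_closed.

End Subspaces.

HB.instance Definition _ (R : realType) := gen_eqMixin (SB R).
HB.instance Definition _ (R : realType) := gen_choiceMixin (SB R).
HB.instance Definition _ (R : realType) := isPointed.Build (SB R) (full R).

Section Closure.
Context (R : realType).
Implicit Types (u : nat -> CD R).

Definition clos u : SB R := xget (full R) [set X | forall f, sbset X f <-> in_closure u f].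

Lemma closP u (X : SB R) : (forall f, sbset X f <-> in_closure u f) -> clos u = X.
Proof.
move=> HX; rewrite /clos; case: xgetP => [Y _ HY|/(_ X)//].
by apply: SB_ext => f; rewrite HX HY.
Qed.

(** Turns a generator of the Effros structure into a countable union of conditions on the terms of a
    dense sequence. *)
Lemma clos_hits u (X : SB R) (U : set (CD R)) : (forall f, sbset X f <-> in_closure u f) ->
  Defs.openC U -> (sbset X `&` U !=set0) <-> exists n, U (u n).
Proof.
move=> HX oU; split=> [[f [/HX cf Uf]]|[n Un]].
  have [e e0 He] := oU f Uf; have [n Hn] := cf e e0.
  by exists n; apply: He; rewrite distC_sym.
by exists (u n); split => //; apply/HX => e e0; exists n; rewrite distCxx.
Qed.

End Closure.

(** * Coding by Baire space *)

Section Coding.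
Context (R : realType) (dn : nat -> CD R).
Hypothesis dn_dense : forall f (e : R), 0 < e -> exists n, distC (dn n) f < e.

Definition gap (i : nat) : R := (2 ^+ i)^-1.

Lemma gap_gt0 i : 0 < gap i. Proof. by rewrite invr_gt0 exprn_gt0. Qed.

Lemma gapS i : gap i = 2 * gap i.+1.
Proof. by rewrite /gap exprS; field; rewrite expf_neq0. Qed.

Lemma gap_le m n : (m <= n)%N -> gap n <= gap m.
Proof. by move=> mn; rewrite lef_pV2 ?posrE ?exprn_gt0// ler_eXn2l// ltr1n. Qed.

Lemma gap_lt (e : R) : 0 < e -> exists n, gap n < e.
Proof.
move=> /invS_lt[n ne]; exists n; apply: le_lt_trans ne.
rewrite lef_pV2 ?posrE ?exprn_gt0// -natrX ler_nat.
by rewrite ltn_expl.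
Qed.

(* The [i]-th term is replaced by the previous one when it would move the point
   by more than [gap i]: this makes every sequence of indices Cauchy. *)
Fixpoint ridx (z : nat -> nat) (i : nat) : nat :=
  if i is j.+1 then
    if distC (dn (ridx z j)) (dn (z i)) <= gap j then z i else ridx z j
  else z 0%N.

Lemma ridx_step z i : distC (dn (ridx z i)) (dn (ridx z i.+1)) <= gap i.
Proof. by rewrite /=; case: ifP => // _; rewrite distCxx ltW// gap_gt0. Qed.

Lemma ridx_cauchy z i m : (i <= m)%N ->
  distC (dn (ridx z i)) (dn (ridx z m)) <= 2 * gap i - 2 * gap m.
Proof.
elim: m => [|m IH]; first by rewrite leqn0 => /eqP->; rewrite distCxx subrr.
rewrite leq_eqVlt ltnS => /orP[/eqP->|/IH H]; first by rewrite distCxx subrr.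
have := distC_tri (dn (ridx z m)) (dn (ridx z i)) (dn (ridx z m.+1)).
have := ridx_step z m; have := gapS m; lra.
Qed.

Lemma ridx_ext z z' i : agree i.+1 z z' -> ridx z i = ridx z' i.
Proof.
elim: i => [|i IH] H /=; first exact: H.
by rewrite IH ?H//; apply: agree_le H.
Qed.

Lemma dec_exists z : exists f, forall n, distC (dn (ridx z n)) f <= 2 * gap n.
Proof.
apply: CD_complete => [e e0|n m nm].
  have [|n Hn] := @gap_lt (e / 2); first by rewrite divr_gt0.
  by exists n; lra.
by apply: (le_trans (ridx_cauchy z nm)); have := gap_gt0 m; lra.
Qed.

Definition dec z : CD R := sval (cid (dec_exists z)).

Lemma decP z n : distC (dn (ridx z n)) (dec z) <= 2 * gap n.
Proof. by rewrite /dec; case: cid. Qed.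

Lemma enc_exists f i : exists n, `[< distC (dn n) f < gap i / 4 >].
Proof.
have [|n Hn] := @dn_dense f (gap i / 4); first by rewrite divr_gt0// gap_gt0.
by exists n; apply/asboolP.
Qed.

(** Taking the least index makes [enc] measurable. The radius [gap i / 4] puts consecutive terms
    within [gap i], so the correction in [ridx] never acts and [dec] returns [f]. *)
Definition enc f i : nat := ex_minn (enc_exists f i).

Lemma encP f i : distC (dn (enc f i)) f < gap i / 4.
Proof. by rewrite /enc; case: ex_minnP => n /asboolP. Qed.

Lemma enc_eq f i n : enc f i = n <-> distC (dn n) f < gap i / 4 /\
  forall m, (m < n)%N -> ~ distC (dn m) f < gap i / 4.
Proof.
rewrite /enc; case: ex_minnP => k /asboolP Hk kmin; split=> [<-|[Hn nmin]].
  split=> // m mk /asboolP/kmin; by rewrite leqNgt mk.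
apply/eqP; rewrite eqn_leq kmin ?andTb; last exact/asboolP.
by rewrite leqNgt; apply/negP => /nmin.
Qed.

Lemma decK f : dec (enc f) = f.
Proof.
have E i : ridx (enc f) i = enc f i.
  elim: i => // i IH /=; rewrite IH ifT//.
  have := distC_tri f (dn (enc f i)) (dn (enc f i.+1)); rewrite (distC_sym f).
  have := encP f i; have := encP f i.+1; have := gapS i; have := gap_gt0 i.+1; lra.
apply: distC_eq0 => e e0; have [|n Hn] := @gap_lt (e / 3); first by rewrite divr_gt0.
have := distC_tri (dn (enc f n)) (dec (enc f)) f; rewrite (distC_sym (dec _) (dn _)).
have := encP f n; have := decP (enc f) n; rewrite E.
have := gap_gt0 n; lra.
Qed.

Definition decp (p : nat -> nat) (w : baire) : CD R := dec (fun i => w (p i)).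

Lemma agree_comp (p : nat -> nat) n : exists N, forall w w' : nat -> nat, agree N w w' ->
  agree n (fun i => w (p i)) (fun i => w' (p i)).
Proof.
have [N HN] := bounded_range p n; exists N => w w' ww' i ni.
by apply: ww'; exact: HN.
Qed.

(** [ridx z n] sees only [n + 1] entries of [z] and determines [dec z] up to [2 * gap n], whence a
    modulus uniform in [w]. *)
Lemma decp_cont p (e : R) : 0 < e -> exists n, forall w w' : baire, agree n w w' ->
  distC (decp p w) (decp p w') < e.
Proof.
move=> e0; have [|n Hn] := @gap_lt (e / 4); first by rewrite divr_gt0.
have [N HN] := agree_comp p n.+1; exists N => w w' /HN/ridx_ext E.
have := decP (fun i => w (p i)) n; have := decP (fun i => w' (p i)) n; rewrite -E.
have := distC_tri (dn (ridx (fun i => w (p i)) n)) (decp p w) (decp p w').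
by rewrite (distC_sym (decp p w) (dn _)) /decp; lra.
Qed.

Lemma baire_local_measurable (P : baire -> Prop) n :
  (forall w w', agree n w w' -> P w -> P w') -> measurable [set w | P w].
Proof.
move=> H; apply: baire_closed_measurable => w /(_ n)[w' ww'].
exact/H/agree_sym.
Qed.

Lemma decp_meas p : measC [set: baire] (decp p).
Proof.
apply: (measC_approx measurableT (I := nat) (S := fun n i (w : baire) => ridx (fun i => w (p i)) n = i)
  (Psi := fun i _ => dn i)) => //.
- move=> n i; have [N HN] := agree_comp p n.+1.
  apply: (@baire_local_measurable _ N) => w w' /HN/ridx_ext E [_ <-].
  by rewrite E.
- by move=> i; exact: measC_cst.
- by move=> w n _; eexists.
- move=> w _ e e0; have [|n Hn] := @gap_lt (e / 2); first by rewrite divr_gt0.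
  exists n => m i nm <-; apply: (le_lt_trans (decP _ m)).
  have := gap_le nm; lra.
Qed.

Lemma enc_meas d (T : measurableType d) (D : set T) (Phi : T -> CD R) i n :
  measurable D -> measC D Phi -> measurable [set w | D w /\ enc (Phi w) i = n].
Proof.
move=> mD mPhi.
have mlt m : measurable [set w | D w /\ distC (dn m) (Phi w) < gap i / 4].
  by have := measC_dist mD (measC_cst mD (dn m)) mPhi; apply.
apply: (measP_ext (P := fun w => (D w /\ distC (dn n) (Phi w) < gap i / 4) /\
  forall m, (m < n)%N -> ~ (D w /\ distC (dn m) (Phi w) < gap i / 4))) => [w|].
  split=> [[[Dw Hn] H]|[Dw /enc_eq[Hn H]]].
    by split => //; apply/enc_eq; split => // m /H nm h; apply: nm.
  by split => // m /H nm [].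
apply: measP_and => //; apply: measP_all => m; apply: measP_imp; first exact: measP_const.
exact: measP_not.
Qed.

End Coding.

(** * Norm dense sequences of functionals, measurably in the space *)

Section DualSelection.
Context (R : realType) (d : nat -> SB R -> CD R).
Hypothesis hd : dseq_ok d.

Definition gen3 : set (set (T3 R)) :=
  [set S | (exists2 E, effros E & S = [set t : T3 R | E t.1.1])
            \/ (exists2 E, effros E & S = [set t : T3 R | E t.1.2])
            \/ (exists n, exists2 E, borelC E & S = [set t : T3 R | E (t.2 n)])].

Definition T3m := g_sigma_algebraType gen3.

(** [C(Delta)] is itself a member of [SB], so [d] supplies its dense sequence. *)
Let dn n := d n (full R).

Lemma d_in n X : sbset X (d n X). Proof. by have [_ []] := hd. Qed.

Lemma d_dense X f : sbset X f -> forall e : R, 0 < e -> exists n, distC (d n X) f < e.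
Proof. by have [_ [_ [H _]]] := hd; exact: H. Qed.

Lemma dn_dense f (e : R) : 0 < e -> exists n, distC (dn n) f < e.
Proof. exact: d_dense. Qed.

(** The index does not depend on [X]. Linearity on the dense sequence is thus one fixed countable
    list of equations for all spaces, hence a closed condition on codes. *)
Lemma d_lin_exists : exists iota : nat * nat * rat * rat -> nat, forall k m r q X,
  d (iota (k, m, r, q)) X = CDlin (ratr r) (d k X) (ratr q) (d m X).
Proof.
have /choice[i Hi] : forall c : nat * nat * rat * rat, exists n, forall X,
    lincomb (d n X) (ratr c.1.2) (d c.1.1.1 X) (ratr c.2) (d c.1.1.2 X).
  by move=> [[[k m] r] q]; have [_ [_ [_ H]]] := hd; exact: H.
by exists i => k m r q X; apply: lincomb_eq; exact: (Hi (k, m, r, q)).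
Qed.

Let iota := sval (cid d_lin_exists).

Lemma iotaE k m r q X : d (iota (k, m, r, q)) X = CDlin (ratr r) (d k X) (ratr q) (d m X).
Proof. by rewrite /iota; case: cid. Qed.

Lemma d_lin X k m (r q : rat) :
  exists n, lincomb (d n X) (ratr r) (d k X) (ratr q) (d m X).
Proof. by exists (iota (k, m, r, q)); rewrite iotaE. Qed.

Lemma d_closure X f : sbset X f <-> in_closure (d^~ X) f.
Proof.
split=> [/d_dense//|H]; apply: sb_closed => e e0; have [n Hn] := H e e0.
by exists (d n X); [exact: d_in|rewrite distC_sym].
Qed.

Definition rational_closed (u : nat -> CD R) : Prop := forall c : nat * nat * rat * rat,
  u (iota c) = CDlin (ratr c.1.2) (u c.1.1.1) (ratr c.2) (u c.1.1.2).

Lemma rational_closed_clos u : rational_closed u ->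
  forall f, sbset (clos u) f <-> in_closure u f.
Proof.
move=> Hu; have [|X HX] := @closure_subspace R u; last by rewrite (closP HX).
move=> a b l m e e0.
pose M := normC (u l) + normC (u m) + 1.
have M0 : 0 < M by rewrite ltr_wpDl// addr_ge0// normC_ge0.
have eM : 0 < e / M by rewrite divr_gt0.
have [r Hr] := rat_approx a eM; have [q Hq] := rat_approx b eM.
exists (iota (l, m, r, q)); rewrite Hu /= distC_sym.
apply: (le_lt_trans (distC_lin _ _ _ _ _ _ _ _)); rewrite !distCxx !mulr0 !addr0.
have h1 : `|a - ratr r| * normC (u l) <= (e / M) * normC (u l).
  by rewrite ler_wpM2r ?normC_ge0// ltW.
have h2 : `|b - ratr q| * normC (u m) <= (e / M) * normC (u m).
  by rewrite ler_wpM2r ?normC_ge0// ltW.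
have : (e / M) * M = e by rewrite divfK// gt_eqF.
rewrite {2}/M; lra.
Qed.

(* The components of [t = (X, Y, Ah)], the spaces being given by their dense sequences. *)
Definition comp3 (t : T3 R) (j k : nat) : CD R :=
  if j == 0%N then d k t.1.1 else if j == 1%N then d k t.1.2 else t.2 k.

Definition code (t : T3 R) : baire := fun m =>
  let c := odflt (0%N, 0%N, 0%N) (unpickle m) in enc dn_dense (comp3 t c.1.1 c.1.2) c.2.

Definition decode (j k : nat) : baire -> CD R := decp dn (fun i => pickle (j, k, i)).

Lemma decode_code j k t : decode j k (code t) = comp3 t j k.
Proof.
rewrite /decode /decp -[RHS](decK dn_dense); congr dec.
by apply/funext => i; rewrite /code pickleK.
Qed.

Definition decode3 (w : baire) : T3 R :=
  ((clos (decode 0 ^~ w), clos (decode 1 ^~ w)), decode 2 ^~ w).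

Lemma decode3_code t : decode3 (code t) = t.
Proof.
have E j : decode j ^~ (code t) = comp3 t j by apply/funext => k; rewrite decode_code.
rewrite /decode3 !E (closP (u := comp3 t 0) (d_closure t.1.1)).
by rewrite (closP (u := comp3 t 1) (d_closure t.1.2)); case: t {E} => [[]].
Qed.

(** The relations indexed by [iota] make the closures of the decoded sequences subspaces. These
    sequences need not be the ones [d] assigns to the closures; density in them is enough to pull a
    Borel set back along [decode3]. *)
Definition coherent (w : baire) : Prop :=
  rational_closed (decode 0 ^~ w) /\ rational_closed (decode 1 ^~ w).

Lemma coherent_code t : coherent (code t).
Proof. by split=> -[[[k m] r] q]; rewrite !decode_code; exact: iotaE. Qed.

Lemma coherent_measurable : measurable [set w | coherent w].
Proof.
have H j : measurable [set w | rational_closed (decode j ^~ w)].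
  apply: measP_all => -[[[k m] r] q] /=.
  apply: (measP_ext (T := baire) (P := fun w => [set: baire] w /\ distC (decode j (iota (k, m, r, q)) w)
    (CDlin (ratr r) (decode j k w) (ratr q) (decode j m w)) <= 0)) => [w|].
    split=> [[_ h]|->]; last by rewrite distCxx.
    by apply: distC_eq0 => e /ltW; exact: le_trans.
  apply: meas_on_le; last exact: meas_on_cst.
  apply: measC_dist => //; first exact: decp_meas.
  by apply: measC_lin; exact: decp_meas.
by apply: measP_and.
Qed.

Lemma decode3_measurable (B : set T3m) : measurable B ->
  measurable [set w | coherent w /\ B (decode3 w)].
Proof.
move: B; apply: measurable_generated; first exact: coherent_measurable.
have H j (mj : forall w, coherent w -> rational_closed (decode j ^~ w)) (E : set (SB R)) :
    effros E -> measurable [set w | coherent w /\ E (clos (decode j ^~ w))].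
  apply: measurable_generated; first exact: coherent_measurable.
  move=> _ [U oU <-].
  apply: (measP_ext (T := baire) (P := fun w => exists n, coherent w /\ U (decode j n w))) => [w|].
    split=> [[n [cw Un]]|[cw /(clos_hits (rational_closed_clos (mj w cw)) oU)[n Un]]]; last by exists n.
    by split => //; apply/(clos_hits (rational_closed_clos (mj w cw)) oU); exists n.
  apply: measP_ex => n; apply: (measC_borel coherent_measurable dn_dense).
    by move=> t; apply: meas_on_sub (decp_meas _ _ t) => //; exact: coherent_measurable.
  exact: sub_sigma_algebra.
move=> A [[E mE ->]|[[E mE ->]|[n [E mE ->]]]] /=.
- by apply: H => // w [].
- by apply: H => // w [].
- apply: (measC_borel coherent_measurable dn_dense) => //.
  by move=> t; apply: meas_on_sub (decp_meas _ _ t) => //; exact: coherent_measurable.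
Qed.

Lemma d_measC (D : set T3m) (X : T3m -> SB R) k : measurable D ->
  (forall E, effros E -> measurable [set t | D t /\ E (X t)]) -> measC D (fun t => d k (X t)).
Proof.
move=> mD mX; apply: borel_measC => E mE.
by apply: (mX [set X | E (d k X)]); have [H _] := hd; exact: H.
Qed.

Lemma comp3_measC (D : set T3m) j k : measurable D -> measC D (fun t => comp3 t j k).
Proof.
move=> mD; rewrite /comp3; case: (j == 0%N); [|case: (j == 1%N)].
- by apply: d_measC => // E mE; apply: measurableI => //; apply: sub_sigma_algebra; left; exists E.
- by apply: d_measC => // E mE; apply: measurableI => //; apply: sub_sigma_algebra; right; left; exists E.
- apply: borel_measC => E mE; apply: measurableI => //.
  by apply: sub_sigma_algebra; right; right; exists k, E.
Qed.

Lemma code_measurable (D : set T3m) (A : set baire) : measurable D -> measurable A ->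
  measurable [set t | D t /\ A (code t)].
Proof.
move=> mD; move: A; apply: measurable_generated => // _ [i [n ->]] /=.
exact: (enc_meas _ _ _ mD (comp3_measC _ _ mD)).
Qed.

Variable j : nat.
Hypothesis j2 : (j < 2)%N.

(** Both duals are handled at once, [j] selecting the space. *)
Let Xc (t : T3 R) : SB R := if j == 0%N then t.1.1 else t.1.2.

Lemma comp3_Xc t k : comp3 t j k = d k (Xc t).
Proof. by rewrite /comp3 /Xc; case: j j2 => [|[|]]. Qed.

Lemma coherent_j w : coherent w -> rational_closed (decode j ^~ w).
Proof. by case: j j2 => [|[|//]] _ []. Qed.

Lemma Xc_decode3 w : Xc (decode3 w) = clos (decode j ^~ w).
Proof. by rewrite /Xc /decode3; case: j j2 => [|[|]]. Qed.

(* The dual ball of the space coded by [w], a functional [phi] being recorded by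
   the numbers [phi (x k) / mu (x k)]. *)
Definition dual_ball (w : baire) : set (nat -> R) := [set psi |
  (forall k, `|psi k * mu (decode j k w)| <= normC (decode j k w)) /\
  forall c : nat * nat * rat * rat,
    psi (iota c) * mu (decode j (iota c) w) =
    ratr c.1.2 * (psi c.1.1.1 * mu (decode j c.1.1.1 w)) +
    ratr c.2 * (psi c.1.1.2 * mu (decode j c.1.1.2 w))].

Lemma dual_ball_bounded w phi k : dual_ball w phi -> `|phi k| <= 1.
Proof.
move=> [H _]; have := le_trans (H k) (mu_ge _).
by rewrite normrM (gtr0_norm (mu_gt0 _)) -[leRHS]mul1r ler_pM2r ?mu_gt0.
Qed.

Lemma dual_ball0 w : dual_ball w (fun=> 0).
Proof.
split=> [k|c]; first by rewrite mul0r normr0 normC_ge0.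
by rewrite !mul0r !mulr0 addr0.
Qed.

Lemma dual_ball_approx w (phi : nat -> R) k (e : R) : 0 < e -> exists N, forall n w' psi,
  (N <= n)%N -> agree n w w' -> dual_ball w' psi -> pnear phi psi n ->
  `|phi k * mu (decode j k w) - psi k * mu (decode j k w')| <= e /\
  normC (decode j k w') <= normC (decode j k w) + e.
Proof.
(* With [m = mu (decode j k w)], an error [e / M] in [psi k] costs [(e / M) * m], and one in the
   vector costs [e / M] since [|psi k| <= 1]; these add up to [e]. *)
move=> e0; pose M := mu (decode j k w) + 1.
have M0 : 0 < M by have := mu_gt0 (decode j k w); rewrite /M; lra.
have eM : 0 < e / M by rewrite divr_gt0.
have eMe : e / M <= e.
  by rewrite ler_pdivrMr// ler_peMr ?ltW//; have := mu_gt0 (decode j k w); rewrite /M; lra.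
have [N1 HN1] := @decp_cont R dn (fun i => pickle (j, k, i)) _ eM.
have [N2 HN2] := invS_lt eM.
exists (maxn k.+1 (maxn N1 N2)) => n w' psi; rewrite !geq_max => /and3P[kn N1n N2n] ww' Kpsi near.
have {}HN1 : distC (decode j k w) (decode j k w') < e / M by apply: HN1; exact: agree_le ww'.
have := mu_lip (decode j k w) (decode j k w'); have := normC_dist (decode j k w) (decode j k w').
have := near k kn; have := @invS_le R _ _ N2n; have := dual_ball_bounded k Kpsi.
set m' := mu (decode j k w'); set m := mu (decode j k w).
move=> h1 h2 h3 h4 h5; split; last by move: h4; rewrite ler_norml => /andP[? ?]; lra.
have -> : phi k * m - psi k * m' = - ((psi k - phi k) * m) + psi k * (m - m') by ring.
apply: (le_trans (ler_normD _ _)); rewrite normrN !normrM.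
have p1 : `|psi k - phi k| * `|m| <= e / M * m.
  rewrite (gtr0_norm (mu_gt0 _)) ler_pM2r ?mu_gt0//; exact: ltW (lt_le_trans h3 (le_trans h2 (ltW HN2))).
have p2 : `|psi k| * `|m - m'| <= 1 * (e / M).
  by apply: ler_pM => //; lra.
have : (e / M) * M = e by rewrite divfK// gt_eqF.
rewrite {2}/M -/m; lra.
Qed.

(** Each condition compares finitely many quantities continuous in [(w, phi)]. It is phrased with
    [iota] and not with functionals, so the graph is closed at incoherent points too. *)
Lemma dual_ball_closed w phi : (forall n, exists w', exists psi,
  [/\ agree n w w', dual_ball w' psi & pnear phi psi n]) -> dual_ball w phi.
Proof.
move=> H; split=> [k|[[[k m] r] q] /=].
  apply/ler_addgt0Pr => e e0; have e2 : 0 < e / 2 by rewrite divr_gt0.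
  have [N HN] := dual_ball_approx w phi k e2.
  have [w' [psi [ww' Kpsi near]]] := H N.
  have [h1 h2] := HN N w' psi (leqnn N) ww' Kpsi near; have [/(_ k) h3 _] := Kpsi.
  move: h1 h2 h3; move: (psi k * _) (phi k * _) (normC _) (normC _) => a b c f.
  by rewrite !ler_norml => /andP[? ?] ? /andP[? ?]; apply/andP; split; lra.
apply/eqP; rewrite -subr_eq0 -normr_le0.
apply: (@le0_scaled _ (1 + `|ratr r| + `|ratr q|)) => e e0 _.
set i := iota _.
have [N1 HN1] := dual_ball_approx w phi i e0.
have [N2 HN2] := dual_ball_approx w phi k e0.
have [N3 HN3] := dual_ball_approx w phi m e0.
pose N := maxn N1 (maxn N2 N3).
have [w' [psi [ww' Kpsi near]]] := H N.
have [h1 _] := HN1 N w' psi (leq_maxl _ _) ww' Kpsi near.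
have [h2 _] := HN2 N w' psi (leq_trans (leq_maxl _ _) (leq_maxr _ _)) ww' Kpsi near.
have [h3 _] := HN3 N w' psi (leq_trans (leq_maxr _ _) (leq_maxr _ _)) ww' Kpsi near.
have [_ /(_ (k, m, r, q)) /= h4] := Kpsi.
move: h1 h2 h3 h4; rewrite -/i.
move: (psi i * _) (phi i * _) (psi k * _) (phi k * _) (psi m * _) (phi m * _) => a a' b b' c c'.
move=> h1 h2 h3 h4.
have -> : a' - (ratr r * b' + ratr q * c') =
  (a' - a) - ratr r * (b' - b) - ratr q * (c' - c) by rewrite h4; ring.
rewrite (le_trans (ler_normB _ _))// (mulrDr e) (mulrDr e) mulr1 lerD//.
  by rewrite (le_trans (ler_normB _ _))// lerD// normrM [e * _]mulrC ler_wpM2l//.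
by rewrite normrM [e * _]mulrC ler_wpM2l.
Qed.

Lemma dual_ball_extension (X : SB R) (x : nat -> CD R) (w : baire) (psi : nat -> R) :
  (forall f, sbset X f <-> in_closure x f) -> rational_closed x ->
  (forall k, decode j k w = x k) -> dual_ball w psi ->
  exists phi, [/\ in_dual (sbset X) phi, forall k, phi (x k) = psi k * mu (x k) &
     forall f, sbset X f -> `|phi f| <= 1 * normC f].
Proof.
move=> HX xr xw [Kb Kl].
have Xx n : sbset X (x n) by apply/HX => e e0; exists n; rewrite distCxx.
have ul k m r q : psi (iota (k, m, r, q)) * mu (x (iota (k, m, r, q))) =
    ratr r * (psi k * mu (x k)) + ratr q * (psi m * mu (x m)).
  by have := Kl (k, m, r, q); rewrite /= !xw.
have ub k : `|psi k * mu (x k)| <= normC (x k) by have := Kb k; rewrite xw.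
apply: (@functional_extension R X x Xx _ _ (fun k => psi k * mu (x k)) 1) => //.
- by move=> f /HX.
- by move=> k m r q; exists (iota (k, m, r, q)); rewrite (xr (k, m, r, q)).
- move=> n k m r q /lincomb_eq E; rewrite -ul.
  have xE : x n = x (iota (k, m, r, q)) by rewrite E (xr (k, m, r, q)).
  (* [x n] may equal the combination at an index [n] other than [n']. The bound at the index of
     [x n - x n' = 0] forces both indices to carry the same value. *)
  set n' := iota (k, m, r, q) in xE *.
  have := ub (iota (n, n', 1, -1)); rewrite ul (xr (n, n', 1, -1)) /= rmorph1 rmorphN1.
  rewrite -distC_normC -xE distCxx normr_le0 mul1r mulN1r subr_eq0 => /eqP.
  by rewrite xE.
- by move=> n; rewrite mul1r.
Qed.

Theorem measurable_dual_selection (B : set T3m) : measurable B ->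
  (forall t, B t -> SD (Xc t)) ->
  exists v : nat -> T3m -> nat -> R,
  [/\ forall l k, meas_on B (fun t => v l t k),
      forall t l, exists2 phi, in_dual (sbset (Xc t)) phi & forall k, phi (d k (Xc t)) = v l t k &
      forall t, B t -> forall phi, in_dual (sbset (Xc t)) phi -> forall e : R, 0 < e ->
        exists l, forall k, `|phi (d k (Xc t)) - v l t k| <= e * mu (d k (Xc t))].
Proof.
move=> mB BSD.
have [||||w [cw Bw]|s [ms Ks] sdense] := @measurable_dense_selectors R dual_ball
  [set w | coherent w /\ B (decode3 w)].
- exact: dual_ball_closed.
- by move=> w phi k; exact: dual_ball_bounded.
- exact: dual_ball0.
- exact: decode3_measurable.
- pose x := decode j ^~ w; have xr : rational_closed x := coherent_j cw.
  have HX := rational_closed_clos xr.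
  have Xx n : sbset (clos x) (x n) by apply/HX => e e0; exists n; rewrite distCxx.
  have [s [sd sdense]] : SD (clos x) by have := BSD _ Bw; rewrite Xc_decode3.
  exists (fun n k => s n (x k) / mu (x k)) => psi Kpsi e e0.
  have [//|phi [dphi phix _]] := dual_ball_extension HX xr _ Kpsi.
  have [n Hn] := sdense phi dphi e e0; exists n => k.
  have := dnorm_ub (in_dualB dphi (sd n)) (Xx k); rewrite phix => h.
  have -> : psi k - s n (x k) / mu (x k) = (psi k * mu (x k) - s n (x k)) / mu (x k).
    by field; rewrite gt_eqF// mu_gt0.
  rewrite normrM normfV (gtr0_norm (mu_gt0 _)) ler_pdivrMr ?mu_gt0//.
  apply: (le_trans h); apply: ler_pM.
  + exact: dnorm_nneg (in_dualB dphi (sd n)).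
  + exact: normC_ge0.
  + exact: ltW.
  + exact: mu_ge.
(* Selectors only reach the unit ball; integer multiples reach the whole dual, and the factor [mu]
   undoes the normalization. *)
pose v l (t : T3m) k : R := let il := odflt (0%N, 0%N) (unpickle l) in
  il.1%:R * (s il.2 (code t) k * mu (d k (Xc t))).
exists v; split.
- move=> l k; rewrite /v /=; move: (odflt _ _) => [i m] /=; apply: meas_onZ; apply: meas_onM.
    move=> c; apply: (measP_ext (T := T3m) (P := fun t => B t /\
      ([set w | [set: baire] w /\ s m w k < c] (code t)))) => [t|].
      by rewrite /=; have : [set: baire] (code t) by []; tauto.
    exact: (code_measurable mB (ms m k c)).
  apply: meas_on_max; first exact: meas_on_cst.
  apply: (measC_norm mB) => tau; apply: meas_on_ext (comp3_measC j k mB tau) => t _.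
  by rewrite comp3_Xc.
- move=> t l; rewrite /v /=; move: (odflt _ _) => [i m] /=.
  have [||k||phi [dphi phix _]] := @dual_ball_extension (Xc t) (d^~ (Xc t)) (code t) (s m (code t)).
  + exact: d_closure.
  + by move=> [[[k m'] r] q]; exact: iotaE.
  + by rewrite decode_code comp3_Xc.
  + exact: Ks.
  exists (fun f => i%:R * phi f + 0 * phi f); first exact: in_dual_lin.
  by move=> k; rewrite phix mul0r addr0.
move=> t Bt phi dphi e e0.
(* [phi / i] lies in the unit ball; approximating it within [e / i] gives [phi] within [e]. *)
pose i := (Num.truncn (dnorm (sbset (Xc t)) phi)).+1.
have i0 : 0 < i%:R :> R by rewrite ltr0n.
have phii : dnorm (sbset (Xc t)) phi <= i%:R by rewrite ltW// truncnS_gt.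
pose psi k := phi (d k (Xc t)) / i%:R / mu (d k (Xc t)).
have psimu k : psi k * mu (d k (Xc t)) = phi (d k (Xc t)) / i%:R.
  by rewrite /psi divfK// gt_eqF// mu_gt0.
have Kpsi : dual_ball (code t) psi.
  split=> [k|[[[k m] r] q]] /=; rewrite !decode_code !comp3_Xc !psimu.
    rewrite normrM normfV (gtr0_norm i0) ler_pdivrMr//.
    apply: (le_trans (dnorm_ub dphi (d_in k (Xc t)))).
    by rewrite mulrC ler_wpM2l// normC_ge0.
  have [lphi _] := dphi.
  rewrite (lphi (d k (Xc t)) (d m (Xc t)) _ (ratr r) (ratr q)) ?iotaE//; try exact: d_in.
    by rewrite mulrDl !mulrA.
  by apply: sb_CDlin; exact: d_in.
have [||m Hm] := sdense (code t) _ psi Kpsi (e / i%:R).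
- by rewrite /= decode3_code; split => //; exact: coherent_code.
- by rewrite divr_gt0.
exists (pickle (i, m)) => k; rewrite /v pickleK /=.
have := Hm k; have -> : psi k - s m (code t) k =
   (phi (d k (Xc t)) - i%:R * (s m (code t) k * mu (d k (Xc t)))) / (i%:R * mu (d k (Xc t))).
  by rewrite /psi; field; rewrite !gt_eqF// mu_gt0.
rewrite normrM normfV (gtr0_norm (mulr_gt0 i0 (mu_gt0 _))) ler_pdivrMr ?mulr_gt0 ?mu_gt0//.
by rewrite (mulrA (e / _)) divfK// gt_eqF.
Qed.

End DualSelection.

(** * Measurable embedding of the dual in C(Delta) *)

Section DualEmbedding.
Context (R : realType) dd (T : measurableType dd) (D : set T) (X : T -> SB R)
  (x : nat -> T -> CD R) (v : nat -> T -> nat -> R).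
Hypotheses (mD : measurable D) (mx : forall k, measC D (x k)).
Hypothesis x_in : forall w k, sbset (X w) (x k w).
Hypothesis x_dense : forall w f, sbset (X w) f -> forall e : R, 0 < e ->
  exists k, distC (x k w) f < e.
Hypothesis mv : forall l k, meas_on D (fun w => v l w k).
Hypothesis v_dual : forall w l, exists2 phi, in_dual (sbset (X w)) phi &
  forall k, phi (x k w) = v l w k.
Hypothesis v_dense : forall w, D w -> forall phi, in_dual (sbset (X w)) phi ->
  forall e : R, 0 < e -> exists l, forall k, `|phi (x k w) - v l w k| <= e * mu (x k w).

Let Phi w l : CD R -> R := sval (cid2 (v_dual w l)).

Lemma Phi_dual w l : in_dual (sbset (X w)) (Phi w l).
Proof. by rewrite /Phi; case: cid2. Qed.

Lemma Phi_x w l k : Phi w l (x k w) = v l w k.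
Proof. by rewrite /Phi; case: cid2 => /= ?. Qed.

Definition evaluation w (f : CD R) : nat -> R := fun l => Phi w l f / mu f.

(** On this closure the functionals [Phi w l] become coordinate functions, and suprema over it are
    dual norms. Requiring [D w] keeps the hitting sets inside the domain where measurability is
    known. *)
Definition evaluations w : set (nat -> R) := [set phi | D w /\
  forall n, exists k, pnear phi (evaluation w (x k w)) n].

Lemma evaluation_bound w f l : sbset (X w) f ->
  `|evaluation w f l| <= dnorm (sbset (X w)) (Phi w l).
Proof.
move=> Xf; rewrite /evaluation normrM normfV (gtr0_norm (mu_gt0 _)) ler_pdivrMr ?mu_gt0//.
apply: (le_trans (dnorm_ub (Phi_dual w l) Xf)).
by rewrite ler_wpM2l ?mu_ge//; apply: dnorm_nneg; exact: Phi_dual.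
Qed.

Lemma evaluations_closed w : pclosed (evaluations w).
Proof.
move=> phi H; split; first by have [psi [Dw _] _] := H 0%N.
(* [N + 1 = 2 (n + 1)], so two errors [1 / (N + 1)] add up to [1 / (n + 1)]. *)
move=> n; pose N := (n.*2).+1.
have nN : (n <= N)%N by rewrite /N -addnn -addnS leq_addr.
have [psi [_ /(_ N)[k Hk]] near] := H N.
exists k => i ni; have iN := leq_trans ni nN.
have := Hk i iN; have := near i iN.
have -> : n.+1%:R^-1 = N.+1%:R^-1 + N.+1%:R^-1 :> R.
  have : n.+1%:R != 0 :> R by rewrite pnatr_eq0.
  by rewrite /N -doubleS -mul2n natrM; move: (n.+1%:R) => u u0; field.
move: (evaluation _ _ _) (psi i) (phi i) => a b c h1 h2.
by rewrite -(subrK b a) -addrA (le_lt_trans (ler_normD _ _))// ltrD.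
Qed.

Lemma evaluations_bounded w : pbounded (evaluations w).
Proof.
move=> l; exists (dnorm (sbset (X w)) (Phi w l) + 1) => phi [Dw /(_ l.+1)[k /(_ l (ltnSn l))]].
have := evaluation_bound l (x_in w k); move: (evaluation _ _ _) => a.
have : l.+2%:R^-1 <= 1 :> R by rewrite invf_le1// ler1n.
move: (l.+2%:R^-1) (dnorm _ _) (phi l) => i c p.
by rewrite !ler_norml !ltr_norml => ? /andP[? ?] /andP[? ?]; apply/andP; split; lra.
Qed.

Definition almost_sat n (phi : nat -> R) (c : cns) : Prop :=
  if c.2 then ratr c.1.2 <= phi c.1.1 + n.+1%:R^-1 else phi c.1.1 <= ratr c.1.2 + n.+1%:R^-1.

(** By compactness, the closure meets [U] as soon as evaluations at the dense sequence satisfy [U]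
    up to every slack; this form has countable quantifiers only. *)
Lemma evaluations_hits w U : hits (evaluations w) U <->
  D w /\ forall n, exists k, forall c, c \in U -> almost_sat n (evaluation w (x k w)) c.
Proof.
split=> [[phi [Dw near] sU]|[Dw /choice[k Hk]]].
  split => // n; have [N HN] : exists N, forall c, c \in U -> (c.1.1 < N)%N.
    elim: U {sU} => [|c U [N HN]]; first by exists 0%N.
    exists (maxn c.1.1.+1 N) => c'; rewrite inE => /orP[/eqP->|/HN H].
      by rewrite leq_max leqnn.
    by rewrite leq_max H orbT.
  have [k Hk] := near (maxn n N); exists k => c cU.
  have /Hk : (c.1.1 < maxn n N)%N by rewrite leq_max HN ?orbT.
  have /(lt_le_trans _)/[apply] := @invS_le R _ _ (leq_maxl n N).
  have := sU c cU; rewrite /sat /almost_sat ltr_norml.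
  by move: (n.+1%:R^-1) (ratr _) (phi _) => i q p; case: c.2 => ? /andP[? ?]; lra.
have [|phi Hphi] := @cluster_point _ (fun n => evaluation w (x (k n) w))
    (fun l => dnorm (sbset (X w)) (Phi w l)).
  by move=> n l; exact: evaluation_bound.
exists phi.
  by split => // n; have [m _ Hm] := Hphi n; exists (k m).
move=> c cU; rewrite /sat.
suff E (e : R) : 0 < e -> if c.2 then ratr c.1.2 <= phi c.1.1 + e else phi c.1.1 <= ratr c.1.2 + e.
  by case: c.2 E => E; apply/ler_addgt0Pr => e /E.
move=> e0; have [|n Hn] := @invS_lt R (e / 2); first by rewrite divr_gt0.
have [m + /(_ c.1.1)] := Hphi (maxn n c.1.1.+1).
rewrite geq_max leq_max ltnSn orbT => /andP[nm _] /(_ isT).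
have /(lt_le_trans _)/[apply] := @invS_le R _ _ (leq_maxl n c.1.1.+1).
have := Hk m c cU; rewrite /almost_sat ltr_norml; have := @invS_le R _ _ nm.
move: (evaluation _ _ _) (ratr _) (phi _) Hn => a r f; move: (n.+1%:R^-1) (m.+1%:R^-1) => p q.
by case: c.2 => ? ? ? /andP[? ?]; lra.
Qed.

Lemma evaluations_hits_measurable U : measurable [set w | hits (evaluations w) U].
Proof.
apply: (measP_ext (fun w => iff_sym (evaluations_hits w U))).
apply: (measP_ext (P := fun w => D w /\ forall n, exists k, forall c : cns,
   c \in U -> D w /\ almost_sat n (evaluation w (x k w)) c)) => [w|].
  split=> -[Dw H]; split => // n; have [k Hk] := H n; exists k => c cU; last by split => //; exact: Hk.
  by have [] := Hk c cU.
apply: measP_and => //; apply: measP_all => n; apply: measP_ex => k.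
apply: measP_all => c; apply: measP_imp; first exact: measP_const.
have me : meas_on D (fun w => evaluation w (x k w) c.1.1).
  have mmu : meas_on D (fun w => mu (x k w)).
    by apply: meas_on_max; [exact: meas_on_cst|exact: measC_norm].
  apply: (meas_on_ext (f := fun w => v c.1.1 w k * (mu (x k w))^-1)) => [w Dw|].
    by rewrite /evaluation Phi_x.
  apply: meas_onM => // a.
  apply: (measP_ext (P := fun w => (D w /\ 0 < a) /\ (D w /\ 1 < a * mu (x k w)))) => [w|].
    have m0 := mu_gt0 (x k w); split=> [[[Dw a0] [_ h]]|[Dw h]].
      by split => //; rewrite -[_^-1]mul1r ltr_pdivrMr.
    have a0 : 0 < a by apply: lt_trans h; rewrite invr_gt0.
    by split=> //; split=> //; rewrite -ltr_pdivrMr// mul1r.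
  apply: measP_and; first by apply: measP_and => //; exact: measP_const.
  apply: meas_on_lt; first exact: meas_on_cst.
  exact: meas_onZ.
rewrite /almost_sat; case: c.2.
  apply: meas_on_le; first exact: meas_on_cst.
  by apply: meas_onD => //; exact: meas_on_cst.
by apply: meas_on_le => //; exact: meas_on_cst.
Qed.

Let s := cparam evaluations.

Lemma s_in w b : D w -> evaluations w (s w b).
Proof.
move=> Dw; apply: cparam_in.
- exact: evaluations_closed.
- exact: evaluations_bounded.
exists (evaluation w (x 0%N w)); split => // n; exists 0%N => i _.
by rewrite subrr normr0 invr_gt0.
Qed.

Lemma s_cyl_cont w l : cyl_cont (fun b : cantor_space => s w b l).
Proof.
move=> b e e0; have [L0|L0] := pselect (evaluations w !=set0).
  have [n Hn] := cparam_cont evaluations_closed evaluations_bounded l b L0 e0.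
  by exists n.
have s0 b' : s w b' = fun=> 0.
  by rewrite /s /cparam; case: xgetP => // phi _ [Lphi _]; exfalso; apply: L0; exists phi.
by exists 0%N => b' _; rewrite !s0 subrr normr0.
Qed.

Definition gdual l w : CD R := mkCD (s_cyl_cont w l).

Lemma gdual_measC l : measC D (gdual l).
Proof.
move=> b; apply: meas_on_sub (cparam_meas evaluations_closed evaluations_bounded
  evaluations_hits_measurable b l) => //.
by move=> w Dw; exists (s w b); exact: s_in.
Qed.

(* Every point of Cantor space is a limit of evaluations at normalized points of [X w]. *)
Lemma gdual_bound w a b c l m n (C : R) : D w ->
  (forall k, `|a * v l w k + b * v m w k + c * v n w k| <= C * mu (x k w)) ->
  forall t, `|a * cfun (gdual l w) t + b * cfun (gdual m w) t + c * cfun (gdual n w) t| <= C.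
Proof.
move=> Dw H t; rewrite -subr_le0; apply: (@le0_scaled _ (`|a| + `|b| + `|c|)) => e e0 _.
have [N HN] := invS_lt e0; pose N' := maxn N (maxn l.+1 (maxn m.+1 n.+1)).
have [_ /(_ N')[k near]] := s_in t Dw.
have nr i : (i < N')%N -> `|evaluation w (x k w) i - s w t i| <= e.
  move=> /near h; apply: ltW; apply: (lt_trans h); apply: le_lt_trans HN.
  by apply: invS_le; exact: leq_maxl.
have lN : (l < N')%N by rewrite !leq_max ltnSn !orbT.
have mN : (m < N')%N by rewrite !leq_max ltnSn !orbT.
have nN : (n < N')%N by rewrite !leq_max ltnSn !orbT.
have := nr l lN; have := nr m mN; have := nr n nN.
have : `|a * evaluation w (x k w) l + b * evaluation w (x k w) m + c * evaluation w (x k w) n| <= C.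
  rewrite /evaluation !Phi_x !mulrA -!mulrDl normrM normfV (gtr0_norm (mu_gt0 _)).
  by rewrite ler_pdivrMr ?mu_gt0.
rewrite /gdual /=; move: (evaluation _ _ l) (evaluation _ _ m) (evaluation _ _ n) => u1 u2 u3.
move: (s w t l) (s w t m) (s w t n) => s1 s2 s3 h h3 h2 h1.
rewrite lerBlDr.
have -> : a * s1 + b * s2 + c * s3 = (a * u1 + b * u2 + c * u3) -
  (a * (u1 - s1) + b * (u2 - s2) + c * (u3 - s3)) by ring.
rewrite (le_trans (ler_normB _ _))// addrC lerD//.
rewrite !(mulrDr e) (le_trans (ler_normD _ _))// lerD//.
  rewrite (le_trans (ler_normD _ _))// lerD// normrM [e * _]mulrC ler_wpM2l//.
by rewrite normrM [e * _]mulrC ler_wpM2l.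
Qed.

Lemma gdual_dist w l m (C : R) : D w ->
  (forall k, `|v l w k - v m w k| <= C * mu (x k w)) -> distC (gdual l w) (gdual m w) <= C.
Proof.
move=> Dw H; apply/distC_leP => t.
have := @gdual_bound w 1 (-1) 0 l m m C Dw _ t; rewrite !mul0r !mul1r !mulN1r !addr0.
apply => k; rewrite mul0r addr0 mul1r mulN1r; exact: H.
Qed.

Lemma gdual_subspace w : D w -> exists Z : SB R, forall f, sbset Z f <-> in_closure (gdual^~ w) f.
Proof.
move=> Dw; apply: closure_subspace => a b l m e e0.
have e2 : 0 < e / 2 by rewrite divr_gt0.
have [n Hn] := v_dense Dw (in_dual_lin a b (Phi_dual w l) (Phi_dual w m)) e2.
exists n; apply: (@le_lt_trans _ _ (e / 2)); last lra.
rewrite distC_sym; apply/distC_leP => t /=.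
have := @gdual_bound w a b (-1) l m n (e / 2) Dw _ t; rewrite !mulN1r.
by apply => k; have := Hn k; rewrite !Phi_x mulN1r.
Qed.

Definition Zdual w : SB R := clos (gdual^~ w).

Lemma ZdualP w : D w -> forall f, sbset (Zdual w) f <-> in_closure (gdual^~ w) f.
Proof. by move=> /gdual_subspace[Z HZ]; rewrite /Zdual (closP HZ). Qed.

Lemma evaluation_in w f : D w -> sbset (X w) f -> evaluations w (evaluation w f).
Proof.
move=> Dw Xf; split => // n.
have [C C0 HC] : exists2 C : R, 0 < C & forall l, (l < n)%N -> dnorm (sbset (X w)) (Phi w l) <= C.
  elim: n => [|n [C C0 HC]]; first by exists 1.
  exists (Num.max C (dnorm (sbset (X w)) (Phi w n))); first by rewrite lt_max C0.
  by move=> l; rewrite ltnS leq_eqVlt le_max => /orP[/eqP->|/HC->//]; rewrite lexx orbT.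
(* Numerator and normalizing denominator each contribute at most [C] times the distance from [x k w]
   to [f], hence the 2. *)
have d0 : 0 < (n.+1%:R^-1) / (2 * C) :> R by rewrite divr_gt0 ?invr_gt0 ?mulr_gt0.
have [k Hk] := x_dense Xf d0; exists k => l ln.
have N0 := dnorm_nneg (Phi_dual w l); have NC := HC l ln.
have := dnorm_ub (Phi_dual w l) (sb_CDlin 1 (-1) (x_in w k) Xf).
rewrite (in_dual_sub (Phi_dual w l) (x_in w k) Xf) -distC_normC.
have := evaluation_bound l Xf; have := mu_lip f (x k w); have := mu_ge1 (x k w).
rewrite /evaluation distC_sym; have := mu_gt0 f.
set a := Phi w l (x k w); set b := Phi w l f; set m := mu (x k w); set m' := mu f.
set dl := distC _ _ in Hk *; set Nl := dnorm _ _ in N0 NC * => m'0 m1 h1 h2 h3.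
have m0 : 0 < m by apply: lt_le_trans m1.
have -> : a / m - b / m' = (a - b) / m + (b / m') * (m' - m) / m.
  by field; rewrite !gt_eqF.
have p1 : `|(a - b) / m| <= Nl * dl.
  rewrite normrM normfV (gtr0_norm m0) ler_pdivrMr// (le_trans h3)//.
  by rewrite ler_peMr// mulr_ge0// distC_ge0.
have p2 : `|b / m' * (m' - m) / m| <= Nl * dl.
  rewrite normrM normfV (gtr0_norm m0) ler_pdivrMr//.
  apply: (@le_trans _ _ (Nl * dl)); first by rewrite normrM ler_pM.
  by rewrite ler_peMr// mulr_ge0// distC_ge0.
apply: (le_lt_trans (ler_normD _ _)); apply: (le_lt_trans (lerD p1 p2)).
have : Nl * dl <= C * dl by rewrite ler_wpM2r// distC_ge0.
have : C * dl < C * (n.+1%:R^-1 / (2 * C)) by rewrite ltr_pM2l.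
have -> : C * (n.+1%:R^-1 / (2 * C)) = n.+1%:R^-1 / 2.
  have : n.+1%:R != 0 :> R by rewrite pnatr_eq0.
  by move: (n.+1%:R) => u u0; field; rewrite u0 gt_eqF.
move: (n.+1%:R^-1) => i; lra.
Qed.

(** [beta] is an arbitrary choice, not a measurable one. It exists at every [f] in [X w], not only
    along the dense sequence, because [evaluations w] is closed. *)
Lemma point_exists : exists beta : T -> CD R -> cantor_space, forall w f, D w ->
  sbset (X w) f -> s w (beta w f) = evaluation w f.
Proof.
have /choice[b Hb] : forall wf : T * CD R, exists b : cantor_space,
    D wf.1 -> sbset (X wf.1) wf.2 -> s wf.1 b = evaluation wf.1 wf.2.
  move=> [w f] /=; have [[Dw Xf]|nH] := pselect (D w /\ sbset (X w) f).
    have [b Hb] := cparam_onto evaluations_closed evaluations_bounded (evaluation_in Dw Xf).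
    by exists b.
  by exists point => Dw Xf; exfalso; apply: nH.
by exists (fun w f => b (w, f)) => w f Dw Xf; exact: (Hb (w, f)).
Qed.

Let beta := sval (cid point_exists).

(* The functional coded by [h] is evaluated at [f] as the value of [h] at a point of
   Cantor space representing the normalized evaluation at [f]. *)
Definition jdual w (h f : CD R) : R := mu f * cfun h (beta w f).

Lemma jdual_Phi w l f : D w -> sbset (X w) f -> jdual w (gdual l w) f = Phi w l f.
Proof.
move=> Dw Xf; rewrite /jdual /= /beta; case: cid => b /= Hb; rewrite Hb//.
by rewrite /evaluation mulrC divfK// gt_eqF// mu_gt0.
Qed.

Lemma jdual_lip w h h' f : `|jdual w h f - jdual w h' f| <= distC h h' * mu f.
Proof.
rewrite /jdual -mulrBr normrM (gtr0_norm (mu_gt0 _)) mulrC.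
by rewrite ler_wpM2r ?distC_ub// ltW// mu_gt0.
Qed.

Lemma jdual_linear w h : D w -> sbset (Zdual w) h -> linear_on (sbset (X w)) (jdual w h).
Proof.
move=> Dw /(ZdualP Dw) Zh f1 f2 f a b X1 X2 Xf fE.
apply/eqP; rewrite -subr_eq0 -normr_le0.
apply: (@le0_scaled _ (mu f + `|a| * mu f1 + `|b| * mu f2)) => e e0 _.
have [l Hl] := Zh e e0.
have H z : sbset (X w) z -> `|Phi w l z - jdual w h z| <= e * mu z.
  move=> Xz; rewrite -jdual_Phi//; apply: (le_trans (jdual_lip _ _ _ _)).
  by rewrite ler_wpM2r ?ltW// mu_gt0.
have := H f Xf; have := H f1 X1; have := H f2 X2.
have [Pl _] := Phi_dual w l; rewrite (Pl _ _ _ _ _ X1 X2 Xf fE).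
move: (Phi w l f1) (Phi w l f2) => p1 p2; move: (jdual _ _ _) (jdual _ _ _) (jdual _ _ _) => u u1 u2.
move=> h2 h1 h0.
have -> : u - (a * u1 + b * u2) = - ((a * p1 + b * p2) - u) + a * (p1 - u1) + b * (p2 - u2) by ring.
rewrite !(mulrDr e) (le_trans (ler_normD _ _))// lerD//.
  by rewrite (le_trans (ler_normD _ _))// lerD ?normrN// normrM mulrCA ler_wpM2l.
by rewrite normrM mulrCA ler_wpM2l.
Qed.

Lemma jdual_bound w h f : D w -> sbset (Zdual w) h -> sbset (X w) f ->
  `|jdual w h f| <= normC h * normC f.
Proof.
move=> Dw Zh Xf; have lin := jdual_linear Dw Zh.
have H g : normC g <= 1 -> `|jdual w h g| <= normC h.
  by move=> g1; rewrite /jdual /mu (max_idPl g1) mul1r normC_ub.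
have hom c : jdual w h (CDlin c f 0 f) = c * jdual w h f.
  by rewrite (lin f f (CDlin c f 0 f) c 0)// ?mul0r ?addr0//; exact: sb_CDlin.
have [f0|f0] := eqVneq (normC f) 0.
  have fE : f = CDlin 0 f 0 f.
    apply: CD_ext => t /=; rewrite mul0r addr0; apply/eqP; rewrite -normr_le0 -f0; exact: normC_ub.
  by rewrite {1}fE hom mul0r normr0 f0 mulr0.
have {}f0 : 0 < normC f by rewrite lt_def f0 normC_ge0.
have := H (CDlin (normC f)^-1 f 0 f); rewrite hom normC_scale normrM.
rewrite (gtr0_norm (_ : 0 < (normC f)^-1)) ?invr_gt0// mulVf ?gt_eqF// => /(_ (lexx _)).
by rewrite mulrC ler_pdivrMr.
Qed.

Lemma jdual_in_dual w h : D w -> sbset (Zdual w) h -> in_dual (sbset (X w)) (jdual w h).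
Proof.
move=> Dw Zh; split; first exact: jdual_linear.
by exists (normC h) => f Xf; exact: jdual_bound.
Qed.

Lemma jdual_iso w : D w -> iso_sub_dual (sbset (Zdual w)) (sbset (X w)) (jdual w).
Proof.
move=> Dw; split; first by move=> g; exact: jdual_in_dual.
split.
  by move=> g h k a b Zg Zh Zk kE f Xf; rewrite /jdual kE; ring.
split.
  move=> h Zh; have dh := jdual_in_dual Dw Zh.
  apply/eqP; rewrite eq_le; apply/andP; split.
    by apply/(dnorm_leP dh (normC_ge0 h)) => f Xf; exact: jdual_bound.
  (* [h] is replaced by a nearby [gdual l w], whose values [gdual_bound] controls by those of the
     functional at the [x k w]. Passing to [gdual l w] and back costs [e] each way. *)
  apply/normC_leP => t; rewrite -subr_le0; apply: (@le0_scaled _ 2) => e e0 _.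
  have [l Hl] := (ZdualP Dw h).1 Zh e e0.
  have ht := distC_ub (gdual l w) h t.
  have gt : `|cfun (gdual l w) t| <= dnorm (sbset (X w)) (jdual w h) + e.
    have := @gdual_bound w 1 0 0 l l l (dnorm (sbset (X w)) (jdual w h) + e) Dw _ t.
    rewrite !mul0r mul1r !addr0; apply => k; rewrite !mul0r mul1r !addr0.
    rewrite -Phi_x -jdual_Phi ?x_in// mulrDl.
    have := jdual_lip w (gdual l w) h (x k w); have := dnorm_ub dh (x_in w k).
    have : distC (gdual l w) h * mu (x k w) <= e * mu (x k w).
      by rewrite ler_wpM2r ?ltW// mu_gt0.
    have : dnorm (sbset (X w)) (jdual w h) * normC (x k w) <=
           dnorm (sbset (X w)) (jdual w h) * mu (x k w).
      by rewrite ler_wpM2l ?mu_ge// dnorm_nneg.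
    move: (jdual _ _ _) (jdual _ _ _) => u1 u2; rewrite !ler_norml.
    by move=> ? ? /andP[? ?] /andP[? ?]; apply/andP; split; lra.
  have gh : `|cfun (gdual l w) t - cfun h t| <= e by apply: le_trans ht _; exact: ltW.
  have := ler_normB (cfun (gdual l w) t) (cfun (gdual l w) t - cfun h t).
  by rewrite opprB addrC subrK; lra.
move=> psi dpsi.
have /choice[l Hl] : forall i : nat, exists l, forall k,
    `|psi (x k w) - v l w k| <= i.+1%:R^-1 * mu (x k w).
  by move=> i; apply: v_dense => //; rewrite invr_gt0.
have [||h Hh] := @CD_complete R (fun i => gdual (l i) w) (fun i => 2 * i.+1%:R^-1).
- move=> e e0; have [|n Hn] := @invS_lt R (e / 2); first by rewrite divr_gt0.
  by exists n; move: Hn; move: (n.+1%:R^-1) => i ?; lra.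
- move=> n m nm; apply: gdual_dist => // k.
  have := Hl n k; have := Hl m k.
  have : m.+1%:R^-1 * mu (x k w) <= n.+1%:R^-1 * mu (x k w).
    by rewrite ler_wpM2r ?invS_le// ltW// mu_gt0.
  rewrite -(mulrA 2); move: (n.+1%:R^-1 * _) (m.+1%:R^-1 * _) (psi _) (v (l n) _ _) (v (l m) _ _).
  move=> a b c p q.
  by rewrite !ler_norml => ? /andP[? ?] /andP[? ?]; apply/andP; split; lra.
have Zh : sbset (Zdual w) h.
  apply/(ZdualP Dw) => e e0; have [|n Hn] := @invS_lt R (e / 2); first by rewrite divr_gt0.
  by exists (l n); apply: (le_lt_trans (Hh n)); move: Hn; move: (n.+1%:R^-1) => i ?; lra.
exists h => // f Xf; have dh := jdual_in_dual Dw Zh.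
apply/eqP; rewrite -subr_eq0 -normr_le0.
rewrite -[leRHS](mul0r (normC f)).
apply: (dual_bound_mu (lexx _) (x_in w) (@x_dense w) (in_dualB dh dpsi)) => // k.
rewrite mul0r; apply: (@le0_scaled _ (3 * mu (x k w))) => e e0 _.
have [n Hn] := invS_lt e0.
have := jdual_lip w (gdual (l n) w) h (x k w); rewrite jdual_Phi ?x_in// Phi_x.
have := Hl n k.
have : n.+1%:R^-1 * mu (x k w) <= e * mu (x k w) by rewrite ler_wpM2r ?ltW// mu_gt0.
have : distC (gdual (l n) w) h * mu (x k w) <= 2 * n.+1%:R^-1 * mu (x k w).
  by rewrite ler_wpM2r// ltW// mu_gt0.
set i := n.+1%:R^-1; set r := distC _ _ * _; set m := mu _.
set a := jdual _ _ _; set b := psi _; set c := v _ _ _.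
by rewrite !ler_norml => ? ? /andP[? ?] /andP[? ?]; apply/andP; split; lra.
Qed.

(** The last clause gives access to [j] on the two dense sequences, where its values are measurable;
    other values follow by continuity. *)
Theorem measurable_dual_space :
  exists (g : nat -> T -> CD R) (Z : T -> SB R) (j : T -> CD R -> CD R -> R),
  [/\ forall l, measC D (g l),
      forall w, D w -> forall h, sbset (Z w) h <-> in_closure (g^~ w) h,
      forall w, D w -> iso_sub_dual (sbset (Z w)) (sbset (X w)) (j w) &
      forall w l k, D w -> j w (g l w) (x k w) = v l w k].
Proof.
exists gdual, Zdual, jdual; split.
- exact: gdual_measC.
- exact: ZdualP.
- exact: jdual_iso.
- by move=> w l k Dw; rewrite jdual_Phi ?x_in// Phi_x.
Qed.

End DualEmbedding.

(** * Operators and their adjoints *)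

Section Operators.
Context (R : realType) (d : nat -> SB R -> CD R).
Hypothesis hd : dseq_ok d.

Lemma coded_operator t : Lset d t -> exists A, codes d t.1.1 t.1.2 t.2 A.
Proof.
case: t => [[X Y] Ah] [AY [Alin [L L0 AL]]] /=.
have L0' : 0 <= ratr L :> R by rewrite ler0q ltW.
have Abnd n : normC (Ah n) <= ratr L * normC (d n X).
  (* A single coefficient equal to 1 turns the inequality on sums into a bound on each term. *)
  pose a i : rat := (i == n)%:R.
  have E (u : nat -> CD R) : (fun t => \sum_(i < n.+1) ratr (a i) * cfun (u i) t) = cfun (u n).
    apply/funext => t; rewrite big_ord_recr /= big1 ?add0r => [|i _].
      by rewrite /a eqxx rmorph1 mul1r.
    by rewrite /a (ltn_eqF (ltn_ord i)) rmorph0 mul0r.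
  by have := AL n.+1 a; rewrite (E Ah) (E (d^~ X)).
have [A [Al Ab Ad Alip]] := bounded_extension (d_in hd ^~ X) (@d_dense _ _ hd X) (d_lin hd X) L0'
  Alin Abnd.
exists A; split; last by split; [exact: Al|split; [exists (ratr L)|]].
move=> f Xf; apply: sb_closed => e e0.
have [|n Hn] := d_dense hd Xf (e := e / (ratr L + 1)); first by rewrite divr_gt0// ltr_wpDl.
exists (Ah n) => //; rewrite distC_sym; apply: (le_lt_trans (Alip f n Xf)).
rewrite ltr_pdivlMr ?ltr_wpDl// in Hn; have := distC_ge0 (d n X) f; lra.
Qed.

Lemma codes_lip X Y Ah A : codes d X Y Ah A -> exists2 L : R, 0 <= L &
  (forall f, sbset X f -> normC (A f) <= L * normC f) /\
  forall f g, sbset X f -> sbset X g -> distC (A f) (A g) <= L * distC f g.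
Proof.
move=> [AY [Al [[M AM] _]]]; exists `|M|; first exact: normr_ge0.
have H f : sbset X f -> normC (A f) <= `|M| * normC f.
  by move=> Xf; apply: (le_trans (AM f Xf)); rewrite ler_wpM2r ?normC_ge0// ler_norm.
split=> // f g Xf Xg; rewrite !distC_normC.
rewrite -(lincomb_eq (Al f g _ 1 (-1) Xf Xg _ (CDlinE 1 f (-1) g))); last exact: sb_CDlin.
by apply: H; exact: sb_CDlin.
Qed.

Lemma codes_unique X Y Ah A A' f : codes d X Y Ah A -> codes d X Y Ah A' -> sbset X f ->
  A f = A' f.
Proof.
move=> cA cA' Xf; apply: distC_eq0 => e e0; rewrite -subr_le0.
have [L L0 [_ HL]] := codes_lip cA; have [L' L0' [_ HL']] := codes_lip cA'.
suff : distC (A f) (A' f) <= 0 by lra.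
apply: (@le0_scaled _ (L + L')) => r r0 _.
have [n Hn] := d_dense hd Xf r0; have Xn := d_in hd n X.
have := HL _ _ Xf Xn; have := HL' _ _ Xn Xf.
have [_ [_ [_ ->]]] := cA; have [_ [_ [_ ->]]] := cA'.
have := distC_tri (Ah n) (A f) (A' f); rewrite (distC_sym f).
have : L * distC (d n X) f <= L * r by rewrite ler_wpM2l// ltW.
have : L' * distC (d n X) f <= L' * r by rewrite ler_wpM2l// ltW.
lra.
Qed.

End Operators.

Section DualRepresentations.
Context (R : realType) (Z X : SB R) (j : CD R -> CD R -> R).
Hypothesis iso : iso_sub_dual (sbset Z) (sbset X) j.

Lemma iso_bound g f : sbset Z g -> sbset X f -> `|j g f| <= normC g * normC f.
Proof.
by move: iso => [jd [_ [jn _]]] Zg Xf; rewrite -jn//; apply: dnorm_ub => //; exact: jd.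
Qed.

Lemma iso_subl g g' f : sbset Z g -> sbset Z g' -> sbset X f ->
  j (CDlin 1 g (-1) g') f = j g f - j g' f.
Proof.
move: iso => [_ [jl _]] Zg Zg' Xf.
rewrite (jl _ _ (CDlin 1 g (-1) g') 1 (-1) Zg Zg')//; last exact: sb_CDlin.
by rewrite mul1r mulN1r.
Qed.

Lemma iso_lip g g' f f' : sbset Z g -> sbset Z g' -> sbset X f -> sbset X f' ->
  `|j g f - j g' f'| <= normC g * distC f f' + distC g g' * normC f'.
Proof.
move=> Zg Zg' Xf Xf'; have [jd _] := iso.
have -> : j g f - j g' f' = (j g f - j g f') + (j g f' - j g' f') by ring.
rewrite -(iso_subl Zg Zg' Xf') -(in_dual_sub (jd g Zg) Xf Xf') !distC_normC.
by rewrite (le_trans (ler_normD _ _))// lerD// iso_bound//; exact: sb_CDlin.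
Qed.

Lemma iso_dist g g' (c : R) : 0 <= c -> sbset Z g -> sbset Z g' ->
  (forall f, sbset X f -> `|j g f - j g' f| <= c * normC f) -> distC g g' <= c.
Proof.
move=> c0 Zg Zg' H; have Zl := sb_CDlin 1 (-1) Zg Zg'.
have [jd [_ [jn _]]] := iso; rewrite distC_normC -jn//.
by apply/(dnorm_leP (jd _ Zl) c0) => f Xf; rewrite iso_subl//; exact: H.
Qed.

Lemma iso_inj g g' : sbset Z g -> sbset Z g' -> deq (sbset X) (j g) (j g') -> g = g'.
Proof.
move=> Zg Zg' E; apply: distC_eq0 => e e0; apply: (iso_dist (ltW e0)) => // f Xf.
by rewrite E// subrr normr0 mulr_ge0 ?normC_ge0 ?ltW.
Qed.

End DualRepresentations.

(** * The adjoint and the pairing for fixed spaces *)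

Section Adjoint.
Context (R : realType) (d : nat -> SB R -> CD R) (X Y ZX ZY : SB R) (jX jY : CD R -> CD R -> R)
  (Ah : nat -> CD R) (A : CD R -> CD R).
Hypotheses (isoX : iso_sub_dual (sbset ZX) (sbset X) jX)
  (isoY : iso_sub_dual (sbset ZY) (sbset Y) jY) (cA : codes d X Y Ah A).

Definition is_adjoint (Ab : CD R -> CD R) : Prop := forall g, sbset ZY g ->
  sbset ZX (Ab g) /\ deq (sbset X) (jX (Ab g)) (fun x => jY g (A x)).

Lemma adjoint_exists : exists Ab, is_adjoint Ab.
Proof.
have [AY [Al _]] := cA; have [L L0 [AL _]] := codes_lip cA.
have /choice[Ab HAb] : forall g, exists h, sbset ZY g ->
    sbset ZX h /\ deq (sbset X) (jX h) (fun x => jY g (A x)); last by exists Ab.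
move=> g; have [Zg|nZg] := pselect (sbset ZY g); last by exists g.
have [_ [_ [_ jsurj]]] := isoX; have [jd _] := isoY.
have [|h Zh hE] := jsurj (fun x => jY g (A x)); last by exists h.
have [jl _] := jd g Zg; split.
  move=> f f' h a b Xf Xf' Xh E; apply: jl; try exact: AY.
  exact: Al.
exists (normC g * L) => f Xf; apply: (le_trans (iso_bound isoY Zg (AY f Xf))).
by rewrite -mulrA ler_wpM2l ?normC_ge0// AL.
Qed.

Variable Ab : CD R -> CD R.
Hypothesis adjAb : is_adjoint Ab.

Lemma adjoint_linear g h k a b : sbset ZY g -> sbset ZY h -> sbset ZY k ->
  lincomb k a g b h -> lincomb (Ab k) a (Ab g) b (Ab h).
Proof.
move=> Zg Zh Zk E; have [ZAg Eg] := adjAb Zg; have [ZAh Eh] := adjAb Zh; have [ZAk Ek] := adjAb Zk.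
suff -> : Ab k = CDlin a (Ab g) b (Ab h) by [].
apply: (iso_inj isoX ZAk (sb_CDlin a b ZAg ZAh)) => f Xf.
have [AY _] := cA.
have [_ [jl _]] := isoX; have [_ [jl' _]] := isoY.
rewrite Ek// (jl' _ _ _ _ _ Zg Zh Zk E) ?(jl _ _ _ _ _ ZAg ZAh (sb_CDlin a b ZAg ZAh) (CDlinE _ _ _ _))//.
  by rewrite Eg// Eh.
exact: AY.
Qed.

Lemma adjoint_bounded : exists2 M : R, 0 <= M & forall g, sbset ZY g -> normC (Ab g) <= M * normC g.
Proof.
have [AY _] := cA; have [L L0 [AL _]] := codes_lip cA; exists L => // g Zg.
have [ZAg Eg] := adjAb Zg; have [jd [_ [jn _]]] := isoX; rewrite -jn//.
apply/(dnorm_leP (jd _ ZAg)) => [|f Xf]; first by rewrite mulr_ge0 ?normC_ge0.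
rewrite Eg//; apply: (le_trans (iso_bound isoY Zg (AY f Xf))).
by rewrite [L * _]mulrC -mulrA ler_wpM2l ?normC_ge0// AL.
Qed.

Hypothesis hd : dseq_ok d.

Lemma adjoint_codes : codes d ZY ZX (fun n => Ab (d n ZY)) Ab.
Proof.
have [M M0 HM] := adjoint_bounded.
split; first by move=> g /adjAb[].
split; last by split => //; exists M.
by move=> f g h a b Zf Zg Zh; exact: adjoint_linear.
Qed.

Lemma adjoint_Lset : Lset d ((ZY, ZX), fun n => Ab (d n ZY)).
Proof.
have [M M0 HM] := adjoint_bounded; have Zd n := d_in hd n ZY; split => /=.
  by move=> n; have [] := adjAb (Zd n).
split; first by move=> n k m r q; exact: adjoint_linear.
have [L /andP[ML _]] : exists L : rat, M < ratr L < M + 1.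
  by apply: rat_lt_between; rewrite ltrDl.
exists L; first by rewrite -(ltr0q R); exact: le_lt_trans ML.
move=> N a.
(* The sum is an element [s] of [ZY] and [Ab s] is the transformed sum, so the inequality is the
   norm bound of [Ab] at [s]. *)
have [s [Zs sE AsE]] : exists s, [/\ sbset ZY s,
    cfun s = (fun t => \sum_(i < N) ratr (a i) * cfun (d i ZY) t) &
    cfun (Ab s) = (fun t => \sum_(i < N) ratr (a i) * cfun (Ab (d i ZY)) t)].
  elim: N => [|N [s [Zs sE AsE]]].
    pose z := CDlin 0 (d 0%N ZY) 0 (d 0%N ZY).
    have Zz : sbset ZY z by exact: sb_CDlin.
    exists z; split => //; apply/funext => t; rewrite big_ord0 /=.
      by rewrite !mul0r addr0.
    by rewrite (adjoint_linear (Zd _) (Zd _) Zz (CDlinE _ _ _ _)) !mul0r addr0.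
  have Zs' := sb_CDlin 1 (ratr (a N)) Zs (Zd N).
  exists (CDlin 1 s (ratr (a N)) (d N ZY)); split => //; apply/funext => t; rewrite big_ord_recr /=.
    by rewrite mul1r sE.
  by rewrite (adjoint_linear Zs (Zd N) Zs' (CDlinE _ _ _ _)) mul1r AsE.
rewrite -sE -AsE; apply: (le_trans (HM s Zs)).
by rewrite ler_wpM2r ?normC_ge0// ltW.
Qed.

Lemma adjoint_isometric A' Ab' : codes d X Y Ah A' ->
  codes d ZY ZX (fun n => Ab (d n ZY)) Ab' -> isometric_to_adjoint X Y ZX ZY A' Ab'.
Proof.
move=> cA' cAb'; exists jY, jX; split=> //; split=> // g Zg f Xf.
rewrite -(codes_unique hd cA cA' Xf) -(codes_unique hd adjoint_codes cAb' Zg).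
by have [_ ->] := adjAb Zg.
Qed.

Lemma pairing_bilin_cont : bilin_cont (sbset ZY) (sbset X) (fun g x => jY g (A x)).
Proof.
have [AY [Al _]] := cA; have [jd [jl _]] := isoY; split; last split.
- move=> g Zg f f' h a b Xf Xf' Xh E; have [jlg _] := jd g Zg.
  by apply: jlg; [exact: AY|exact: AY|exact: AY|exact: Al].
- by move=> x Xx f g h a b Zf Zg Zh E; rewrite (jl _ _ _ _ _ Zf Zg Zh E)//; exact: AY.
move=> g x Zg Xx e e0; have [L L0 [AL Alip]] := codes_lip cA.
(* The two error terms add up to [(C - 1) * (e / C) < e]; the cap 1 on the radius gives
   [normC x' <= normC x + 1]. *)
pose C := L * (normC g + normC x + 1) + 1.
have C0 : 0 < C by rewrite ltr_wpDl// mulr_ge0// !addr_ge0 ?normC_ge0.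
exists (Num.min 1 (e / C)); first by rewrite lt_min ltr01 divr_gt0.
move=> g' x' Zg' Xx'; rewrite !lt_min => /andP[_ gg'] /andP[x1 xx'].
apply: (le_lt_trans (iso_lip isoY Zg Zg' (AY _ Xx) (AY _ Xx'))).
have p1 : normC g * distC (A x) (A x') <= normC g * (L * (e / C)).
  by rewrite ler_wpM2l ?normC_ge0// (le_trans (Alip _ _ Xx Xx'))// ler_wpM2l// ltW.
have nx' : normC x' <= normC x + 1.
  by have := normC_dist x x'; rewrite ler_norml => /andP[? ?]; lra.
have p2 : distC g g' * normC (A x') <= (e / C) * (L * (normC x + 1)).
  apply: ler_pM; [exact: distC_ge0|exact: normC_ge0|exact: ltW|].
  by apply: (le_trans (AL _ Xx')); rewrite ler_wpM2l.
apply: (le_lt_trans (lerD p1 p2)).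
have -> : normC g * (L * (e / C)) + e / C * (L * (normC x + 1)) = (C - 1) * (e / C).
  by rewrite /C; ring.
have : C * (e / C) = e by rewrite mulrC divfK// gt_eqF.
have : 0 < e / C by rewrite divr_gt0.
lra.
Qed.

Lemma pairing_isometric A' : codes d X Y Ah A' ->
  isometric_to_adjoint' X Y ZY A' (fun g x => jY g (A x)).
Proof.
(* The pairing already takes values in the dual of [X], so the second isometry is the identity. *)
move=> cA'; exists jY, id; split=> //; split; last first.
  by move=> g Zg f Xf; rewrite -(codes_unique hd cA cA' Xf).
split; first by [].
split; first by [].
split; first by [].
by split=> // psi dpsi; exists psi.
Qed.

End Adjoint.

(** * Measurability of the adjoint map and of the pairing *)

Section AdjointMap.
Context (R : realType) (d : nat -> SB R -> CD R).
Hypothesis hd : dseq_ok d.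
Variable B : set (T3m R).
Hypothesis mB : measurable B.
Variables (gX gY : nat -> T3m R -> CD R) (ZX ZY : T3m R -> SB R)
  (jX jY : T3m R -> CD R -> CD R -> R) (A Ab : T3m R -> CD R -> CD R).
Hypotheses (mgX : forall l, measC B (gX l)) (mgY : forall l, measC B (gY l)).
Hypotheses (HZX : forall t, B t -> forall h, sbset (ZX t) h <-> in_closure (gX^~ t) h)
  (HZY : forall t, B t -> forall h, sbset (ZY t) h <-> in_closure (gY^~ t) h).
Hypotheses (isoX : forall t, B t -> iso_sub_dual (sbset (ZX t)) (sbset t.1.1) (jX t))
  (isoY : forall t, B t -> iso_sub_dual (sbset (ZY t)) (sbset t.1.2) (jY t)).
Hypotheses (mjX : forall l k, meas_on B (fun t => jX t (gX l t) (d k t.1.1)))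
  (mjY : forall l k, meas_on B (fun t => jY t (gY l t) (d k t.1.2))).
Hypothesis cA : forall t, B t -> codes d t.1.1 t.1.2 t.2 (A t).
Hypothesis adjA : forall t, B t ->
  is_adjoint t.1.1 (ZX t) (ZY t) (jX t) (jY t) (A t) (Ab t).

Let dn_dense' := dn_dense hd.

Definition adjoint_map (t : T3 R) : T3 R := ((ZY t, ZX t), fun n => Ab t (d n (ZY t))).

Lemma gX_in t l : B t -> sbset (ZX t) (gX l t).
Proof. by move=> Bt; apply/(HZX Bt) => e e0; exists l; rewrite distCxx. Qed.

Lemma gY_in t l : B t -> sbset (ZY t) (gY l t).
Proof. by move=> Bt; apply/(HZY Bt) => e e0; exists l; rewrite distCxx. Qed.

Lemma Ah_in t n : B t -> sbset t.1.2 (t.2 n).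
Proof. by move=> /cA[AY [_ [_ <-]]]; apply: AY; exact: d_in. Qed.

Lemma closure_effros (g : nat -> T3m R -> CD R) (Z : T3m R -> SB R) :
  (forall l, measC B (g l)) -> (forall t, B t -> forall h, sbset (Z t) h <-> in_closure (g^~ t) h) ->
  forall E, effros E -> measurable [set t | B t /\ E (Z t)].
Proof.
move=> mg HZ; apply: measurable_generated => // _ [U oU <-].
apply: (measP_ext (T := T3m R) (P := fun t => exists l, B t /\ U (g l t))) => [t|].
  split=> [[l [Bt Ul]]|[Bt /(clos_hits (HZ t Bt) oU)[l Ul]]]; last by exists l.
  by split => //; apply/(clos_hits (HZ t Bt) oU); exists l.
apply: measP_ex => l; apply: (measC_borel mB dn_dense') => //.
exact: sub_sigma_algebra.
Qed.

Lemma d_X_measC k : measC B (fun t => d k t.1.1).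
Proof.
apply: (d_measC hd) => // E mE; apply: measurableI => //.
by apply: sub_sigma_algebra; left; exists E.
Qed.

Lemma d_Y_measC k : measC B (fun t => d k t.1.2).
Proof.
apply: (d_measC hd) => // E mE; apply: measurableI => //.
by apply: sub_sigma_algebra; right; left; exists E.
Qed.

Lemma Ah_measC n : measC B (fun t => t.2 n).
Proof.
apply: borel_measC => E mE; apply: measurableI => //.
by apply: sub_sigma_algebra; right; right; exists n, E.
Qed.

Lemma meas_dist_lt (c : R) (Phi Psi : T3m R -> CD R) : measC B Phi -> measC B Psi ->
  measurable [set t | B t /\ distC (Phi t) (Psi t) < c].
Proof. by move=> H1 H2; exact: (measC_dist mB H1 H2). Qed.

Lemma small_lt (C : R) (e : R) : 0 < e -> 0 <= C ->
  exists n, forall m, (n <= m)%N -> C * m.+1%:R^-1 < e.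
Proof.
move=> e0 C0; have C1 : 0 < C + 1 by rewrite ltr_wpDl.
have [|n Hn] := @invS_lt R (e / (C + 1)); first by rewrite divr_gt0.
exists n => m nm; have := @invS_le R _ _ nm.
have : 0 < m.+1%:R^-1 :> R by rewrite invr_gt0.
move: Hn; rewrite ltr_pdivlMr//; move: (n.+1%:R^-1) (m.+1%:R^-1) => p q h1 h2 h3.
have : q * (C + 1) <= p * (C + 1) by rewrite ler_wpM2r// ltW.
lra.
Qed.

(** Known on two dense sequences, the form is extended by continuity: here in the second variable,
    then in the first to the sequence that [d] assigns to [ZY t]. *)
Lemma pairing_Ah_meas l m : meas_on B (fun t => jY t (gY l t) (t.2 m)).
Proof.
apply: (meas_on_approx (T := T3m R) (D := B) (I := nat) (S := fun n i t => distC (d i t.1.2) (t.2 m) < n.+1%:R^-1)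
   (r := fun i t => jY t (gY l t) (d i t.1.2))) => //.
- by move=> n i; apply: meas_dist_lt; [exact: d_Y_measC|exact: Ah_measC].
- move=> t n Bt; apply: (d_dense hd); first exact: Ah_in.
  by rewrite invr_gt0.
move=> t Bt e e0; have [n Hn] := small_lt e0 (normC_ge0 (gY l t)).
exists n => k i nk Hi; apply: le_lt_trans (Hn k nk).
have Gl := gY_in l Bt.
apply: (le_trans (iso_lip (isoY Bt) Gl Gl (d_in hd i t.1.2) (Ah_in m Bt))).
by rewrite distCxx mul0r addr0 ler_wpM2l ?normC_ge0// ltW.
Qed.

Lemma dZY_measC n : measC B (fun t => d n (ZY t)).
Proof. by apply: (d_measC hd n mB) => E; exact: (closure_effros mgY HZY). Qed.

Lemma pairing_dZY_meas n m : meas_on B (fun t => jY t (d n (ZY t)) (t.2 m)).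
Proof.
apply: (meas_on_approx (T := T3m R) (D := B) (I := nat) (S := fun k l t => distC (gY l t) (d n (ZY t)) < k.+1%:R^-1)
   (r := fun l t => jY t (gY l t) (t.2 m))) => //.
- by move=> k l; apply: meas_dist_lt => //; exact: dZY_measC.
- by move=> l; exact: pairing_Ah_meas.
- by move=> t k Bt; apply: ((HZY Bt _).1 (d_in hd n (ZY t))); rewrite invr_gt0.
move=> t Bt e e0; have [k Hk] := small_lt e0 (normC_ge0 (t.2 m)).
exists k => i l ki Hl; apply: le_lt_trans (Hk i ki).
apply: (le_trans (iso_lip (isoY Bt) (gY_in l Bt) (d_in hd n (ZY t)) (Ah_in m Bt) (Ah_in m Bt))).
by rewrite distCxx mulr0 add0r mulrC ler_wpM2l ?normC_ge0// ltW.
Qed.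

(** The adjoint is located among the [gX i t] by its values at the [d k t.1.1], which are the
    measurable numbers [jY t (d n (ZY t)) (t.2 k)]; [dual_bound_mu] turns closeness of these values
    into closeness in norm. *)
Lemma Ab_measC n : measC B (fun t => Ab t (d n (ZY t))).
Proof.
apply: (measC_approx mB (I := nat) (S := fun m i t => forall k,
    `|jX t (gX i t) (d k t.1.1) - jY t (d n (ZY t)) (t.2 k)| <= m.+1%:R^-1 * mu (d k t.1.1))
  (Psi := gX)) => //.
- move=> m i; apply: (measP_ext (T := T3m R) (P := fun t => B t /\ forall k, B t /\
    `|jX t (gX i t) (d k t.1.1) - jY t (d n (ZY t)) (t.2 k)| <= m.+1%:R^-1 * mu (d k t.1.1))) => [t|].
    by split=> -[Bt H]; split => // k; have := H k; tauto.
  apply: measP_and => //; apply: measP_all => k; apply: meas_on_le.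
    by apply: meas_on_norm; apply: meas_onB => //; exact: pairing_dZY_meas.
  apply: meas_onZ; apply: meas_on_max; first exact: meas_on_cst.
  by apply: measC_norm => //; exact: d_X_measC.
- move=> t m Bt; have Zd := d_in hd n (ZY t); have [ZAb AbE] := adjA Bt Zd.
  have [|i Hi] := (HZX Bt _).1 ZAb m.+1%:R^-1; first by rewrite invr_gt0.
  exists i => k; have Xk := d_in hd k t.1.1.
  have := AbE _ Xk; have [_ [_ [_ ->]]] := cA Bt => <-.
  apply: (le_trans (iso_lip (isoX Bt) (gX_in i Bt) ZAb Xk Xk)).
  rewrite distCxx mulr0 add0r ler_pM ?distC_ge0 ?normC_ge0 ?mu_ge//.
  exact: ltW.
move=> t Bt e e0; have [m Hm] := small_lt e0 ler01.
exists m => k i mk Hi; apply: le_lt_trans (Hm k mk); rewrite mul1r.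
have Zd := d_in hd n (ZY t); have [ZAb AbE] := adjA Bt Zd.
have [jd _] := isoX Bt.
have i0 : 0 <= k.+1%:R^-1 :> R by rewrite invr_ge0.
apply: (iso_dist (isoX Bt) i0 (gX_in i Bt) ZAb) => f Xf.
apply: (dual_bound_mu (x := d^~ t.1.1) i0 (d_in hd ^~ t.1.1) (@d_dense _ _ hd t.1.1)
   (in_dualB (jd _ (gX_in i Bt)) (jd _ ZAb))) => // k' /=.
have := AbE _ (d_in hd k' t.1.1); have [_ [_ [_ ->]]] := cA Bt => ->.
exact: Hi.
Qed.

Lemma adjoint_map_measurable (E : set (T3 R)) : T3_meas E -> measurable [set t | B t /\ E (adjoint_map t)].
Proof.
move: E; apply: measurable_generated => // _ [[E mE ->]|[[E mE ->]|[n [E mE ->]]]] /=.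
- exact: (closure_effros mgY HZY mE).
- exact: (closure_effros mgX HZX mE).
- exact: (measC_borel mB dn_dense' (Ab_measC n) mE).
Qed.

Definition gen5 : set (set (T5 R)) :=
  [set S | (exists2 E, T3_meas E & S = [set u : T5 R | E u.1.1])
            \/ (exists2 E, borelC E & S = [set u : T5 R | E u.1.2])
            \/ (exists2 E, borelC E & S = [set u : T5 R | E u.2])].

Definition T5m := g_sigma_algebraType gen5.

Let C : set T5m := Cset B adjoint_map.
Let B5 : set T5m := [set u | B u.1.1].

Lemma B5_measurable : measurable B5.
Proof. by apply: sub_sigma_algebra; left; exists B. Qed.

Lemma lift_meas_on (f : T3m R -> R) : meas_on B f -> meas_on B5 (fun u => f u.1.1).
Proof.
by move=> mf c; apply: sub_sigma_algebra; left; exists [set t | B t /\ f t < c] => //; exact: mf.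
Qed.

Lemma lift_measC (Psi : T3m R -> CD R) : measC B Psi -> measC B5 (fun u => Psi u.1.1).
Proof. by move=> mPsi b; apply: (lift_meas_on (f := fun t => cfun (Psi t) b)); exact: mPsi. Qed.

Lemma proj1_measC : measC B5 (fun u => u.1.2).
Proof.
apply: borel_measC => E mE; apply: measurableI; first exact: B5_measurable.
by apply: sub_sigma_algebra; right; left; exists E.
Qed.

Lemma proj2_measC : measC B5 (fun u => u.2).
Proof.
apply: borel_measC => E mE; apply: measurableI; first exact: B5_measurable.
by apply: sub_sigma_algebra; right; right; exists E.
Qed.

Lemma in_closure_nat (u : nat -> CD R) f :
  in_closure u f <-> forall n, exists l, distC (u l) f < n.+1%:R^-1.
Proof.
split=> [H n|H e e0]; first by apply: H; rewrite invr_gt0.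
have [n Hn] := invS_lt e0; have [l Hl] := H n; exists l; exact: lt_trans Hn.
Qed.

Lemma closure_lift_measurable (g : nat -> T3m R -> CD R) (Psi : T5m -> CD R) :
  (forall l, measC B (g l)) -> measC B5 Psi ->
  measurable [set u | B5 u /\ in_closure (g^~ u.1.1) (Psi u)].
Proof.
move=> mg mPsi; apply: (measP_ext (T := T5m) (P := fun u => B5 u /\ forall n : nat, exists l,
   B5 u /\ distC (g l u.1.1) (Psi u) < n.+1%:R^-1)) => [u|].
  split=> -[Bu]; [move=> H|move=> /in_closure_nat H]; split => //.
    by apply/in_closure_nat => n; have [l []] := H n; exists l.
  by move=> n; have [l Hl] := H n; exists l.
apply: measP_and; first exact: B5_measurable.
apply: measP_all => n; apply: measP_ex => l.
have := measC_dist B5_measurable (lift_measC (mg l)) mPsi; apply.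
Qed.

Lemma Cset_measurable : measurable C.
Proof.
apply: (measP_ext (T := T5m) (P := fun u => (B5 u /\ in_closure (gY^~ u.1.1) u.1.2) /\
  (B5 u /\ in_closure (fun k => d k u.1.1.1.1) u.2))) => [u|].
  split=> [[[Bu /(HZY Bu) H1] [_ /(d_closure hd) H2]]|[Bu [/(HZY Bu) H1 /(d_closure hd) H2]]].
    by [].
  by [].
apply: measP_and; first exact: (closure_lift_measurable mgY proj1_measC).
exact: (closure_lift_measurable (g := fun k t => d k t.1.1) d_X_measC proj2_measC).
Qed.

Definition pairing (t : T3 R) (g x : CD R) : R := jY t g (A t x).

Lemma pairing_meas_on : meas_on C (fun u => pairing u.1.1 u.1.2 u.2).
Proof.
have CB : C `<=` B5 by move=> u [].
apply: (meas_on_approx (T := T5m) (D := C) (I := (nat * nat)%type) (S := fun n lk u =>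
    distC (gY lk.1 u.1.1) u.1.2 < n.+1%:R^-1 /\ distC (d lk.2 u.1.1.1.1) u.2 < n.+1%:R^-1)
  (r := fun lk u => jY u.1.1 (gY lk.1 u.1.1) (u.1.1.2 lk.2))) => //.
- exact: Cset_measurable.
- move=> n [l k] /=; apply: (measP_ext (T := T5m) (P := fun u => C u /\
     ((B5 u /\ distC (gY l u.1.1) u.1.2 < n.+1%:R^-1) /\
      (B5 u /\ distC (d k u.1.1.1.1) u.2 < n.+1%:R^-1)))) => [u|].
    by split=> [[Cu [[_ ?] [_ ?]]]|[/[dup]/CB Bu Cu [? ?]]].
  apply: measP_and; first exact: Cset_measurable.
  apply: measP_and.
    have := measC_dist B5_measurable (lift_measC (mgY l)) proj1_measC; apply.
  have := measC_dist B5_measurable (lift_measC (d_X_measC k)) proj2_measC; apply.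
- move=> [l k] /=; apply: (meas_on_sub CB Cset_measurable).
  exact: (lift_meas_on (pairing_Ah_meas l k)).
- move=> [[t g] x] n [Bt [Zg Xx]] /=.
  have n0 : 0 < n.+1%:R^-1 :> R by rewrite invr_gt0.
  have [l Hl] := (HZY Bt _).1 Zg _ n0; have [k Hk] := d_dense hd Xx n0.
  by exists (l, k).
move=> [[t g] x] [Bt [Zg Xx]] /= e e0.
have [L L0 [AL Alip]] := codes_lip (cA Bt); have [AY [_ [_ Ad]]] := cA Bt.
(* The factor that [iso_lip] puts in front of [1/(m+1)], using [normC (gY l t) <= normC g + 1]. *)
have C0 : 0 <= (normC g + 1) * L + normC (A t x).
  by rewrite addr_ge0 ?normC_ge0// mulr_ge0// addr_ge0 ?normC_ge0.
have [n Hn] := small_lt e0 C0; exists n => m [l k] nm /= [Hl Hk].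
apply: le_lt_trans (Hn m nm).
apply: (le_trans (iso_lip (isoY Bt) (gY_in l Bt) Zg (Ah_in k Bt) (AY _ Xx))).
rewrite mulrDl; apply: lerD.
  rewrite -mulrA; apply: ler_pM; [exact: normC_ge0|exact: distC_ge0| |].
    have := normC_dist (gY l t) g; rewrite ler_norml => /andP[_].
    have : m.+1%:R^-1 <= 1 :> R by rewrite invf_le1// ler1n.
    move: Hl; move: (m.+1%:R^-1) => i; lra.
  rewrite -Ad; apply: (le_trans (Alip _ _ (d_in hd k t.1.1) Xx)).
  by rewrite ler_wpM2l// ltW.
by rewrite mulrC ler_wpM2l ?normC_ge0// ltW.
Qed.

Lemma pairing_measurable (U : set R) : borelR U ->
  measurable [set u | C u /\ U (pairing u.1.1 u.1.2 u.2)].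
Proof.
have mC := Cset_measurable; move: U; apply: measurable_generated => // U /open_measurable mU.
have /(_ mC U mU) := (meas_onP _ mC).1 pairing_meas_on.
by [].
Qed.

End AdjointMap.

Unset Implicit Arguments.

Theorem theorem1p7 (R : realType) (d : nat -> SB R -> CD R) (hd : dseq_ok d)
  (B : set (T3 R)) (hBmeas : T3_meas B) (hBsub : B `<=` LSD d) :
  exists F : T3 R -> T3 R,
    (* F is a Borel map on B with values in L *)
    (forall E, T3_meas E -> T3_meas (B `&` F @^-1` E)) /\
    (forall t, B t -> Lset d (F t)) /\
    (* the operator coded by F t is isometric to the adjoint of the one coded by t *)
    (forall t, B t -> forall A Ab : CD R -> CD R,
        codes d t.1.1 t.1.2 t.2 A -> codes d (F t).1.1 (F t).1.2 (F t).2 Ab ->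
        isometric_to_adjoint t.1.1 t.1.2 (F t).1.2 (F t).1.1 A Ab) /\
    T5_meas (Cset B F) /\
    exists p : T3 R -> CD R -> CD R -> R,
      (forall U, borelR U -> T5_meas (Cset B F `&` [set u | U (p u.1.1 u.1.2 u.2)])) /\
      (forall t, B t ->
         bilin_cont (sbset (F t).1.1) (sbset t.1.1) (p t) /\
         forall A : CD R -> CD R, codes d t.1.1 t.1.2 t.2 A ->
           isometric_to_adjoint' t.1.1 t.1.2 (F t).1.1 A (p t)).
Proof.
have mB : measurable (B : set (T3m R)) by exact: hBmeas.
have [|vX [mvX vXdual vXdense]] := @measurable_dual_selection R d hd 0 isT B mB.
  by move=> t /hBsub[_ []].
have [|vY [mvY vYdual vYdense]] := @measurable_dual_selection R d hd 1 isT B mB.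
  by move=> t /hBsub[_ []].
have [gX [ZX [jX [mgX HZX isoX jgX]]]] := @measurable_dual_space R _ (T3m R) B
  (fun t => t.1.1) (fun k t => d k t.1.1) vX mB (d_X_measC hd mB)
  (fun t k => d_in hd k t.1.1) (fun t => @d_dense _ _ hd t.1.1) mvX vXdual vXdense.
have [gY [ZY [jY [mgY HZY isoY jgY]]]] := @measurable_dual_space R _ (T3m R) B
  (fun t => t.1.2) (fun k t => d k t.1.2) vY mB (d_Y_measC hd mB)
  (fun t k => d_in hd k t.1.2) (fun t => @d_dense _ _ hd t.1.2) mvY vYdual vYdense.
have mjX l k : meas_on (B : set (T3m R)) (fun t => jX t (gX l t) (d k t.1.1)).
  by apply: meas_on_ext (mvX l k) => t Bt; rewrite jgX.
have mjY l k : meas_on (B : set (T3m R)) (fun t => jY t (gY l t) (d k t.1.2)).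
  by apply: meas_on_ext (mvY l k) => t Bt; rewrite jgY.
(* No measurability is asked of the choices of [A] and [Ab]: on the relevant spaces they are
   determined by [t] and the isometries already fixed. *)
have /choice[A cA] : forall t, exists A, B t -> codes d t.1.1 t.1.2 t.2 A.
  move=> t; have [/hBsub[Lt _]|nB] := pselect (B t); last by exists id.
  by have [A HA] := coded_operator hd Lt; exists A.
have /choice[Ab adjA] : forall t, exists Ab, B t ->
    is_adjoint t.1.1 (ZX t) (ZY t) (jX t) (jY t) (A t) Ab.
  move=> t; have [Bt|nB] := pselect (B t); last by exists id.
  by have [Ab HAb] := adjoint_exists (isoX t Bt) (isoY t Bt) (cA t Bt); exists Ab.
exists (adjoint_map d ZX ZY Ab); split; last split; last split; last split.
- move=> E mE; exact: (adjoint_map_measurable hd mB mgX mgY HZX HZY isoX isoY mjX mjY cA adjA mE).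
- by move=> t Bt; exact: (adjoint_Lset (isoX t Bt) (isoY t Bt) (cA t Bt) (adjA t Bt) hd).
- move=> t Bt A' Ab'.
  exact: (adjoint_isometric (isoX t Bt) (isoY t Bt) (cA t Bt) (adjA t Bt) hd).
- exact: (Cset_measurable hd mB ZX Ab mgY HZY).
exists (pairing jY A); split.
  by move=> U mU; exact: (pairing_measurable hd mB ZX Ab mgY HZY isoY mjY cA mU).
move=> t Bt; split; first exact: (pairing_bilin_cont (isoY t Bt) (cA t Bt)).
by move=> A'; exact: (pairing_isometric (isoY t Bt) (cA t Bt) hd).
Qed.
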